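(* Let $G\subset \mathrm{Diff}_+^2(\mathbb S^1)$ be a finitely generated, locally discrete subgroup without finite orbits in $\mathbb S^1$. Let $\Lambda$ be its unique minimal set and assume that $G$ satisfies property $(\star)$ or $(\Lambda\star)$. Then $$\dim_{\mathrm H}\Lambda=\delta_2(G).$$
   Context: $\mathrm{Diff}_+^2(\mathbb S^1)$ is the group of orientation-preserving $C^2$ circle diffeomorphisms. A minimal set is a nonempty closed $G$-invariant set, minimal for inclusion; it is exceptional if homeomorphic to a Cantor set. $\mathrm{NE}=\{x\in\mathbb S^1: g'(x)\le1\ \forall g\in G\}$. Property $(\star)$: $G$ acts minimally on $\mathbb S^1$ and for every $x\in\mathrm{NE}$ there exist $g_+,g_-\in G$ with $g_+(x)=g_-(x)=x$ such that $x$ is isolated from the right in the fixed point set $\mathrm{Fix}(g_+)$ and isolated from the left in $\mathrm{Fix}(g_-)$. Property $(\Lambda\star)$: $G$ admits an exceptional minimal set $\Lambda$ and for every $x\in\mathrm{NE}\cap\Lambda$ there exist such $g_+,g_-\in G$. $G$ is locally discrete if for every interval $I\subset\mathbb S^1$ there is no sequence $(g_n)\subset G$ of distinct elements with $g_n|_I\to\mathrm{id}$ in the $C^1$-topology. For an interval $I$, $\widetilde\varkappa(g,I)=\sup_{x\ne y\in I}\frac{|\log g'(x)-\log g'(y)|}{d(x,y)}$. The $C^2$-dynamical critical exponent is $$\delta_2(G)=\lim_{\varepsilon\to0^+}\lim_{C\to+\infty}\limsup_{n\to+\infty}\frac1n\log\#\{g\in G:\exists x\in\Lambda,\ g'|_{B(x,\varepsilon)}\ge2^{-n},\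 \widetilde\varkappa(g,B(x,\varepsilon))\le C\},$$ with $\log$ to base $2$. *)

(* Defs.v *)
From HB Require Import structures.
From mathcomp Require Import all_boot all_order all_algebra.
From mathcomp Require Import ring_quotient.
From mathcomp Require Import all_classical all_reals all_analysis.
From mathcomp Require Import lra.

Set Implicit Arguments.
Unset Strict Implicit.
Unset Printing Implicit Defensive.

Import Order.TTheory GRing.Theory Num.Theory.
Import numFieldNormedType.Exports.

Local Open Scope classical_set_scope.
Local Open Scope ring_scope.

Section Circle.
Context (R : realType).

Definition integers : zmodClosed R :=
  GRing.ZmodClosed.clone R Num.int_num_subdef _.

Definition circle : Type := Quotient.quot integers.

HB.instance Definition _ := GRing.Zmodule.on circle.

Definition cproj (t : R) : circle := \pi_(Quotient.quot integers)%qT t.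

(* The representative of a class in [-1/2, 1/2[. *)
Definition crep (z : circle) : R :=
  let t : R := repr (z : Quotient.quot integers) in
  t - (Num.floor (t + 2^-1))%:~R.

(* The quotient distance of R/Z: crep picks a representative of least absolute
   value. *)
Definition cdist (x y : circle) : R := `|crep (x - y)|.

Lemma cprojD : {morph cproj : s t / s + t}.
Proof. by move=> s t; rewrite /cproj -raddfD. Qed.

Lemma cprojN : {morph cproj : t / - t}.
Proof. by move=> t; rewrite /cproj -raddfN. Qed.

Lemma cproj_eq0 (t : R) : cproj t = 0 <-> exists m : int, t = m%:~R.
Proof.
split=> [t0|[m ->]].
  have /eqP : cproj t == cproj 0 by rewrite t0 /cproj raddf0.
  move/eqP; rewrite -Quotient.idealrBE subr0 => /intrP[m tm]; by exists m.
have -> : (0 : circle) = cproj 0 by rewrite /cproj raddf0.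
by apply/eqP; rewrite -Quotient.idealrBE subr0; apply/intrP; exists m.
Qed.

Lemma crepK : cancel crep cproj.
Proof.
move=> z; rewrite /crep /= cprojD cprojN.
have -> : cproj (Num.floor (repr (z : Quotient.quot integers) + 2^-1))%:~R = 0.
  by apply/cproj_eq0; eexists.
by rewrite oppr0 addr0 /cproj reprK.
Qed.

Lemma crep_itv (z : circle) : - 2^-1 <= crep z < 2^-1.
Proof.
rewrite /crep; set t := repr _.
have := Num.Theory.floor_itv (t + 2^-1).
by rewrite intrD => /andP[]; lra.
Qed.

Lemma crep_min (t : R) : `|crep (cproj t)| <= `|t|.
Proof.
have [m tm] : exists m : int, crep (cproj t) - t = m%:~R.
  by apply/cproj_eq0; rewrite cprojD cprojN crepK subrr.
have := crep_itv (cproj t); set u := crep _ in tm *.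
have -> : t = u - m%:~R by rewrite -tm; lra.
have [->|m0] := eqVneq m 0; first by rewrite subr0.
move=> /andP[u1 u2].
have : 1 <= `|m%:~R : R|.
  by rewrite norm_intr_ge1 ?intr_int// intr_eq0.
have := lerB_dist m%:~R u; rewrite distrC => h1 h2.
have : `|u| <= 2^-1 by rewrite ler_norml u1 ltW.
lra.
Qed.

Fact cdistxx x : cdist x x = 0.
Proof.
rewrite /cdist subrr; have -> : (0 : circle) = cproj 0 by rewrite /cproj raddf0.
by apply/eqP; rewrite eq_le normr_ge0 andbT -[leRHS](normr0 R) crep_min.
Qed.

Fact cdist_positivity x y : cdist x y = 0 -> x = y.
Proof.
move/normr0_eq0 => xy0; apply/eqP; rewrite -subr_eq0 -[_ - _]crepK xy0.
by rewrite /cproj raddf0.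
Qed.

Fact cdist_sym x y : cdist x y = cdist y x.
Proof.
suff H a b : cdist a b <= cdist b a by apply/eqP; rewrite eq_le !H.
rewrite /cdist -[a - b]opprB -[X in - X]crepK -cprojN.
by rewrite -[leRHS]normrN crep_min.
Qed.

Fact cdist_triangle y x z : cdist x z <= cdist x y + cdist y z.
Proof.
rewrite /cdist (le_trans _ (ler_normD _ _))//.
have -> : x - z = cproj (crep (x - y) + crep (y - z)).
  by rewrite cprojD !crepK addrA subrK.
exact: crep_min.
Qed.

HB.instance Definition _ := Choice.on circle.
HB.instance Definition _ :=
  @isMetric.Build R circle cdist cdistxx cdist_positivity cdist_sym
    cdist_triangle.

End Circle.

Arguments cproj {R}.
Arguments crep {R}.

Section Diffeomorphisms.
Context {R : realType}.
Local Notation S1 := (circle R).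
Implicit Types (g : S1 -> S1) (x : S1) (G : set (S1 -> S1)) (A : set S1).

(* The expression of g in the local coordinates h |-> x + h at x and
   h |-> g x + h at g x. *)
Definition in_chart g x (h : R) : R := crep (g (x + cproj h) - g x).

Definition cderiv g x : R := derive1 (in_chart g x) 0.

(* Derivability of in_chart g x at 0 forces g to be continuous at x. *)
Definition C2_circle g : Prop :=
  [/\ forall x, derivable (in_chart g x) 0 1,
      forall t : R, derivable (cderiv g \o cproj) t 1 &
      continuous (derive1 (cderiv g \o cproj))].

Definition Diff2_plus : set (S1 -> S1) :=
  [set g | [/\ C2_circle g,
               exists g', [/\ C2_circle g', cancel g g' & cancel g' g] &
               forall x, 0 < cderiv g x]].

Definition subgroup G : Prop :=
  [/\ G `<=` Diff2_plus, G id,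
      forall f g, G f -> G g -> G (f \o g) &
      forall g, G g -> exists g', [/\ G g', cancel g g' & cancel g' g]].

Definition finitely_generated G : Prop :=
  exists S, [/\ finite_set S, S `<=` G &
                forall H, subgroup H -> S `<=` H -> G `<=` H].

Definition group_orbit G x : set S1 := [set g x | g in G].

Definition invariant G A : Prop := forall g, G g -> g @` A `<=` A.

Definition minimal_set G A : Prop :=
  [/\ A !=set0, closed A, invariant G A &
      forall B, B !=set0 -> closed B -> invariant G B -> B `<=` A -> B = A].

Definition acts_minimally G : Prop := minimal_set G [set: S1].

Definition homeomorphic_to_Cantor A : Prop :=
  exists (f : cantor_space -> S1) (f' : S1 -> cantor_space),
    [/\ continuous f, {within A, continuous f'}, range f `<=` A,
        cancel f f' & {in A, cancel f' f}].

Definition exceptional_minimal_set G A : Prop :=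
  minimal_set G A /\ homeomorphic_to_Cantor A.

Definition NE G : set S1 := [set x | forall g, G g -> cderiv g x <= 1].

Definition Fix g : set S1 := [set x | g x = x].

Definition isolated_right A x : Prop :=
  exists2 e : R, 0 < e & forall t, 0 < t < e -> ~ A (x + cproj t).

Definition isolated_left A x : Prop :=
  exists2 e : R, 0 < e & forall t, 0 < t < e -> ~ A (x - cproj t).

Definition has_isolating_fixers G x : Prop :=
  (exists gp, [/\ G gp, gp x = x & isolated_right (Fix gp) x]) /\
  (exists gm, [/\ G gm, gm x = x & isolated_left (Fix gm) x]).

Definition property_star G : Prop :=
  acts_minimally G /\ forall x, NE G x -> has_isolating_fixers G x.

Definition property_Lambda_star G : Prop :=
  exists L, exceptional_minimal_set G L /\
    forall x, (NE G `&` L) x -> has_isolating_fixers G x.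

Definition circle_interval A : Prop :=
  exists J : set R, [/\ is_interval J, (interior J) !=set0, set_inj J cproj &
                        A = cproj @` J].

(* Convergence to the identity in the C^1 topology on A. *)
Definition C1_cvg_id (gs : nat -> S1 -> S1) A : Prop :=
  forall e : R, 0 < e -> \forall n \near \oo, forall x, A x ->
    mdist (gs n x) x < e /\ `|cderiv (gs n) x - 1| < e.

Definition locally_discrete G : Prop :=
  forall I, circle_interval I ->
    ~ exists gs : nat -> S1 -> S1,
        [/\ injective gs, forall n, G (gs n) & C1_cvg_id gs I].

End Diffeomorphisms.

Section HausdorffDimension.
Context {R : realType} {T : metricType R}.
Implicit Types (A U : set T).
Local Open Scope ereal_scope.

(* The maximum with 0 makes the diameter of the empty set 0 instead of -oo. *)
Definition diameter U : \bar R :=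
  maxe 0 (ereal_sup [set (mdist p.1 p.2)%:E | p in U `*` U]).

Definition hausdorff_premeasure (s delta : R) A : \bar R :=
  ereal_inf [set \sum_(0 <= i <oo) poweR (diameter (U i)) s
            | U in [set U : nat -> set T |
                A `<=` \bigcup_i U i /\ forall i, diameter (U i) <= delta%:E]].

Definition hausdorff_measure (s : R) A : \bar R :=
  ereal_sup [set hausdorff_premeasure s delta A | delta in `]0%R, +oo[].

(* Only s > 0 is considered, so that empty sets in a cover contribute 0. *)
Definition hausdorff_dimension A : \bar R :=
  ereal_inf [set s%:E | s in [set s : R | (0 < s)%R /\
                                          hausdorff_measure s A = 0]].

End HausdorffDimension.

Section CriticalExponent.
Context {R : realType}.
Local Notation S1 := (circle R).
Implicit Types (g : S1 -> S1) (I L : set S1) (G : set (S1 -> S1)).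

Definition log2 (x : R) : R := ln x / ln 2.

Definition elog2 (x : \bar R) : \bar R := (lne x * ((ln 2)^-1)%:E)%E.

Definition distortion g I : \bar R :=
  ereal_sup [set (`|log2 (cderiv g p.1) - log2 (cderiv g p.2)|
                    / mdist p.1 p.2)%:E
            | p in [set p : S1 * S1 | [/\ I p.1, I p.2 & p.1 != p.2]]].

Definition expanding_elements G L (eps C : R) (n : nat) : set (S1 -> S1) :=
  [set g | G g /\ exists2 x, L x &
    (forall y, ball x eps y -> 2 ^- n <= cderiv g y) /\
    (distortion g (ball x eps) <= C%:E)%E].

(* The number counted is nondecreasing in C and nonincreasing in eps, so both
   limits exist in \bar R. *)
Definition delta2 G L : \bar R :=
  lim (lim (limn_esup (fun n : nat =>
              (n%:R^-1)%:E * elog2 (counting (expanding_elements G L eps C n)))%E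
       @[C --> +oo%R])
  @[eps --> 0^'+]).

End CriticalExponent.

(* Main.v *)
Require Import Defs.
From HB Require Import structures.
From mathcomp Require Import all_boot all_order all_algebra.
From mathcomp Require Import all_classical all_reals all_analysis.
From mathcomp Require Import ring lra zify.

Set Implicit Arguments.
Unset Strict Implicit.
Unset Printing Implicit Defensive.

Import Order.TTheory GRing.Theory Num.Theory.
Import numFieldNormedType.Exports.

Local Open Scope classical_set_scope.
Local Open Scope ring_scope.

(** The number of elements counted by [expanding_elements] grows with [C] and
    as [eps] decreases, so the critical exponent is the supremum, over all
    [eps] and [C], of the growth rates taken with [eps] and [C] fixed
    ([delta2E]).  Each growth rate is compared with the dimension.

    Dimension at most exponent.  There is a fixed [eps] such that every point
    of the minimal set, outside a countable set, is the value [F x] at a point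
    [x] of the minimal set of elements [F] which contract the ball of radius
    [eps] about [x] as strongly as desired, with a distortion bounded
    independently of [F] ([iterated_branches]).  If the derivative of [F] is of
    size [2^-n], then [F] is among the elements counted at time [n]; for
    [delta2 < s' < s] there are at most [2^(s' n)] of them, so the images of
    small balls form covers for which the sum of the diameters to the power
    [s] is the tail of a geometric series ([limit_set_null]).  The maps [F] are
    compositions of contracting steps.  Near a point where some [g] has
    derivative larger than [1], the inverse of [g] is such a step.  Near a
    point where no element expands, a fixed point isolated on one side
    provides one: up to exchanging [g] and its inverse, the iterates of [g]
    converge to the fixed point, their distortion on a fundamental domain is
    controlled by the total length of its images, and hence high iterates
    contract it ([parabolic_expansion]).  Compactness leaves finitely many
    centres for which no step is available, and their orbits form the
    countable exceptional set.  Distortions of successive contractions add up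
    like a geometric series ([inverse_branch_comp]).

    Exponent at most dimension.  Suppose that the [s]-dimensional measure of
    the minimal set vanishes, and consider the elements whose derivative on a
    fixed ball is comparable to [v], with a uniform bound on its relative
    variation.  Boundedly many of them send the centre to a given interval of
    length of order [v]: otherwise, by the pigeonhole principle, two of them
    would be so close after rescaling that their quotient would be close to
    the identity, against local discreteness ([overlap_bounded]).  So a fixed
    proportion of these elements have images separated at the scale [v].  By
    minimality finitely many elements suffice to bring these images back into
    the ball, and this produces an iterated function system which preserves
    the minimal set and shrinks distances at most by a factor of order [v].
    If the number of its maps were large compared with [v^-s], every cover
    would have a sum of diameters to the power [s] bounded below
    ([ifs_hausdorff_positive]).  Hence there are at most [A v^-s] such elements
    ([scales_by_counting]), and summing over dyadic [v] down to [2^-n] bounds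
    the growth rate by [s] ([growth_rate_le_dimension]).

    When the hypothesis on fixers concerns some exceptional minimal set, this
    set is the given one, since there is only one minimal set when no orbit is
    finite ([minimal_set_unique]). *)

(** * Real calculus *)

Section RealCalculus.
Context {R : realType}.
Implicit Types (f F : R -> R) (a b x y : R).

Lemma derive_lower_bound F f a b m : a <= b ->
  (forall x, is_derive x 1 F (f x)) ->
  (forall x, a < x < b -> m <= f x) -> m * (b - a) <= F b - F a.
Proof.
rewrite le_eqVlt => /orP[/eqP-> _ _|ab dF mf]; first by rewrite !subrr mulr0.
have [|c cab ->] := @MVT R F f a b ab (fun x _ => dF x).
  apply: continuous_subspaceT => x; apply: differentiable_continuous.
  by apply/derivable1_diffP; case: (dF x).
by rewrite ler_wpM2r ?subr_ge0 ?(ltW ab)//; apply: mf; rewrite in_itv in cab.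
Qed.

Lemma derive_upper_bound F f a b m : a <= b ->
  (forall x, is_derive x 1 F (f x)) ->
  (forall x, a < x < b -> f x <= m) -> F b - F a <= m * (b - a).
Proof.
rewrite le_eqVlt => /orP[/eqP-> _ _|ab dF mf]; first by rewrite !subrr mulr0.
have [|c cab ->] := @MVT R F f a b ab (fun x _ => dF x).
  apply: continuous_subspaceT => x; apply: differentiable_continuous.
  by apply/derivable1_diffP; case: (dF x).
by rewrite ler_wpM2r ?subr_ge0 ?(ltW ab)//; apply: mf; rewrite in_itv in cab.
Qed.

Lemma derive_pos_lt F f a b : a < b ->
  (forall x, is_derive x 1 F (f x)) -> (forall x, 0 < f x) -> F a < F b.
Proof.
move=> ab dF f0; have [|c cab e] := @MVT R F f a b ab (fun x _ => dF x).
  apply: continuous_subspaceT => x; apply: differentiable_continuous.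
  by apply/derivable1_diffP; case: (dF x).
by rewrite -subr_gt0 e mulr_gt0 ?subr_gt0.
Qed.

Lemma is_derive_continuous F f :
  (forall x, is_derive x 1 F (f x)) -> continuous F.
Proof.
move=> dF x; apply: differentiable_continuous.
by apply/derivable1_diffP; case: (dF x).
Qed.

(** The integral from [-n-1] is a primitive on the half line to the right of
    [-n-1]; normalized to vanish at [0], these primitives agree where they are
    all defined and glue together. *)
Lemma continuous_antiderivative f : continuous f ->
  exists F, forall x, is_derive x 1 F (f x).
Proof.
move=> cf.
pose P n x := (\int[lebesgue_measure]_(t in `[(- n.+1%:R)%R, x]) (f t))%R.
pose Q n x := P n x - P n 0.
have dQ n x : - n.+1%:R < x -> is_derive x 1 (Q n) (f x).
  move=> nx; have [||||dP P'] := @continuous_FTC1_closed R f (- n.+1%:R) x (x + 1).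
  - by rewrite ltrDl.
  - apply: continuous_compact_integrable; first exact: segment_compact.
    exact: continuous_subspaceT.
  - exact: nx.
  - exact: cf.
  have {P' dP} : is_derive x 1 (P n) (f x) by split; [exact: dP|rewrite -P' derive1E].
  rewrite /Q; move: (P n) => p dp; rewrite -[f x]subr0; exact: is_deriveB.
have Q0 n : Q n 0 = 0 by rewrite /Q subrr.
have dQQ n m x : - n.+1%:R < x -> (n <= m)%N -> is_derive x 1 (Q m - Q n) 0.
  move=> nx nm; have dn := dQ _ _ nx.
  have dm : is_derive x 1 (Q m) (f x).
    by apply: dQ; rewrite (le_lt_trans _ nx)// lerN2 ler_nat.
  by rewrite -(subrr (f x)); exact: is_deriveB.
have QQ n m x : - n.+1%:R < x -> (n <= m)%N -> Q m x = Q n x.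
  move=> nx nm.
  have n0 : - n.+1%:R < 0 :> R by rewrite ltrNl oppr0.
  have H a b : a <= b -> - n.+1%:R < a -> Q m b - Q n b = Q m a - Q n a.
    move=> ab na; apply/eqP; rewrite -subr_eq0; apply/eqP.
    have [||c _ E] := @MVT_segment R (Q m - Q n) (fun=> 0) a b ab.
    - move=> y; rewrite in_itv => /andP[ay _]; apply: dQQ => //.
      exact: lt_trans ay.
    - apply: derivable_within_continuous => y; rewrite in_itv => /andP[ay _].
      by have [] := dQQ n m y (lt_le_trans na ay) nm.
    - by move: E; rewrite mul0r !fctE opprB addrACA [X in _ + X]addrC => <-; lra.
  apply/eqP; rewrite -subr_eq0; apply/eqP.
  case: (leP x 0) => x0.
    by have := H _ _ x0 nx; rewrite !Q0 subrr => <-.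
  by rewrite (H _ _ (ltW x0) n0) !Q0 subrr.
pose N x := (Num.truncn `|x|).+2.
have Nx x : `|x| < (N x)%:R.
  by apply: lt_trans (truncnS_gt _) _; rewrite ltr_nat.
exists (fun x => Q (N x) x) => x.
have nx y : `|x - y| < 1 -> - (N x).+1%:R < y.
  have := Nx x; rewrite -[(N x).+1%:R]natr1 !ltr_norml; lra.
have := dQ (N x) x (nx x _); rewrite subrr normr0 => /(_ ltr01).
apply: near_eq_is_derive.
near=> y; have yx : `|x - y| < 1 by near: y; apply: cvgr_dist_lt => //; exact: cvg_id.
case: (leqP (N x) (N y)) => Nxy; first by apply/esym/QQ => //; exact: nx.
apply: QQ => //; last exact: ltnW.
by have := Nx y; rewrite -[(N y).+1%:R]natr1 !ltr_norml; lra.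
Unshelve. all: end_near. Qed.
End RealCalculus.

(** * The circle *)

Section CircleGeometry.
Context {R : realType}.
Local Notation S1 := (circle R).
Implicit Types (x y z : S1) (s t h : R).

Lemma cproj0 : cproj 0 = 0 :> S1.
Proof. by apply/cproj_eq0; exists 0. Qed.

Lemma cprojB s t : cproj (s - t) = cproj s - cproj t :> S1.
Proof. by rewrite cprojD cprojN. Qed.

Lemma cproj_eqP s t : cproj s = cproj t :> S1 <-> exists m : int, s - t = m%:~R.
Proof.
rewrite -cproj_eq0 cprojB; split=> [->|/eqP]; first by rewrite subrr.
by rewrite subr_eq0 => /eqP.
Qed.

Lemma cprojDz s (m : int) : cproj (s + m%:~R) = cproj s :> S1.
Proof. by apply/cproj_eqP; exists m; rewrite addrAC subrr add0r. Qed.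

Lemma small_int (m : int) : `|m%:~R : R| < 1 -> m = 0.
Proof.
move=> m1; apply/eqP; case: (eqVneq m 0) => // m0.
by have := @norm_intr_ge1 R m%:~R; rewrite intr_int intr_eq0 => /(_ isT m0); rewrite leNgt m1.
Qed.

Lemma cprojK t : - 2^-1 <= t < 2^-1 -> crep (cproj t : S1) = t.
Proof.
move=> t2; have /cproj_eqP[m tm] := crepK (cproj t : S1).
have := crep_itv (cproj t : S1) => r2.
have : `|m%:~R : R| < 1 by rewrite -tm ltr_norml; lra.
by move/small_int => m0; apply/eqP; rewrite -subr_eq0 tm m0.
Qed.

Lemma mdistE x y : mdist x y = `|crep (x - y)|. Proof. by []. Qed.

Lemma mdist_cproj_le s t : mdist (cproj s : S1) (cproj t) <= `|s - t|.
Proof. by rewrite mdistE -cprojB crep_min. Qed.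

(** The projection from the line is an isometry on intervals of length [1/2]. *)
Lemma mdist_cproj s t : `|s - t| <= 2^-1 -> mdist (cproj s : S1) (cproj t) = `|s - t|.
Proof.
wlog st : s t / s <= t => [H|].
  by case: (leP s t) => [/H//|/ltW/H]; rewrite metric_sym distrC.
rewrite metric_sym distrC mdistE -cprojB ger0_norm ?subr_ge0//.
rewrite le_eqVlt => /orP[/eqP->|h]; last by rewrite cprojK ?ger0_norm; lra.
suff -> : cproj 2^-1 = cproj (- 2^-1) :> S1 by rewrite cprojK ?normrN ?ger0_norm; lra.
by apply/cproj_eqP; exists 1; lra.
Qed.

Lemma mdist_le_half x y : mdist x y <= 2^-1.
Proof.
by rewrite mdistE ler_norml; have /andP[-> /ltW] := crep_itv (x - y).
Qed.

Lemma mdistD_cproj x h : mdist x (x + cproj h) <= `|h|.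
Proof. by rewrite metric_sym mdistE addrAC subrr add0r crep_min. Qed.

(** Shortest representatives: [h] is read off [crep]. *)
Lemma circle_chart x y : exists2 h, y = x + cproj h & `|h| = mdist x y.
Proof.
exists (crep (y - x)); last by rewrite metric_sym mdistE.
by rewrite crepK addrC subrK.
Qed.

Lemma circle_chart_cproj t y :
  exists s, [/\ y = cproj s, `|s - t| = mdist (cproj t) y & `|s - t| <= 2^-1].
Proof.
have [h -> hd] := circle_chart (cproj t) y; exists (t + h).
by rewrite cprojD addrAC subrr add0r -hd hd mdist_le_half.
Qed.

Lemma near_circleP x (P : S1 -> Prop) : (\forall y \near x, P y) <->
  exists2 r : R, 0 < r & forall y, mdist x y < r -> P y.
Proof.
split=> [/metricType_numDomainType.nbhs_mdistP[r/= r0 rP]|[r r0 rP]]; first by exists r => // y /rP.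
by apply/metricType_numDomainType.nbhs_mdistP; exists r => // y /rP.
Qed.

Lemma continuous_cproj : continuous (cproj : R -> S1).
Proof.
move=> t P /near_circleP[r r0 rP].
suff : \forall s \near t, P (cproj s) by [].
near=> s; apply: rP.
apply: (le_lt_trans (mdist_cproj_le t s)).
by near: s; apply: cvgr_dist_lt => //; exact: cvg_id.
Unshelve. all: end_near. Qed.

Lemma compact_circle : compact [set: S1].
Proof.
have -> : [set: S1] = cproj @` `[-2^-1, 2^-1].
  apply/seteqP; split=> // x _; exists (crep x); last exact: crepK.
  by rewrite /= in_itv/=; have /andP[-> /ltW] := crep_itv x.
apply: continuous_compact; last exact: segment_compact.
exact/continuous_subspaceT/continuous_cproj.
Qed.

Lemma closed_compact_circle (A : set S1) : closed A -> compact A.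
Proof. by move=> cA; apply: (subclosed_compact cA compact_circle). Qed.

Lemma circle_net (r : R) : 0 < r ->
  exists (M : nat) (z : 'I_M -> S1), forall x, exists i, mdist (z i) x < r.
Proof.
move=> r0; pose M := (Num.truncn r^-1).+1.
have Mr : r^-1 < M%:R by exact: truncnS_gt.
have M0 : 0 < M%:R :> R by rewrite ltr0n.
exists M, (fun i => cproj (- 2^-1 + i%:R / M%:R)) => x.
have := crep_itv x; have := crepK x; set t := crep x => <- t2.
pose j := Num.truncn ((t + 2^-1) * M%:R).
have /andP[j1 j2] : (j%:R <= (t + 2^-1) * M%:R < j.+1%:R).
  by apply: truncn_itv; rewrite mulr_ge0 ?ler0n//; lra.
have jM : (j < M)%N.
  rewrite -(ltr_nat R) (le_lt_trans j1)// -[ltRHS]mul1r ltr_pM2r//; lra.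
exists (Ordinal jM); rewrite /= (le_lt_trans (mdist_cproj_le _ _))// distrC ger0_norm.
  rewrite opprD addrA opprK -(ltr_pM2r M0) mulrBl divfK ?gt_eqF//.
  rewrite (@lt_trans _ _ 1)//; last by rewrite -ltr_pdivrMl// mulr1.
  by rewrite ltrBlDl natr1.
by rewrite opprD addrA opprK subr_ge0 ler_pdivrMr.
Qed.

End CircleGeometry.

(** * Derivatives in charts and lifts to the line *)

Section Lifts.
Context {R : realType}.
Local Notation S1 := (circle R).
Implicit Types (x y z : S1) (s t h : R) (f g : S1 -> S1).

Lemma crep0 : crep (0 : S1) = 0 :> R.
Proof. by rewrite -cproj0 cprojK//; lra. Qed.

Lemma in_chart0 g x : in_chart g x 0 = 0.
Proof. by rewrite /in_chart cproj0 addr0 subrr crep0. Qed.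

(** Charts compose exactly, without any smallness condition, because
    [cproj] cancels [crep]; this makes the chain rule immediate. *)
Lemma in_chart_comp f g x h :
  in_chart (f \o g) x h = in_chart f (g x) (in_chart g x h).
Proof.
have -> // : in_chart f (g x) (in_chart g x h) =
  crep (f (g x + cproj (crep (g (x + cproj h) - g x))) - f (g x)) by [].
by rewrite crepK subrKC.
Qed.

Lemma is_derive_in_chart g x : derivable (in_chart g x) 0 1 ->
  is_derive (0 : R) 1 (in_chart g x) (cderiv g x).
Proof. by move=> dg; split => //; rewrite /cderiv derive1E. Qed.

Lemma is_derive_cderiv g x (d : R) :
  is_derive (0 : R) 1 (in_chart g x) d -> cderiv g x = d.
Proof. by move=> [_ <-]; rewrite /cderiv derive1E. Qed.

Lemma cderiv_comp f g x : derivable (in_chart g x) 0 1 ->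
  derivable (in_chart f (g x)) 0 1 ->
  cderiv (f \o g) x = cderiv f (g x) * cderiv g x.
Proof.
move=> /is_derive_in_chart dg /is_derive_in_chart df.
have df' : is_derive (in_chart g x 0) 1 (in_chart f (g x)) (cderiv f (g x)).
  by rewrite in_chart0.
have := @is_derive1_comp R (in_chart f (g x)) (in_chart g x) 0 _ _ df' dg.
rewrite -/(_ \o _) => dfg; apply: is_derive_cderiv.
have -> : in_chart (f \o g) x = in_chart f (g x) \o in_chart g x.
  by apply/funext => h /=; rewrite in_chart_comp.
by [].
Qed.

Lemma is_derive_in_chart_id x : is_derive (0 : R) 1 (in_chart id x) 1.
Proof.
apply: (@near_eq_is_derive _ _ _ id).
near=> h; rewrite /in_chart addrAC subrr add0r cprojK//.
have : `|0 - h| < 2^-1.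
  by near: h; apply: cvgr_dist_lt; [exact: cvg_id|rewrite invr_gt0 ltr0n].
by rewrite sub0r normrN ltr_norml => /andP[/ltW -> ->].
Unshelve. all: end_near. Qed.

Lemma cderiv_id x : cderiv id x = 1.
Proof. exact/is_derive_cderiv/is_derive_in_chart_id. Qed.

Lemma in_chart_continuous g x : derivable (in_chart g x) 0 1 ->
  forall e : R, 0 < e -> \forall h \near 0, `|in_chart g x h| < e.
Proof.
move=> dg e e0.
have cg : {for 0, continuous (in_chart g x)}.
  by apply: differentiable_continuous; apply/derivable1_diffP.
near=> h.
have : `|in_chart g x 0 - in_chart g x h| < e.
  by near: h; exact: (@cvgr_dist_lt _ _ _ _ _ _ _ cg).
by rewrite in_chart0 sub0r normrN.
Unshelve. all: end_near.
Qed.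

(** The representative [crep] is additive only on small values, which is
    why both displacements are assumed smaller than [1/4]. *)
Lemma in_chart_shift g x h k :
  `|in_chart g x h| < 4^-1 -> `|in_chart g (x + cproj h) k| < 4^-1 ->
  in_chart g x (h + k) = in_chart g x h + in_chart g (x + cproj h) k.
Proof.
rewrite /in_chart cprojD; set a := crep _; set b := crep _ => a4 b4.
have -> : g (x + (cproj h + cproj k)) - g x = cproj (a + b).
  by rewrite cprojD !crepK [x + (_ + _)]addrA [RHS]addrC addrA subrK.
by rewrite cprojK//; move: a4 b4; rewrite !ltr_norml; lra.
Qed.

(** The hypothesis gives the derivative of each chart at its centre only;
    translating the chart at a nearby point extends it to a neighbourhood. *)
Lemma is_derive_in_chart_near g x : (forall y, derivable (in_chart g y) 0 1) ->
  \forall h \near (0 : R), is_derive (h : R) 1 (in_chart g x) (cderiv g (x + cproj h)).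
Proof.
move=> dg; near=> h.
have hx : `|in_chart g x h| < 4^-1.
  by near: h; apply: in_chart_continuous; [exact: dg|rewrite invr_gt0 ltr0n].
have := is_derive_in_chart (dg (x + cproj h)).
set k := in_chart g (x + _) => dk.
apply: (@near_eq_is_derive _ _ _ (fun s => in_chart g x h + k (s - h))).
  have : \forall s \near h, `|k (s - h)| < 4^-1.
    have c : (s - h) @[s --> h] --> (0 : R).
      by rewrite -[0](subrr h); apply: cvgB; [exact: cvg_id|exact: cvg_cst].
    by apply: (c [set u | `|k u| < 4^-1]); apply: in_chart_continuous;
       [exact: dg|rewrite invr_gt0 ltr0n].
  apply: filterS => s ks.
  by rewrite -(in_chart_shift hx ks) addrC subrK.
have ds : is_derive (h : R) 1 (fun s : R => s - h) 1.
  by rewrite -[X in is_derive _ _ _ X]subr0; apply: is_deriveB.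
have dk' : is_derive (h - h) 1 k (cderiv g (x + cproj h)) by rewrite subrr.
have := @is_derive1_comp R k (fun s : R => s - h) h _ _ dk' ds; rewrite mulr1 => dks.
by have := is_deriveD (is_derive_cst (in_chart g x h) h 1) dks; rewrite add0r.
Unshelve. all: end_near. Qed.

End Lifts.

Section LiftExistence.
Context {R : realType}.
Local Notation S1 := (circle R).
Implicit Types (x y z : S1) (s t u h : R) (f g : S1 -> S1) (phi psi : R -> R).

(** A lift to the universal cover, together with its derivative: on the line
    the usual one-variable calculus applies. *)
Definition is_lift g phi :=
  (forall t, g (cproj t) = cproj (phi t)) /\
  (forall t, is_derive t 1 phi (cderiv g (cproj t))).

Lemma continuous_cderiv_cproj g : C2_circle g -> continuous (cderiv g \o cproj).
Proof.
move=> [_ dd _] t; apply: differentiable_continuous.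
by apply/derivable1_diffP; exact: dd.
Qed.

(** If [phi] is a primitive of the derivative of [g], then in the chart at
    [cproj t] the increments of [phi] and of [g] have the same derivative, so
    [g] and [cproj \o phi] differ by a locally constant function. *)
Lemma lift_near g phi t : (forall x, derivable (in_chart g x) 0 1) ->
  (forall t, is_derive t 1 phi (cderiv g (cproj t))) ->
  \forall s \near t, g (cproj s) - cproj (phi s) = g (cproj t) - cproj (phi t).
Proof.
move=> dg dphi.
have [e e0 eP] : exists2 e : R, 0 < e & forall h, `|h| < e ->
    is_derive (h : R) 1 (in_chart g (cproj t)) (cderiv g (cproj t + cproj h)).
  have [e/= e0 eP] := is_derive_in_chart_near (cproj t) dg.
  by exists e => // h he; apply: eP; rewrite /= sub0r normrN.
have key h : `|h| < e -> in_chart g (cproj t) h = phi (t + h) - phi t.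
  pose D h := in_chart g (cproj t) h - phi (t + h).
  have dD k : `|k| < e -> is_derive (k : R) 1 D 0.
    move=> ke; have dk := eP _ ke.
    have ds : is_derive (k : R) 1 (fun s : R => t + s) 1.
      by rewrite -[X in is_derive _ _ _ X]add0r; apply: is_deriveD.
    have := @is_derive1_comp R phi (fun s : R => t + s) k _ _ (dphi (t + k)) ds.
    rewrite mulr1 cprojD => dp; have := is_deriveB dk dp.
    by rewrite subrr.
  have D0 : D 0 = - phi t by rewrite /D in_chart0 addr0 sub0r.
  have DD a b : a <= b -> - e < a -> b < e -> D b = D a.
    move=> ab ea be; apply/eqP; rewrite -subr_eq0; apply/eqP.
    have dab c : a <= c <= b -> is_derive (c : R) 1 D 0.
      by move=> acb; apply: dD; rewrite ltr_norml; lra.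
    have [||c _ ->] := @MVT_segment R D (fun=> 0) a b ab; last by rewrite mul0r.
    - by move=> c; rewrite in_itv/= => ?; apply: dab; lra.
    - apply: derivable_within_continuous => c; rewrite in_itv/= => ?.
      by have [] := dab c _.
  move=> he; suff : D h = D 0 by rewrite D0 /D => <-; rewrite subrKC.
  move: he; rewrite ltr_norml => /andP[h1 h2].
  case: (leP 0 h) => h0; first by apply: DD => //; lra.
  by apply/esym; apply: DD => //; lra.
near=> s; have se : `|s - t| < e.
  by rewrite distrC; near: s; apply: cvgr_dist_lt => //; exact: cvg_id.
have := key _ se; rewrite subrKC => /(congr1 (fun r => cproj r : S1)).
rewrite /in_chart crepK -cprojD subrKC cprojB => E.
apply/eqP; rewrite subr_eq -addrA [- _ + _]addrC -E; apply/eqP.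
by rewrite subrKC.
Unshelve. all: end_near. Qed.

(** A primitive of the derivative is a lift by [lift_near], since the set
    where it lifts [g] is open, closed and contains [t0]. *)
Lemma exists_lift g t0 u0 : C2_circle g -> g (cproj t0) = cproj u0 ->
  exists2 phi, is_lift g phi & phi t0 = u0.
Proof.
move=> Cg gt0; have [F dF] := continuous_antiderivative (continuous_cderiv_cproj Cg).
pose phi t := F t - F t0 + u0.
have dphi t : is_derive t 1 phi (cderiv g (cproj t)).
  have := is_deriveD (is_deriveB (dF t) (is_derive_cst (F t0) t 1)) (is_derive_cst u0 t 1).
  by rewrite subr0 addr0.
have phi0 : phi t0 = u0 by rewrite /phi subrr add0r.
exists phi => //; split=> // t.
have nearE := lift_near _ (let: And3 d _ _ := Cg in d) dphi.
pose E := [set s | g (cproj s) = cproj (phi s)].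
have EP s : E s <-> g (cproj s) - cproj (phi s) = 0.
  by rewrite /E/=; split=> [->|/eqP]; [rewrite subrr|rewrite subr_eq0 => /eqP].
have oE : open E.
  rewrite openE => s /EP Es; near=> u; apply/EP; rewrite -Es.
  by near: u; exact: nearE.
have oE' : open (~` E).
  rewrite openE => s Es; near=> u; apply: contra_not Es => /EP Eu; apply/EP.
  rewrite -Eu; apply/esym; near: u; exact: nearE.
suff : E = setT by move=> ET; have : E t by rewrite ET.
have /connected_intervalP : is_interval [set: R] by [].
apply.
- by exists t0; rewrite /E /= phi0.
- by exists E => //; rewrite setTI.
- by exists E; [rewrite -[E]setCK; exact: open_closedC|rewrite setTI].
Unshelve. all: end_near. Qed.

Lemma lift_cont g phi : is_lift g phi -> continuous phi.
Proof. by move=> [_ /is_derive_continuous]. Qed.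

Lemma lift_lt g phi s t : (forall x, 0 < cderiv g x) -> is_lift g phi ->
  s < t -> phi s < phi t.
Proof. by move=> g0 [_ dphi] st; exact: (derive_pos_lt st dphi). Qed.

Lemma lift_le g phi s t : (forall x, 0 < cderiv g x) -> is_lift g phi ->
  s <= t -> phi s <= phi t.
Proof.
move=> g0 lphi; rewrite le_eqVlt => /orP[/eqP->//|st].
exact/ltW/(lift_lt g0 lphi).
Qed.

Lemma lift_id : is_lift (id : S1 -> S1) id.
Proof. by split=> // t; rewrite cderiv_id; exact: is_derive_id. Qed.

Lemma lift_comp f g phi psi : (forall x, derivable (in_chart f x) 0 1) ->
  (forall x, derivable (in_chart g x) 0 1) ->
  is_lift f phi -> is_lift g psi -> is_lift (f \o g) (phi \o psi).
Proof.
move=> df dg [fp dp] [gp dq]; split=> [t|t]; first by rewrite /= gp fp.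
rewrite cderiv_comp// gp; exact: (@is_derive1_comp R phi psi).
Qed.

(** Two lifts have the same derivative. *)
Lemma lift_unique g phi psi t0 : is_lift g phi -> is_lift g psi ->
  phi t0 = psi t0 -> phi = psi.
Proof.
move=> [_ dp] [_ dq] e; apply/funext => t.
have d s : is_derive s 1 (phi - psi) 0.
  by rewrite -(subrr (cderiv g (cproj s))); exact: is_deriveB.
have := @is_derive_0_is_cst R (phi - psi) t t0 d.
rewrite !fctE e subrr => /eqP; by rewrite subr_eq0 => /eqP.
Qed.

Lemma lift_cancel f g phi psi t0 : (forall x, derivable (in_chart f x) 0 1) ->
  (forall x, derivable (in_chart g x) 0 1) ->
  cancel g f -> is_lift f phi -> is_lift g psi -> phi (psi t0) = t0 ->
  cancel psi phi.
Proof.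
move=> df dg gf lp lq e t.
have fg : f \o g = id by apply/funext.
have := lift_comp df dg lp lq; rewrite fg => l.
by have := lift_unique l lift_id (t0 := t0) e; move/(congr1 (@^~ t)).
Qed.

End LiftExistence.

(** * Lipschitz and distortion bounds for diffeomorphisms *)

Section Diffeos.
Context {R : realType}.
Local Notation S1 := (circle R).
Implicit Types (x y z : S1) (s t u h : R) (f g : S1 -> S1) (phi psi : R -> R).
Implicit Types (G : set (S1 -> S1)) (A L : set S1).

Lemma diff2_C2 g : Diff2_plus g -> C2_circle g.
Proof. by case. Qed.

Lemma diff2_derivable g : Diff2_plus g -> forall x, derivable (in_chart g x) 0 1.
Proof. by case=> -[]. Qed.

Lemma diff2_pos g : Diff2_plus g -> forall x, 0 < cderiv g x.
Proof. by case. Qed.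

Lemma diff2_inj g : Diff2_plus g -> injective g.
Proof. by case=> _ [g' [_ gK _]] _; exact: can_inj gK. Qed.

Lemma diff2_lift g t0 u0 : Diff2_plus g -> g (cproj t0) = cproj u0 ->
  exists2 phi, is_lift g phi & phi t0 = u0.
Proof. by move=> /diff2_C2; exact: exists_lift. Qed.

Lemma diff2_any_lift g : Diff2_plus g -> exists phi, is_lift g phi.
Proof.
by move=> Dg; have [|phi lphi _] := @diff2_lift g 0 (crep (g (cproj 0))) Dg;
  [rewrite crepK|exists phi].
Qed.

Lemma circle_bounded (F : R -> R) : continuous F ->
  exists2 B : R, 0 < B & forall t, -1 <= t <= 1 -> `|F t| <= B.
Proof.
move=> cF; have [||c _ cm] := @EVT_max R (fun t => `|F t|) (-1) 1.
- by lra.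
- apply: continuous_subspaceT => t; apply: continuous_comp; first exact: cF.
  exact: norm_continuous.
exists (`|F c| + 1); first by rewrite ltr_wpDl.
by move=> t t1; rewrite (le_trans (cm t _)) ?lerDl// in_itv.
Qed.

(** Any two points have representatives at the distance of the points and in
    a fixed compact interval, so that bounds on this interval are global. *)
Lemma circle_pair x y : exists s t, [/\ x = cproj s, y = cproj t,
  `|s - t| = mdist x y, -1 <= s <= 1 & -1 <= t <= 1].
Proof.
have [h yh hd] := circle_chart x y.
have := crep_itv x; have := mdist_le_half x y; rewrite -hd ler_norml => h2 x2.
exists (crep x), (crep x + h); rewrite cprojD !crepK; split => //; last 2 first.
- by lra.
- by lra.
by rewrite opprD addNKr normrN.
Qed.

(** The second derivative and the inverse of the first one are bounded by
    compactness, and their product is the derivative of [ln (cderiv g)]. *)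
Lemma diff2_bounds g : Diff2_plus g -> exists b B K : R,
  [/\ 0 < b, 0 < B, 0 < K, forall x, b <= cderiv g x <= B &
      forall x y, `|ln (cderiv g x) - ln (cderiv g y)| <= K * mdist x y].
Proof.
move=> Dg; have [_ dd cdd] := diff2_C2 Dg; have g0 := diff2_pos Dg.
have cd := continuous_cderiv_cproj (diff2_C2 Dg).
have [B B0 BP] := circle_bounded cd.
have [||c _ cm] := @EVT_min R (cderiv g \o cproj) (-1) 1.
- by lra.
- exact: continuous_subspaceT.
have [M M0 MP] := circle_bounded cdd.
pose b := (cderiv g \o cproj) c.
have b0 : 0 < b by exact: g0.
have bB x : b <= cderiv g x <= B.
  have x1 : -1 <= crep x <= 1 by have := crep_itv x; lra.
  have := BP _ x1; rewrite /= crepK gtr0_norm ?g0// => ->; rewrite andbT.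
  by have := cm (crep x); rewrite in_itv => /(_ x1) /=; rewrite crepK.
exists b, B, (M / b); split => //; first exact: divr_gt0.
move=> x y; have [s [t [-> -> <- s1 t1]]] := circle_pair x y.
pose D := cderiv g \o cproj.
have dln u : is_derive u 1 (@ln R \o D) ((D u)^-1 * derive1 D u).
  apply: is_derive1_comp; first by apply: is_derive1_ln; exact: g0.
  by split; [exact: dd|rewrite derive1E].
have bd u : -1 <= u <= 1 -> `|(D u)^-1 * derive1 D u| <= M / b.
  move=> u1; rewrite normrM mulrC ler_pM//; first exact: MP.
  rewrite gtr0_norm ?invr_gt0 ?g0// lef_pV2 ?posrE ?g0//.
  by have /andP[] := bB (cproj u).
wlog st : s t s1 t1 / s <= t => [H|].
  case: (leP s t) => [|/ltW] st; first exact: H.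
  by have := H t s t1 s1 st; rewrite distrC [`|t - s|]distrC.
rewrite distrC [`|s - t|]distrC (ger0_norm (x := t - s)) ?subr_ge0//.
rewrite ler_norml -mulNr; apply/andP; split.
  apply: (derive_lower_bound st dln) => u su.
  by have := bd u; rewrite ler_norml => /(_ _)/andP[|//]; lra.
apply: (derive_upper_bound st dln) => u su.
by have := bd u; rewrite ler_norml => /(_ _)/andP[|//]; lra.
Qed.

Lemma cderiv_continuous g x (e : R) : Diff2_plus g -> 0 < e ->
  exists2 r : R, 0 < r & forall y, mdist x y < r -> `|cderiv g y - cderiv g x| < e.
Proof.
move=> Dg e0; have cd := continuous_cderiv_cproj (diff2_C2 Dg).
have : \forall s \near crep x, `|cderiv g (cproj s) - cderiv g x| < e.
  near=> s.
  suff : `|(cderiv g \o cproj) (crep x) - (cderiv g \o cproj) s| < e.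
    by rewrite /= crepK distrC.
  by near: s; exact: (@cvgr_dist_lt _ _ _ _ _ _ _ (cd (crep x))).
move=> [r/= r0 rP]; exists r => // y; have [h -> <-] := circle_chart x y => hr.
have := rP (crep x + h); rewrite cprojD crepK; apply.
by rewrite /= opprD addNKr normrN.
Unshelve. all: end_near. Qed.

Lemma ball_chart x (r : R) y z : mdist x y < r -> mdist x z < r -> r <= 4^-1 ->
  exists s t, [/\ y = cproj s, z = cproj t, `|s - t| = mdist y z,
   `|crep x - s| < r & `|crep x - t| < r].
Proof.
have [h -> hy] := circle_chart x y; have [k -> kz] := circle_chart x z.
rewrite -hy -kz => hr kr r4; exists (crep x + h), (crep x + k).
have := crepK x; move: (crep x) => u ux.
split; rewrite ?opprD ?addNKr ?normrN//; try by rewrite cprojD ux.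
rewrite addrACA subrr add0r -ux -!cprojD mdist_cproj opprD addrACA subrr add0r//.
by rewrite (le_trans (ler_normB _ _))//; lra.
Qed.

Lemma ball_lipschitz g x (r m : R) y z : Diff2_plus g -> r <= 4^-1 ->
  (forall w, mdist x w < r -> cderiv g w <= m) ->
  mdist x y < r -> mdist x z < r -> mdist (g y) (g z) <= m * mdist y z.
Proof.
move=> Dg r4 gm xy xz; have [s [t [-> -> <- ]]] := ball_chart xy xz r4.
have [phi lphi] := diff2_any_lift Dg; have [gp dp] := lphi.
rewrite !gp => sr tr; apply: le_trans (mdist_cproj_le _ _) _.
wlog st : s t sr tr / s <= t => [H|].
  case: (leP s t) => [|/ltW] st; first exact: H.
  by have := H t s tr sr st; rewrite distrC [`|t - s|]distrC.
rewrite distrC [`|s - t|]distrC !ger0_norm ?subr_ge0//; last exact: (lift_le (diff2_pos Dg)).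
apply: (derive_upper_bound st dp) => u su; apply: gm.
rewrite -[x]crepK (le_lt_trans (mdist_cproj_le _ _))//.
by move: sr tr; rewrite !ltr_norml; lra.
Qed.

(** The condition on [M] keeps the image of the ball shorter than [1/2], so
    that the image does not wrap around the circle. *)
Lemma ball_lower_lipschitz g x (r m M : R) y z : Diff2_plus g -> r <= 4^-1 ->
  (forall w, mdist x w < r -> m <= cderiv g w <= M) -> M * (2 * r) <= 2^-1 ->
  mdist x y < r -> mdist x z < r -> m * mdist y z <= mdist (g y) (g z).
Proof.
move=> Dg r4 gm Mr xy xz; have [s [t [-> -> <- ]]] := ball_chart xy xz r4.
have [phi lphi] := diff2_any_lift Dg; have [gp dp] := lphi.
rewrite !gp => sr tr.
wlog st : s t sr tr / s <= t => [H|].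
  case: (leP s t) => [|/ltW] st; first exact: H.
  by have := H t s tr sr st; rewrite distrC [mdist _ _]metric_sym.
have gu u : s < u < t -> m <= cderiv g (cproj u) <= M.
  move=> su; apply: gm.
  rewrite -[x]crepK (le_lt_trans (mdist_cproj_le _ _))//.
  by move: sr tr; rewrite !ltr_norml; lra.
have pst : 0 <= phi t - phi s by rewrite subr_ge0; exact: (lift_le (diff2_pos Dg)).
rewrite metric_sym mdist_cproj (ger0_norm pst)//.
  rewrite distrC ger0_norm ?subr_ge0//.
  by apply: (derive_lower_bound st dp) => u /gu/andP[].
rewrite (le_trans _ Mr)// (@le_trans _ _ (M * (t - s)))//.
  by apply: (derive_upper_bound st dp) => u /gu/andP[].
rewrite ler_wpM2l//.
  have xr : mdist x x < r by rewrite mdistxx (le_lt_trans _ sr).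
  by have /andP[_] := gm _ xr; apply: le_trans; exact/ltW/diff2_pos.
by move: sr tr; rewrite !ltr_norml; lra.
Qed.

Lemma diff2_lipschitz g : Diff2_plus g ->
  exists2 B : R, 0 < B & forall x y, mdist (g x) (g y) <= B * mdist x y.
Proof.
move=> Dg; have [b [B [K [_ B0 _ bB _]]]] := diff2_bounds Dg.
exists B => // x y; have [s [t [-> -> <- _ _]]] := circle_pair x y.
have [phi lphi] := diff2_any_lift Dg; have [gp dp] := lphi.
rewrite !gp; apply: le_trans (mdist_cproj_le _ _) _.
wlog st : s t / s <= t => [H|].
  case: (leP s t) => [|/ltW] st; first exact: H.
  by have := H t s st; rewrite distrC [`|t - s|]distrC.
rewrite distrC [`|s - t|]distrC !ger0_norm ?subr_ge0//; last exact: (lift_le (diff2_pos Dg)).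
by apply: (derive_upper_bound st dp) => u _; have /andP[] := bB (cproj u).
Qed.

Lemma diff2_continuous g : Diff2_plus g -> continuous g.
Proof.
move=> /diff2_lipschitz[B B0 BP] x P /near_circleP[r r0 rP].
suff : \forall y \near x, P (g y) by [].
apply/near_circleP; exists (r / B); first exact: divr_gt0.
move=> y xy; apply: rP; apply: le_lt_trans (BP _ _) _.
by rewrite mulrC -ltr_pdivlMr.
Qed.

End Diffeos.

(** * Groups of diffeomorphisms and minimal sets *)

Section Groups.
Context {R : realType}.
Local Notation S1 := (circle R).
Implicit Types (x y z : S1) (s t u h : R) (f g : S1 -> S1) (phi psi : R -> R).
Implicit Types (G : set (S1 -> S1)) (A L : set S1).

Lemma halfr_gt0 (r : R) : 0 < r -> 0 < r / 2.
Proof. by move=> r0; rewrite divr_gt0. Qed.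

Lemma subgroup_diff2 G g : subgroup G -> G g -> Diff2_plus g.
Proof. by case=> H _ _ _; exact: H. Qed.

Lemma subgroup_inv G g : subgroup G -> G g ->
  exists g', [/\ G g', cancel g g' & cancel g' g].
Proof. by case=> _ _ _; apply. Qed.

Lemma subgroup_comp G f g : subgroup G -> G f -> G g -> G (f \o g).
Proof. by case=> _ _ H _; exact: H. Qed.

Lemma subgroup_iter G g n : subgroup G -> G g -> G (iter n g).
Proof.
move=> sG Gg; elim: n => [|n IH]; first by case: sG.
exact: (subgroup_comp sG Gg IH).
Qed.

Lemma diff2_cderiv_comp f g x : Diff2_plus f -> Diff2_plus g ->
  cderiv (f \o g) x = cderiv f (g x) * cderiv g x.
Proof. by move=> Df Dg; apply: cderiv_comp; exact: diff2_derivable. Qed.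

Lemma cderiv_cancel g g' x : Diff2_plus g -> Diff2_plus g' -> cancel g g' ->
  cderiv g' (g x) = (cderiv g x)^-1.
Proof.
move=> Dg Dg' gK; have := diff2_cderiv_comp x Dg' Dg.
have -> : g' \o g = id by apply/funext.
rewrite cderiv_id => /esym e1.
have := diff2_pos Dg x => g0.
by rewrite -[LHS](mulfK (lt0r_neq0 g0)) e1 mul1r.
Qed.

(** The closure of an orbit in the minimal set is closed and invariant, hence
    the whole minimal set. *)
Lemma minimal_orbit_dense G L x y (e : R) : subgroup G -> minimal_set G L ->
  L x -> L y -> 0 < e -> exists2 g, G g & mdist (g x) y < e.
Proof.
move=> sG [_ cL iL mL] Lx Ly e0.
have sub : closure (group_orbit G x) `<=` L.
  rewrite ((closure_id L).1 cL); apply: closureS => _ [g Gg <-].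
  by apply: (iL _ Gg); exists x.
have : closure (group_orbit G x) y.
  rewrite (mL (closure (group_orbit G x)))//; last first.
  - move=> g Gg _ [z zx <-] B /(diff2_continuous (subgroup_diff2 sG Gg)) gB.
    have [_ [[f Gf <-] fB]] := zx _ gB.
    by exists (g (f x)); split => //; exists (g \o f) => //; exact: subgroup_comp.
  - exact: closed_closure.
  - exists x; apply: subset_closure; exists id => //; by case: sG.
move=> /(_ (fun z => mdist z y < e)) [].
  by apply/near_circleP; exists e => // z; rewrite metric_sym.
by move=> _ [[g Gg <-] ge]; exists g.
Qed.

Lemma disjoint_closed_far A B : closed A -> closed B -> A `&` B = set0 ->
  exists2 e : R, 0 < e & forall x y, A x -> B y -> e <= mdist x y.
Proof.
move=> cA cB AB; apply: contrapT => H.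
have /compact_near_coveringP/(_ nat \oo (fun n y => forall x, A x -> n.+1%:R^-1 <= mdist x y)) :=
  closed_compact_circle cB.
case.
  move=> y By; have nAy : ~ A y by move=> Ay; have : (A `&` B) y by []; rewrite AB.
  have : (~` A) y by [].
  move: cA => /closed_openC; rewrite openE => /(_ y) /[apply].
  move=> /near_circleP[r r0 rP].
  exists ([set z | mdist y z < r / 2], [set n | n.+1%:R^-1 < r / 2]).
    split; first by apply/near_circleP; exists (r / 2) => //; exact: divr_gt0.
    exact: near_infty_natSinv_lt (PosNum (halfr_gt0 r0)).
  move=> [z n] [/= zy nr] x Ax; rewrite leNgt; apply/negP => xz.
  apply: (rP x) => //; rewrite (le_lt_trans (metric_triangle _ z _))//.
  have {}nr : n.+1%:R^-1 < r / 2 := nr.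
  have {}zy : mdist y z < r / 2 := zy.
  by rewrite [mdist z x]metric_sym [ltRHS]splitr ltrD// (lt_trans xz).
move=> N _ /(_ N (leqnn N)) NP; apply: H; exists N.+1%:R^-1.
  by rewrite invr_gt0.
by move=> x y Ax By; exact: NP.
Qed.

Lemma infinite_close_pair A (e : R) : 0 < e -> ~ finite_set A ->
  exists x y, [/\ A x, A y, x != y & mdist x y < e].
Proof.
move=> e0 iA; apply: contrapT => H.
have [M [z zP]] := @circle_net R (e / 2) (halfr_gt0 e0).
pose f x := projT1 (cid (zP x)).
have fP x : mdist (z (f x)) x < e / 2 by rewrite /f; case: cid.
apply: iA; rewrite -(eq_finite_set (@inj_card_eq _ _ A f _)); first exact: finite_finset.
move=> x y /set_mem Ax /set_mem Ay fxy; apply: contrapT => /eqP xy; apply: H.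
exists x, y; split => //.
rewrite (le_lt_trans (metric_triangle _ (z (f x)) _))//.
by have := fP x; have := fP y; rewrite -fxy [mdist x _]metric_sym; lra.
Qed.

End Groups.

Section MinimalUnique.
Context {R : realType}.
Local Notation S1 := (circle R).
Implicit Types (x y z : S1) (f g : S1 -> S1) (phi psi : R -> R).
Implicit Types (G : set (S1 -> S1)) (A L : set S1).

Lemma lift_inverse G g t0 u0 : subgroup G -> G g -> g (cproj t0) = cproj u0 ->
  exists g' phi psi, [/\ [/\ G g', cancel g g' & cancel g' g], is_lift g phi,
    is_lift g' psi, (phi t0 = u0 /\ psi u0 = t0) & cancel phi psi /\ cancel psi phi].
Proof.
move=> sG Gg gt; have Dg := subgroup_diff2 sG Gg.
have [g' [Gg' gK g'K]] := subgroup_inv sG Gg; have Dg' := subgroup_diff2 sG Gg'.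
have g'u : g' (cproj u0) = cproj t0 by rewrite -gt gK.
have [phi lp pt] := diff2_lift Dg gt; have [psi lq qu] := diff2_lift Dg' g'u.
exists g', phi, psi; split => //.
have dg := diff2_derivable Dg; have dg' := diff2_derivable Dg'.
by split; [apply: (@lift_cancel _ g' g _ _ t0)|apply: (@lift_cancel _ g g' _ _ u0)];
  rewrite ?pt ?qu.
Qed.

Lemma first_point_right L (t0 : R) : closed L -> L !=set0 ->
  exists a, [/\ t0 <= a, L (cproj a) & forall s, t0 <= s < a -> ~ L (cproj s)].
Proof.
move=> cL [q Lq].
pose q0 := crep q + (Num.floor (t0 - crep q) + 1)%:~R.
have tq : t0 <= q0.
  by have := Num.Theory.floor_itv (t0 - crep q); rewrite /q0; move/andP => [_ /ltW]; lra.
have Lq0 : L (cproj q0) by rewrite /q0 cprojDz crepK.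
pose S := [set t | t \in `[t0, q0]] `&` (cproj @^-1` L).
have cS : compact S.
  apply: (@subclosed_compact _ _ `[t0, q0]%classic).
  - apply: closedI; first exact: interval_closed.
    by apply: preimage_closed => // t _; exact: continuous_cproj.
  - exact: segment_compact.
  - exact: subIsetl.
have S0 : S !=set0 by exists q0; split => //; rewrite /= in_itv/= lexx tq.
have [|c /set_mem[/= + Lc] cmin] := @compact_EVT_min _ R id S S0 cS.
  by apply: continuous_subspaceT => ?; exact: cvg_id.
rewrite in_itv/= => /andP[tc cq]; exists c; split=> // s /andP[ts sc] Ls.
suff : c <= s by rewrite leNgt sc.
by apply: cmin; rewrite inE; split => //=; rewrite in_itv/= ts (le_trans (ltW sc)).
Qed.

(** If [A] and [L] were disjoint, they would be at a distance [e].  Take the arc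
    from a point [p] of [A] to the next point [a] of [L] on its right.  Its
    images avoid [L], have one end in [A] and the other in [L], hence are longer
    than [e].  But the orbit of [a] is infinite, so it has two points at a
    distance less than [e], and one of them lies in the image of the arc that
    ends at the other one. *)
Lemma minimal_set_unique G A L : subgroup G ->
  (forall x, ~ finite_set (group_orbit G x)) ->
  minimal_set G A -> minimal_set G L -> A = L.
Proof.
move=> sG iG [A0 cA iA mA] [L0 cL iL mL].
have inv g (B : set S1) x : Defs.invariant G B -> G g -> B x -> B (g x).
  by move=> iB Gg Bx; apply: (iB _ Gg); exists x.
case: (pselect (A `&` L !=set0)) => [AL0|AL0].
  have cAL : closed (A `&` L) by exact: closedI.
  have iAL : Defs.invariant G (A `&` L).
    by move=> g Gg _ [x [Ax Lx] <-]; split; [exact: (inv g A)|exact: (inv g L)].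
  by transitivity (A `&` L); [apply/esym; apply: mA => // x []|apply: mL => // x []].
have {}AL0 : A `&` L = set0 by apply: contrapT => /eqP/set0P.
exfalso; have [e e0 far] := disjoint_closed_far cA cL AL0.
have [p Ap] := A0; have [a [pa La agap]] := first_point_right (crep p) cL L0.
have [x [y [[g Gg gx] [h Gh hy] xy xye]]] := infinite_close_pair e0 (iG (cproj a)).
have {x y gx hy xy xye} [k [g' [h' [Gg' Gh' k0 ke hE]]]] : exists k g' h',
    [/\ G g', G h', k < 0, `|k| < e & h' (cproj a) = g' (cproj a) + cproj k].
  have [k yk kd] := circle_chart x y.
  have k0 : k != 0 by rewrite -normr_eq0 kd gt_eqF// mdist_gt0.
  case: (ltgtP k 0) k0 => // k0 _.
    by exists k, g, h; rewrite gx hy kd.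
  exists (- k), h, g; split => //; rewrite ?oppr_lt0 ?normrN ?kd ?gx ?hy//.
  by rewrite yk -addrA -cprojD subrr cproj0 addr0.
have [f [phi [psi [[Gf gK fK] lp lq [pa' qa'] [pK qK]]]]] :=
  @lift_inverse G g' a (crep (g' (cproj a))) sG Gg' (esym (crepK _)).
set al := crep (g' (cproj a)) in pa' qa'.
have p0 := diff2_pos (subgroup_diff2 sG Gg'); have q0 := diff2_pos (subgroup_diff2 sG Gf).
have sa : psi (al + k) < a by rewrite -qa'; apply: (lift_lt q0 lq); rewrite gtrDl.
have Ls : L (cproj (psi (al + k))).
  by rewrite -lq.1 cprojD crepK -hE; apply: (inv f L) => //; exact: (inv h' L).
case: (leP (crep p) (psi (al + k))) => ps; first by apply: (agap _ _ Ls); rewrite ps.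
have h1 := lift_lt p0 lp ps; rewrite qK in h1.
have h2 := lift_le p0 lp pa; rewrite pa' in h2.
have := far _ _ (inv _ _ _ iA Gg' Ap) (inv _ _ _ iL Gg' La).
rewrite leNgt => /negP; apply.
rewrite -[p]crepK !lp.1 pa' (le_lt_trans (mdist_cproj_le _ _))//.
by move: ke; rewrite !ltr_norml; lra.
Qed.

End MinimalUnique.

(** * Iterates near a one-sided fixed point *)

Section Parabolic.
Context {R : realType}.
Context (phi dphi : R -> R) (K e : R)
  (dphiP : forall t : R, is_derive t 1 phi (dphi t))
  (dphi0 : forall t, 0 < dphi t) (K0 : 0 < K)
  (ln_dphi : forall s t, `|ln (dphi s) - ln (dphi t)| <= K * `|s - t|)
  (e0 : 0 < e) (phi00 : phi 0 = 0)
  (phi_lt : forall t, 0 < t < e -> phi t < t).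

(** The derivative of [iter n phi] by the chain rule. *)
Definition iter_derive n (t : R) : R := \prod_(i < n) dphi (iter i phi t).

Let iter_derive0 n t : 0 < iter_derive n t.
Proof. by apply: prodr_gt0 => i _; exact: dphi0. Qed.

Lemma is_derive_iter n (t : R) : is_derive t 1 (iter n phi) (iter_derive n t).
Proof.
elim: n t => [|n IH] t; first by rewrite /iter_derive big_ord0; exact: is_derive_id.
rewrite /iter_derive big_ord_recr /= mulrC.
exact: (@is_derive1_comp R phi (iter n phi)).
Qed.

Let phi_mono s t : s < t -> phi s < phi t.
Proof. by move=> st; exact: (derive_pos_lt st dphiP dphi0). Qed.

Let iter_mono n s t : s <= t -> iter n phi s <= iter n phi t.
Proof.
rewrite le_eqVlt => /orP[/eqP->//|st].
by apply/ltW/(derive_pos_lt st (is_derive_iter n)) => u; exact: iter_derive0.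
Qed.

(** The points [a i] cut the right neighbourhood of the fixed point into
    fundamental domains of [phi]. *)
Definition half_orbit i := iter i phi (e / 2).
#[local] Arguments half_orbit : simpl never.
Local Notation a := half_orbit.

Let a_bd i : 0 < a i < e.
Proof.
elim: i => [|i /andP[i0 ie]]; first by have := e0; rewrite /a /= => ?; apply/andP; split; lra.
rewrite [a _.+1]iterS -/(a i) -{1}phi00 phi_mono//=.
by rewrite (lt_trans _ ie)// phi_lt ?i0.
Qed.

Let a_dec i j : (i <= j)%N -> a j <= a i.
Proof.
move=> /subnK <-; elim: (j - i)%N => [|k IH]; first by rewrite add0n.
by rewrite addSn (le_trans _ IH)// ltW// [a _.+1]iterS -/(a _) phi_lt.
Qed.

Let a_decS i : a i.+1 < a i.
Proof. by rewrite [a _.+1]iterS -/(a _) phi_lt. Qed.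

Let a_cvg0 (h : R) : 0 < h -> exists N, a N < h.
Proof.
move=> h0; apply: contrapT => H.
have hA i : h <= a i by rewrite leNgt; apply/negP => ah; apply: H; exists i.
have lA : has_inf (range a).
  by split; [exists (a 0%N), 0%N|exists 0 => _ [i _ <-]; have /andP[/ltW] := a_bd i].
(* The infimum of the orbit would be a fixed point if it were positive. *)
pose m := inf (range a).
have ma i : m <= a i by apply: ge_inf; [case: lA|exists i].
have m0 : 0 < m.
  apply: (lt_le_trans h0); apply: lb_le_inf; first by case: lA.
  by move=> _ [i _ <-].
have me : m < e by apply: le_lt_trans (ma 0%N) _; have /andP[] := a_bd 0%N.
have pm : phi m < m by apply: phi_lt; rewrite m0.
have : \forall t \near m, phi t < m.
  have cphi : {for m, continuous phi} by exact: (is_derive_continuous dphiP).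
  exact: (cvgr_lt _ cphi).
move=> [d/= d0 dP].
have [_ [i _ <-] ai] := inf_adherent d0 lA.
have : phi (a i) < m.
  apply: dP => /=; rewrite distrC ger0_norm ?subr_ge0 ?ma//.
  by rewrite ltrBlDl.
by rewrite ltNge => /negP; apply; exact: (ma i.+1).
Qed.

Let orbit_sum n : \sum_(i < n) (a i - a (i + 3)%N) <= 3 * a 0%N.
Proof.
suff -> : \sum_(i < n) (a i - a (i + 3)%N) =
    a 0%N + a 1%N + a 2%N - (a n + a n.+1 + a n.+2).
  have := a_dec (leq0n 1); have := a_dec (leq0n 2).
  have /andP[? _] := a_bd n; have /andP[? _] := a_bd n.+1; have /andP[? _] := a_bd n.+2.
  lra.
elim: n => [|n IH]; first by rewrite big_ord0 subrr.
rewrite big_ord_recr /= IH addn3.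
by lra.
Qed.

Let ln_iter_derive n u v : `|ln (iter_derive n u) - ln (iter_derive n v)| <=
  \sum_(i < n) K * `|iter i phi u - iter i phi v|.
Proof.
elim: n => [|n IH]; first by rewrite /iter_derive !big_ord0 subrr normr0.
have S w : iter_derive n.+1 w = iter_derive n w * dphi (iter n phi w) by rewrite /iter_derive big_ord_recr.
rewrite !S !lnM ?posrE ?iter_derive0// opprD addrACA big_ord_recr /=.
by rewrite (le_trans (ler_normD _ _))// lerD.
Qed.

Let J u := a 3%N <= u <= a 0%N.

Let iter_J i u : J u -> a (i + 3)%N <= iter i phi u <= a i.
Proof.
have E j : a (i + j)%N = iter i phi (a j) by rewrite /a iterD.
by move=> /andP[h1 h2]; rewrite E -[in X in _ && (_ <= X)](addn0 i) E !iter_mono.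
Qed.

Let iter_J_dist i u v : J u -> J v ->
  `|iter i phi u - iter i phi v| <= a i - a (i + 3)%N.
Proof. by move=> /(iter_J i) ? /(iter_J i) ?; rewrite ler_norml; lra. Qed.

Let c := expR (K * (3 * a 0%N)) / (a 0%N - a 3%N).

Let a03 : 0 < a 0%N - a 3%N.
Proof. by rewrite subr_gt0 (le_lt_trans (@a_dec 1 3 _)). Qed.

Let c0 : 0 < c.
Proof. by rewrite divr_gt0 ?expR_gt0. Qed.

Let iter_derive_J n u v : J u -> J v -> iter_derive n u <= expR (K * (3 * a 0%N)) * iter_derive n v.
Proof.
move=> Ju Jv.
have h : ln (iter_derive n u) - ln (iter_derive n v) <= K * (3 * a 0%N).
  apply: le_trans (ler_norm _) (le_trans (ln_iter_derive n u v) _).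
  rewrite -mulr_sumr ler_wpM2l ?(ltW K0)// (le_trans _ (orbit_sum n))//.
  by apply: ler_sum => i _; exact: iter_J_dist.
rewrite -[leLHS]lnK ?posrE// -[X in _ * X]lnK ?posrE// -expRD ler_expR.
by rewrite -lerBlDr.
Qed.

Let iter_derive_bound n u : J u -> iter_derive n u <= c * (a n - a (n + 3)%N).
Proof.
move=> Ju.
have E j : a (n + j)%N = iter n phi (a j) by rewrite /a iterD.
have [||w wJ e1] := @MVT R (iter n phi) (iter_derive n) (a 3%N) (a 0%N) _ (fun t _ => is_derive_iter n t).
- by rewrite -subr_gt0.
- exact/continuous_subspaceT/(is_derive_continuous (is_derive_iter n)).
rewrite -[in X in _ * (X - _)](addn0 n) !E e1 /c mulrACA mulVf ?gt_eqF// mulr1.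
apply: iter_derive_J => //.
by move: wJ; rewrite in_itv => /andP[/ltW h1 /ltW h2]; rewrite /J h1.
Qed.

Let iter_lip n u v : J u -> J v ->
  `|iter n phi u - iter n phi v| <= c * (a n - a (n + 3)%N) * `|u - v|.
Proof.
wlog uv : u v / u <= v => [H Ju Jv|Ju Jv].
  case: (leP u v) => [|/ltW] uv; first exact: H.
  by have := H v u uv Jv Ju; rewrite distrC [`|v - u|]distrC.
rewrite distrC [`|u - v|]distrC !ger0_norm ?subr_ge0 ?iter_mono//.
apply: (derive_upper_bound uv (is_derive_iter n)) => w wJ; apply: iter_derive_bound.
by move: Ju Jv; rewrite /J; lra.
Qed.

(** Denjoy's argument.  The images of the interval between [a 3] and [a 0]
    under the iterates overlap at most three times, so the sum of their lengths
    is at most [3 * a 0], and this bounds the distortion of all iterates on it.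
    With bounded distortion the derivative of [iter n phi] is comparable to the
    length of the image, which tends to [0].  The point [y] is reached from the
    middle fundamental domain, between [a 2] and [a 1], so that a ball of fixed
    radius about [x] stays inside the larger interval. *)
Lemma parabolic_expansion : exists r eps M : R,
  [/\ 0 < r, 0 < eps, 0 <= M & forall y, 0 < y < r -> exists n x,
    [/\ 0 < x < e, iter n phi x = y,
        forall u, `|u - x| < eps -> iter_derive n u <= 2^-1 &
        forall u v, `|u - x| < eps -> `|v - x| < eps ->
          `|ln (iter_derive n u) - ln (iter_derive n v)| <= M * `|u - v|]].
Proof.
have [|N aN] := a_cvg0 (h := (2 * c)^-1).
  by rewrite invr_gt0 mulr_gt0.
pose eps := Num.min (a 0%N - a 1%N) (a 2%N - a 3%N).
have aS i : 0 < a i - a i.+1 by rewrite subr_gt0.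
exists (a (N + 3)%N), eps, (K * (c * (3 * a 0%N))); split.
- by have /andP[] := a_bd (N + 3)%N.
- by rewrite lt_min !aS.
- apply: mulr_ge0; first exact: ltW.
  apply: mulr_ge0; first exact: ltW.
  by apply: mulr_ge0 => //; have /andP[/ltW] := a_bd 0%N.
move=> y /andP[y0 yr].
have exk : exists k, a k <= y by have [k /ltW] := a_cvg0 y0; exists k.
(* The first [k] with [a k <= y] locates [y] between [a k] and [a k.-1]. *)
case: (ex_minnP exk) => k aky kmin.
have kN : (N + 3 < k)%N.
  rewrite ltnNge; apply/negP => kN.
  by have := le_lt_trans aky yr; rewrite ltNge a_dec.
have [n kn] : exists n, k = n.+2 by exists (k - 2)%N; lia.
subst k; have yn : y < a n.+1 by rewrite ltNge; apply/negP => /kmin; rewrite ltnn.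
have E j : a (n + j)%N = iter n phi (a j) by rewrite /a iterD.
have [|||x] := @IVT R (iter n phi) (a 2%N) (a 1%N) y.
- exact: a_dec.
- exact/continuous_subspaceT/(is_derive_continuous (is_derive_iter n)).
- rewrite min_l ?max_r ?iter_mono ?a_dec// -!E addn2 addn1 aky; exact: ltW.
rewrite in_itv/= => /andP[x2 x1] xy; exists n, x.
have xJ u : `|u - x| < eps -> J u.
  by rewrite lt_min ltr_norml => /andP[/andP[? ?]]; rewrite ltr_norml /J => /andP[? ?]; lra.
split.
- have /andP[? _] := a_bd 2; have /andP[_ ?] := a_bd 1; lra.
- exact: xy.
- move=> u /xJ /(iter_derive_bound n) /le_trans; apply.
  have an : a n < (2 * c)^-1.
    apply: le_lt_trans aN; apply: a_dec.
    by move: kN; rewrite addn3 !ltnS => /ltnW/ltnW.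
  have /andP[h _] := a_bd (n + 3)%N.
  rewrite -ler_pdivlMl// -invfM mulrC; lra.
- move=> u v /xJ Ju /xJ Jv; apply: le_trans (ln_iter_derive n u v) _.
  rewrite -mulr_sumr -mulrA ler_wpM2l ?(ltW K0)//.
  apply: (@le_trans _ _ (\sum_(i < n) c * (a i - a (i + 3)%N) * `|u - v|)).
    by apply: ler_sum => i _; exact: iter_lip.
  rewrite -mulr_suml ler_wpM2r// -mulr_sumr ler_wpM2l ?(ltW c0)//.
Qed.

End Parabolic.

(** * Contracting inverse branches *)

Section Branches.
Context {R : realType}.
Local Notation S1 := (circle R).
Implicit Types (x y z q u v : S1) (f g c : S1 -> S1) (phi psi : R -> R).
Implicit Types (G : set (S1 -> S1)) (L : set S1) (r eps theta K sg t : R).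

(** Contraction by [theta] and bounded distortion on a ball of radius [eps]:
    the properties of an inverse branch of an expanding map that survive
    composition with uniform constants. *)
Definition inverse_branch eps theta K c x :=
  (forall u, mdist x u < eps -> cderiv c u <= theta) /\
  (forall u v, mdist x u < eps -> mdist x v < eps ->
    `|ln (cderiv c u) - ln (cderiv c v)| <= K * mdist u v).

Lemma inverse_branch_mono eps eps' theta theta' K K' c x :
  eps' <= eps -> theta <= theta' -> K <= K' ->
  inverse_branch eps theta K c x -> inverse_branch eps' theta' K' c x.
Proof.
move=> he ht hK [b1 b2]; split=> [u ux|u v ux vx].
  by apply: le_trans (b1 _ _) ht; exact: lt_le_trans he.
apply: le_trans (b2 _ _ _ _) _; rewrite ?(lt_le_trans _ he)//.
by rewrite ler_wpM2r ?mdist_ge0.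
Qed.

Definition contractible G eps theta K y := exists x c,
  [/\ G c, c x = y & inverse_branch eps theta K c x].

Lemma expanding_contractible G g q : subgroup G -> G g -> 1 < cderiv g q ->
  exists r eps theta K, [/\ 0 < r, 0 < eps, 0 < theta < 1, 0 <= K &
    forall y, mdist q y < r -> contractible G eps theta K y].
Proof.
move=> sG Gg g1; have Dg := subgroup_diff2 sG Gg.
have [c [Gc gK cK]] := subgroup_inv sG Gg; have Dc := subgroup_diff2 sG Gc.
have cq : cderiv c (g q) < 1 by rewrite cderiv_cancel// invf_lt1// (lt_trans ltr01).
have c0 : 0 < cderiv c (g q) by exact: diff2_pos.
have cr0 : 0 < (1 - cderiv c (g q)) / 2 by rewrite divr_gt0// subr_gt0.
have [eps eps0 epsP] := cderiv_continuous (g q) Dc cr0.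
have [b [B [K [_ _ K0 _ cK']]]] := diff2_bounds Dc.
have [Bg Bg0 gl] := diff2_lipschitz Dg.
exists (eps / 2 / Bg), (eps / 2), ((1 + cderiv c (g q)) / 2), K; split => //.
- by rewrite !divr_gt0.
- by rewrite divr_gt0.
- by apply/andP; split; lra.
- exact: ltW.
move=> y yr; exists (g y), c; split => //; split => [u ux|u v _ _]; last exact: cK'.
have : mdist (g q) u < eps.
  apply: le_lt_trans (metric_triangle _ (g y) _) _; rewrite [ltRHS]splitr ltrD//.
  by apply: le_lt_trans (gl _ _) _; rewrite mulrC -ltr_pdivlMr.
by move/epsP; rewrite ltr_norml => /andP[_]; lra.
Qed.

Lemma iter_lift g phi n : Diff2_plus g -> is_lift g phi ->
  forall t, iter n g (cproj t) = cproj (iter n phi t).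
Proof. by move=> Dg [gp _]; elim: n => //= n IH t; rewrite IH gp. Qed.

(** Intermediate value theorem for [F t - t]. *)
Lemma no_fixed_lt (F : R -> R) (e s : R) : continuous F ->
  (forall t, 0 < t < e -> F t != t) -> 0 < s < e -> F s < s ->
  forall t, 0 < t < e -> F t < t.
Proof.
move=> cF nF se Fs t te; case: (ltgtP (F t) t) => // [Ft|Ft]; last first.
  by have := nF t te; rewrite Ft eqxx.
pose D (w : R) := F w - w.
have cD : continuous D by move=> u; apply: cvgB; [exact: cF|exact: cvg_id].
exfalso; case: (leP s t) => st.
- have [||c] := @IVT R D s t 0 st.
  + exact: continuous_subspaceT.
  + rewrite /D min_l ?max_r; lra.
  rewrite in_itv/= => csx /eqP; rewrite subr_eq0; apply/negP/nF; lra.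
- have [||c] := @IVT R D t s 0 (ltW st).
  + exact: continuous_subspaceT.
  + rewrite /D min_r ?max_l; lra.
  rewrite in_itv/= => csx /eqP; rewrite subr_eq0; apply/negP/nF; lra.
Qed.

Section OneSide.
Context (G : set (S1 -> S1)) (q : S1) (sg e : R) (sG : subgroup G).
Context (sg1 : sg * sg = 1) (e0 : 0 < e).

Let sgn : `|sg| = 1.
Proof.
by apply/eqP; rewrite -(@eqrXn2 _ 2)// -normrX expr2 sg1 normr1 expr1n.
Qed.

Let side phi t := sg * (phi (crep q + sg * t) - crep q).

Let sideK phi t : crep q + sg * side phi t = phi (crep q + sg * t).
Proof. by rewrite /side mulrA sg1 mul1r subrKC. Qed.

Let iter_side n phi t :
  iter n phi (crep q + sg * t) = crep q + sg * iter n (side phi) t.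
Proof. by elim: n => //= n ->; rewrite sideK. Qed.

Let is_derive_side g phi : is_lift g phi -> forall t : R,
  is_derive t 1 (side phi) (cderiv g (cproj (crep q + sg * t))).
Proof.
move=> [_ dp] t; rewrite /side.
have dl : is_derive t 1 (fun s : R => crep q + sg * s) sg.
  have := is_deriveD (is_derive_cst (crep q) t 1) (is_deriveZ sg (is_derive_id t 1)).
  by rewrite add0r /GRing.scale/= mulr1.
have := @is_derive1_comp R phi (fun s : R => crep q + sg * s) t _ _ (dp _) dl.
set d := cderiv _ _ => dc.
have := is_deriveZ sg (is_deriveB dc (is_derive_cst (crep q) t 1)).
by rewrite subr0 /GRing.scale/= mulrCA sg1 mulr1.
Qed.

(** The sign [sg], with [sg * sg = 1], selects the side of [q] so that both
    sides are treated at once: [side phi] is the lift read in the coordinate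
    [t |-> q + cproj (sg * t)]. *)
Lemma contracting_side g phi : G g -> is_lift g phi -> phi (crep q) = crep q ->
  (forall t, 0 < t < e -> side phi t < t) ->
  exists r eps theta K, [/\ 0 < r, 0 < eps, 0 < theta < 1, 0 <= K &
    forall t, 0 < t < r -> contractible G eps theta K (q + cproj (sg * t))].
Proof.
move=> Gg lp pq plt; have Dg := subgroup_diff2 sG Gg.
have [b [B [K [_ _ K0 _ gK]]]] := diff2_bounds Dg.
have [||r [eps [M [r0 eps0 M0 HP]]]] := @parabolic_expansion R (side phi)
  (fun t => cderiv g (cproj (crep q + sg * t))) K e (is_derive_side lp)
  (fun t => diff2_pos Dg _) K0 _ e0 _ plt.
- move=> s t; apply: le_trans (gK _ _) _; rewrite ler_wpM2l ?(ltW K0)//.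
  apply: le_trans (mdist_cproj_le _ _) _.
  by rewrite opprD addrACA subrr add0r -mulrBr normrM sgn mul1r.
- by rewrite /side mulr0 addr0 pq subrr mulr0.
have dit n t : iter_derive (side phi) (fun t => cderiv g (cproj (crep q + sg * t))) n t =
    cderiv (iter n g) (cproj (crep q + sg * t)).
  elim: n => [|n IH]; first by rewrite /iter_derive big_ord0 cderiv_id.
  have -> : forall F dF, iter_derive F dF n.+1 t = iter_derive F dF n t * dF (iter n F t) :> R.
    by move=> F dF; rewrite /iter_derive big_ord_recr.
  rewrite IH mulrC [iter n.+1 g](_ : _ = g \o iter n g)//.
  rewrite diff2_cderiv_comp//; last exact: (subgroup_diff2 sG (subgroup_iter n sG Gg)).
  by rewrite (iter_lift _ Dg lp) iter_side.
pose eps' := Num.min eps 4^-1.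
exists r, eps', 2^-1, M; split => //.
- by rewrite lt_min eps0; lra.
- by apply/andP; split; lra.
move=> t tr; have [n [x [xe itx dn ln]]] := HP t tr.
exists (cproj (crep q + sg * x)), (iter n g); split.
- exact: subgroup_iter.
- by rewrite (iter_lift _ Dg lp) iter_side itx cprojD crepK.
have chart u : mdist (cproj (crep q + sg * x)) u < eps' -> exists2 h,
    u = cproj (crep q + sg * h) & `|h - x| < eps'.
  have [h -> <-] := circle_chart (cproj (crep q + sg * x)) u => he.
  exists (x + sg * h); last by rewrite addrAC subrr add0r normrM sgn mul1r.
  by rewrite -cprojD mulrDr mulrA sg1 mul1r addrA.
split=> [u /chart[h -> hx]|u v /chart[h -> hx] /chart[k -> kx]].
  by rewrite -dit; apply: dn; apply: lt_le_trans hx _; rewrite ge_min lexx.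
rewrite mdist_cproj; last first.
  rewrite opprD addrACA subrr add0r -mulrBr normrM sgn mul1r.
  move: hx kx; rewrite !lt_min => /andP[_ hx] /andP[_ kx].
  rewrite -[h](subrK x) -[k](subrK x) opprD addrACA subrr addr0.
  by rewrite (le_trans (ler_normB _ _))//; lra.
rewrite opprD addrACA subrr add0r -mulrBr normrM sgn mul1r -!dit.
by apply: ln; [apply: lt_le_trans hx _|apply: lt_le_trans kx _]; rewrite ge_min lexx.
Qed.

(** Without fixed points on the given side, [g] or its inverse moves all
    points towards [q]. *)
Lemma isolated_side g : G g -> g q = q ->
  (forall t, 0 < t < e -> g (q + cproj (sg * t)) <> q + cproj (sg * t)) ->
  exists r eps theta K, [/\ 0 < r, 0 < eps, 0 < theta < 1, 0 <= K &
    forall t, 0 < t < r -> contractible G eps theta K (q + cproj (sg * t))].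
Proof.
move=> Gg gq iso.
have [|g' [phi [psi [[Gg' gK g'K] lp lq [pq qq] [pK qK]]]]] :=
  @lift_inverse R G g (crep q) (crep q) sG Gg.
  by rewrite crepK.
have nofix f F : G f -> is_lift f F -> F (crep q) = crep q ->
    (forall t, 0 < t < e -> f (q + cproj (sg * t)) <> q + cproj (sg * t)) ->
    forall t, 0 < t < e -> side F t != t.
  move=> Gf lf Fq ff t te; apply/eqP => Ft; apply: (ff t te).
  have := sideK F t; rewrite Ft => E.
  by rewrite -[q]crepK -cprojD lf.1 -E.
have iso' t : 0 < t < e -> g' (q + cproj (sg * t)) <> q + cproj (sg * t).
  by move=> te E; apply: (iso t te); rewrite -{1}E g'K.
have contF f F : is_lift f F -> continuous (side F).
  by move=> lf; exact: (is_derive_continuous (is_derive_side lf)).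
have e2 : 0 < e / 2 < e by have := e0 => ?; apply/andP; split; lra.
have ng := nofix _ _ Gg lp pq iso; have ng' := nofix _ _ Gg' lq qq iso'.
case: (ltgtP (side phi (e / 2)) (e / 2)) => [h|h|/eqP]; last by rewrite (negPf (ng _ e2)).
  by apply: (contracting_side Gg lp pq); exact: (no_fixed_lt (contF _ _ lp) ng e2).
apply: (contracting_side Gg' lq qq); apply: (no_fixed_lt (contF _ _ lq) ng' e2).
rewrite ltNge; apply/negP => h'.
have : side phi (e / 2) <= side phi (side psi (e / 2)).
  rewrite le_eqVlt in h'; case/orP: h' => [/eqP<-//|h'].
  apply/ltW/(derive_pos_lt h' (is_derive_side lp)) => u.
  exact: (diff2_pos (subgroup_diff2 sG Gg)).
by rewrite {2}/side sideK qK addrAC subrr add0r mulrA sg1 mul1r leNgt h.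
Qed.

End OneSide.

End Branches.

(** A base point, which the finite subcover form of compactness refers to. *)
HB.instance Definition _ (R : realType) := isPointed.Build (circle R) 0.

Section Expansion.
Context {R : realType}.
Local Notation S1 := (circle R).
Implicit Types (x y z q u v : S1) (f g c : S1 -> S1).
Implicit Types (G : set (S1 -> S1)) (L : set S1) (r eps theta K : R).

(** One integer controls the radius, the rate and the distortion at once, so
    that finitely many local statements have a common bound.  The shift by [4]
    keeps the radius at most [1/4]. *)
Definition uniformly_contractible G (k : nat) y :=
  contractible G k.+4%:R^-1 (1 - k.+4%:R^-1) k%:R y.

Lemma contractible_uniform G eps theta K : 0 < eps -> 0 < theta < 1 ->
  exists k, forall y j, (k <= j)%N -> contractible G eps theta K y -> uniformly_contractible G j y.
Proof.
move=> eps0 /andP[t0 t1].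
pose A := Num.truncn eps^-1; pose B := Num.truncn (1 - theta)^-1.
pose C := Num.truncn `|K|.
exists (A + B + C.+1)%N => y j kj.
have [kA kB kC] : [/\ (A <= j)%N, (B <= j)%N & (C.+1 <= j)%N].
  by move: kj; move: A B C => A B C; split; lia.
have inv_le (a : R) : 0 < a -> (Num.truncn a^-1 <= j)%N -> j.+4%:R^-1 <= a.
  move=> a0 aj; rewrite invf_ple ?posrE// ltW// (lt_le_trans (truncnS_gt _))//.
  by rewrite ler_nat ltnS (leq_trans aj)// !leqW.
have i1 : j.+4%:R^-1 <= eps by exact: inv_le.
have i2 : j.+4%:R^-1 <= 1 - theta by apply: inv_le; rewrite ?subr_gt0.
have i3 : K <= j%:R.
  apply: le_trans (ler_norm _) _; rewrite ltW// (lt_le_trans (truncnS_gt _))//.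
  by rewrite ler_nat.
move=> [x [c [Gc cx bc]]]; exists x, c; split => //.
by apply: inverse_branch_mono bc => //; rewrite lerBrDr -lerBrDl.
Qed.

Lemma uniformly_contractible_mono G j k y : (j <= k)%N ->
  uniformly_contractible G j y -> uniformly_contractible G k y.
Proof.
move=> jk [x [c [Gc cx bc]]]; exists x, c; split => //.
have h : k.+4%:R^-1 <= j.+4%:R^-1 :> R by rewrite lef_pV2 ?posrE// ler_nat.
by apply: inverse_branch_mono bc => //; [rewrite lerD2l lerN2|rewrite ler_nat].
Qed.

(** Either some element expands at [q], or [q] is in [NE] and the isolated
    fixed points handle its two sides; only in the second case is [q] itself to
    be excluded. *)
Lemma near_uniformly_contractible G L q : subgroup G -> L q ->
  (forall x, (NE G `&` L) x -> has_isolating_fixers G x) ->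
  exists k r, 0 < r /\ forall y, y != q -> mdist q y < r -> uniformly_contractible G k y.
Proof.
move=> sG Lq star; have [nq|nq] := pselect (NE G q); last first.
  have [g Gg gq] : exists2 g, G g & 1 < cderiv g q.
    apply: contrapT => H; apply: nq => g Gg; rewrite leNgt; apply/negP => gq.
    by apply: H; exists g.
  have [r [eps [theta [K [r0 eps0 t01 _ H]]]]] := expanding_contractible sG Gg gq.
  have [k kP] := contractible_uniform G K eps0 t01.
  by exists k, r; split => // y _ yr; apply: (kP _ k) => //; exact: H.
have [[gp [Gp pq [ep ep0 pP]]] [gm [Gm mq [em em0 mP]]]] := star q (conj nq Lq).
have [||r1 [eps1 [theta1 [K1 [r10 eps10 t11 _ H1]]]]] :=
  @isolated_side R G q 1 ep sG _ ep0 gp Gp pq.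
- by rewrite mulr1.
- by move=> t te; rewrite mul1r; exact: pP.
have [||r2 [eps2 [theta2 [K2 [r20 eps20 t21 _ H2]]]]] :=
  @isolated_side R G q (-1) em sG _ em0 gm Gm mq.
- by rewrite mulrNN mulr1.
- by move=> t te; rewrite mulN1r cprojN; exact: mP.
have [k1 k1P] := contractible_uniform G K1 eps10 t11.
have [k2 k2P] := contractible_uniform G K2 eps20 t21.
exists (maxn k1 k2), (Num.min r1 r2); split; first by rewrite lt_min r10.
move=> y; have [h -> <-] := circle_chart q y; rewrite lt_min => hq /andP[hr1 hr2].
case: (ltgtP h 0) => [h0|h0|h0].
- apply: (k2P _ _ (leq_maxr _ _)).
  have := H2 (- h); rewrite mulN1r opprK; apply.
  by rewrite oppr_gt0 h0 -(ltr0_norm h0).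
- apply: (k1P _ _ (leq_maxl _ _)).
  have := H1 h; rewrite mul1r; apply.
  by rewrite h0 -(gtr0_norm h0).
- by move: hq; rewrite h0 cproj0 addr0 eqxx.
Qed.

(** Compactness; the set [P] consists of the centres of a finite cover. *)
Lemma all_uniformly_contractible G L : subgroup G -> closed L ->
  (forall x, (NE G `&` L) x -> has_isolating_fixers G x) ->
  exists k (P : set S1), finite_set P /\ forall y, L y -> P y \/ uniformly_contractible G k y.
Proof.
move=> sG cL star.
have ex q : exists kr : nat * R, 0 < kr.2 /\
    (L q -> forall y, y != q -> mdist q y < kr.2 -> uniformly_contractible G kr.1 y).
  have [Lq|nLq] := pselect (L q); last by exists (0%N, 1); split.
  by have [k [r [r0 H]]] := near_uniformly_contractible sG Lq star; exists (k, r).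
(* A choice of local data [(k, r)] at each point. *)
pose F q := projT1 (cid (ex q)).
have FP q : 0 < (F q).2 /\
    (L q -> forall y, y != q -> mdist q y < (F q).2 -> uniformly_contractible G (F q).1 y).
  by rewrite /F; case: cid.
have cL' : cover_compact L by rewrite -compact_cover; exact: closed_compact_circle.
have [||D DL LD] := cL' S1 L (fun q => (ball q (F q).2)^°).
- move=> q _; exact: open_interior.
- by move=> q Lq; exists q => //; apply: nbhsx_ballx; case: (FP q).
exists (\max_(q <- finmap.enum_fset D) (F q).1)%N, [set` finmap.enum_fset D]; split; first exact: finite_seq.
move=> y Ly; have [q qD /interior_subset qy] := LD y Ly.
have [->|yq] := eqVneq y q; [by left|right].
apply: (@uniformly_contractible_mono _ (F q).1); first exact: leq_bigmax_seq.
by apply: (FP q).2 => //; exact: (set_mem (DL _ qD)).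
Qed.

(** The first map is seen through the second one, which contracts by [theta]:
    its distortion enters multiplied by [theta], and a bound [M] with
    [M * theta + K <= M] is preserved. *)
Lemma inverse_branch_comp (eps a theta K M : R) f c x : Diff2_plus f -> Diff2_plus c ->
  eps <= 4^-1 -> 0 <= theta < 1 -> 0 <= a -> 0 <= M -> M * theta + K <= M ->
  inverse_branch eps a M f (c x) -> inverse_branch eps theta K c x ->
  inverse_branch eps (a * theta) M (f \o c) x.
Proof.
move=> Df Dc eps4 /andP[t0 t1] a0 M0 MK [f1 f2] [c1 c2].
have cball u : mdist x u < eps -> mdist (c x) (c u) < eps.
  move=> ux; have xx : mdist x x < eps.
    by rewrite mdistxx; apply: le_lt_trans ux; exact: mdist_ge0.
  apply: le_lt_trans (ball_lipschitz Dc eps4 c1 xx ux) _.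
  by apply: le_lt_trans ux; rewrite ler_piMl ?mdist_ge0// ltW.
split=> [u ux|u v ux vx].
  rewrite (diff2_cderiv_comp _ Df Dc).
  apply: ler_pM; [exact/ltW/diff2_pos|exact/ltW/diff2_pos| |exact: c1].
  by apply: f1; exact: cball.
rewrite !(diff2_cderiv_comp _ Df Dc).
have f0 := diff2_pos Df; have c0 := diff2_pos Dc.
rewrite !lnM ?posrE// opprD addrACA.
apply: le_trans (ler_normD _ _) _.
apply: (@le_trans _ _ ((M * theta + K) * mdist u v)); last by rewrite ler_wpM2r ?mdist_ge0.
rewrite mulrDl -mulrA; apply: lerD; last exact: c2.
apply: le_trans (f2 _ _ (cball _ ux) (cball _ vx)) _.
by apply: ler_wpM2l => //; exact: (ball_lipschitz Dc eps4 c1).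
Qed.

(** The bound [M] is the sum of the geometric series of distortions. *)
Lemma iterated_branches G L : subgroup G -> minimal_set G L ->
  (forall x, (NE G `&` L) x -> has_isolating_fixers G x) ->
  exists (eps theta M : R) (P : set S1),
  [/\ 0 < eps <= 4^-1, 0 < theta < 1, 0 <= M, finite_set P &
  forall y, L y -> (forall g p, G g -> P p -> g p <> y) -> forall n,
    exists x f, [/\ L x, G f, f x = y & inverse_branch eps (theta ^+ n) M f x]].
Proof.
move=> sG [L0 cL iL _] star; have [k [P [fP kP]]] := all_uniformly_contractible sG cL star.
have [eps [eps0 eps4 epsE]] : exists eps : R, [/\ 0 < eps, eps <= 4^-1 & eps = k.+4%:R^-1].
  by exists k.+4%:R^-1; split => //; rewrite lef_pV2 ?posrE// ler_nat.
rewrite /uniformly_contractible -epsE in kP; pose theta := 1 - eps; pose M : R := k%:R / eps.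
have t01 : 0 < theta < 1 by rewrite /theta; apply/andP; split; lra.
have M0 : 0 <= M by rewrite divr_ge0 ?ler0n// ltW.
exists eps, theta, M, P; split; rewrite ?eps0//.
have MK : M * theta + k%:R <= M.
  by rewrite /theta mulrBr mulr1 /M divfK ?gt_eqF//; lra.
move=> y Ly nP; elim=> [|n [x1 [f [Lx1 Gf fx1 bf]]]].
  exists y, id; split => //; first by case: sG.
  split=> [u _|u v _ _]; first by rewrite cderiv_id expr0.
  by rewrite !cderiv_id subrr normr0 mulr_ge0 ?mdist_ge0.
case: (kP _ Lx1) => [Px1|[x [c [Gc cx bc]]]]; first by have := nP f x1 Gf Px1.
have [c' [Gc' cK _]] := subgroup_inv sG Gc.
exists x, (f \o c); split => /=.
- by rewrite -(cK x); apply: (iL _ Gc'); exists (c x) => //; rewrite cx.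
- exact: subgroup_comp.
- by rewrite cx.
rewrite exprSr; apply: (inverse_branch_comp (K := k%:R)) => //.
- exact: (subgroup_diff2 sG).
- exact: (subgroup_diff2 sG).
- by case/andP: t01 => /ltW -> ->.
- by rewrite exprn_ge0//; case/andP: t01 => /ltW.
- by rewrite cx.
Qed.

End Expansion.

(** * Covers and Hausdorff measure *)

Section Hausdorff.
Context {R : realType} {T : metricType R}.
Implicit Types (A U : set T) (s d e : R).

Lemma diameter_ge0 U : (0 <= diameter U)%E.
Proof. by rewrite /diameter le_max lexx. Qed.

Lemma diameter_le U d : 0 <= d -> (forall x y, U x -> U y -> mdist x y <= d) ->
  (diameter U <= d%:E)%E.
Proof.
move=> d0 H; rewrite /diameter ge_max lee_fin d0 /=.
by apply: ge_ereal_sup => _ [[x y] /= [Ux Uy] <-]; rewrite lee_fin H.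
Qed.

Lemma mdist_le_diameter U x y : U x -> U y -> ((mdist x y)%:E <= diameter U)%E.
Proof.
move=> Ux Uy; rewrite /diameter le_max; apply/orP; right.
by apply: ereal_sup_ubound; exists (x, y).
Qed.

(** Each piece of a cover has size at most the sum to the power [1 / s], so
    covers with small sums are fine covers. *)
Lemma hausdorff_measure0 s A : 0 < s ->
  (forall e, 0 < e -> exists (U : nat -> set T) (w : nat -> R),
    [/\ A `<=` \bigcup_i U i, forall i, 0 <= w i,
        forall i x y, U i x -> U i y -> mdist x y <= w i &
        forall M, \sum_(i < M) w i `^ s <= e]) ->
  hausdorff_measure s A = 0%E.
Proof.
move=> s0 H; apply/eqP; rewrite eq_le; apply/andP; split; last first.
  apply: le_trans (ereal_sup_ubound _); last first.
    by exists 1 => //=; rewrite in_itv/= ltr01.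
  apply: le_ereal_inf_tmp => _ [U _ <-]; apply: nneseries_ge0 => i _ _; exact: poweR_ge0.
apply: ge_ereal_sup => _ [d dI <-].
have d0 : 0 < d by move: dI; rewrite /= in_itv/= andbT.
apply/lee_addgt0Pr => e e0; rewrite add0e.
pose e' := Num.min e (d `^ s).
have e'0 : 0 < e' by rewrite lt_min e0 powR_gt0.
have [U [w [AU w0 Uw ws]]] := H _ e'0.
have dU i : (diameter (U i) <= (w i)%:E)%E by apply: diameter_le => //; exact: Uw.
have wd i : w i <= d.
  have := ws i.+1; rewrite big_ord_recr /= => wi.
  have {}wi : w i `^ s <= d `^ s.
    apply: (@le_trans _ _ e'); last by rewrite ge_min lexx orbT.
    by apply: le_trans wi; rewrite lerDr sumr_ge0// => j _; exact: powR_ge0.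
  rewrite leNgt; apply/negP => dw; move: wi; rewrite leNgt => /negP; apply.
  by apply: gt0_ltr_powR => //; rewrite nnegrE// ltW.
apply: (@le_trans _ _ e'%:E); last by rewrite lee_fin ge_min lexx.
apply: (@le_trans _ _ (\sum_(0 <= i <oo) (poweR (diameter (U i)) s))%E).
  apply: ereal_inf_lbound; exists U => //; split => // i.
  by apply: le_trans (dU i) _; rewrite lee_fin.
apply: lime_le; first by apply: is_cvg_nneseries => i _ _; exact: poweR_ge0.
near=> M; rewrite big_mkord.
apply: (@le_trans _ _ (\sum_(i < M) (w i `^ s)%:E)%E); last by rewrite sumEFin lee_fin.
apply: lee_sum => i _; rewrite -poweR_EFin.
by apply: gt0_ler_poweR; rewrite ?(ltW s0)// in_itv/= leey andbT ?diameter_ge0// lee_fin.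
Unshelve. all: end_near. Qed.

Lemma hausdorff_small_cover s A e : hausdorff_measure s A = 0%E -> 0 < s -> 0 < e ->
  exists (U : nat -> set T) (w : nat -> R),
    [/\ A `<=` \bigcup_i U i, forall i, 0 <= w i,
        forall i x y, U i x -> U i y -> mdist x y <= w i &
        forall M, \sum_(i < M) w i `^ s <= e].
Proof.
move=> HA s0 e0.
have : (hausdorff_premeasure s 1 A < e%:E)%E.
  rewrite (@le_lt_trans _ _ 0%E) ?lte_fin// -HA; apply: ereal_sup_ubound.
  by exists 1 => //=; rewrite in_itv/= ltr01.
move=> /ereal_inf_lt[_ [U [AU U1] <-] Ue].
have fU i : diameter (U i) \is a fin_num.
  by rewrite ge0_fin_numE ?diameter_ge0// (le_lt_trans (U1 i)) ?ltry.
exists U, (fun i => fine (diameter (U i))); split => //.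
- by move=> i; rewrite fine_ge0 ?diameter_ge0.
- by move=> i x y Ux Uy; rewrite -lee_fin fineK// mdist_le_diameter.
move=> M; rewrite -lee_fin -sumEFin.
apply: le_trans (ltW Ue).
apply: le_trans (nneseries_lim_ge M _); last by move=> i _ _; exact: poweR_ge0.
rewrite big_mkord; apply: lee_sum => i _.
by rewrite -poweR_EFin fineK.
Qed.

(** Covers indexed by pairs [(n, j)] with [j < K n] become sequences through
    the enumeration of pairs of natural numbers. *)
Lemma flatten_cover s A (K : nat -> nat) (U : nat -> nat -> set T) (d : nat -> nat -> R) e :
  0 < s ->
  (forall n j, 0 <= d n j) ->
  (forall n j x y, (j < K n)%N -> U n j x -> U n j y -> mdist x y <= d n j) ->
  (forall x, A x -> exists n j, (j < K n)%N /\ U n j x) ->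
  (forall N, \sum_(n < N) \sum_(j < K n) d n j `^ s <= e) ->
  exists (V : nat -> set T) (w : nat -> R),
    [/\ A `<=` \bigcup_i V i, forall i, 0 <= w i,
        forall i x y, V i x -> V i y -> mdist x y <= w i &
        forall M, \sum_(i < M) w i `^ s <= e].
Proof.
move=> s0 d0 Ud AU de.
(* Codes that do not correspond to an admissible pair give the empty set. *)
pose V (k : nat) := if (pickle_inv k : option (nat * nat)) is Some (n, j)
            then (if (j < K n)%N then U n j else set0) else set0.
pose w (k : nat) := if (pickle_inv k : option (nat * nat)) is Some (n, j)
            then (if (j < K n)%N then d n j else 0) else 0.
exists V, w; split.
- move=> x /AU[n [j [jK Ux]]]; exists (pickle (n, j)) => //.
  by rewrite /V pickleK_inv jK.
- by move=> i; rewrite /w; case: pickle_inv => // -[n j]; case: ifP.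
- move=> i x y; rewrite /V /w; case: pickle_inv => // -[n j]; case: ifP => // jK.
  exact: Ud.
move=> M.
pose N := (\sum_(k < M) (if (pickle_inv k : option (nat * nat)) is Some p then p.1.+1 else 0))%N.
apply: le_trans (de N).
have wle (k : 'I_M) : w k `^ s <= \sum_(n < N) \sum_(j < K n)
    (if pickle (nat_of_ord n, nat_of_ord j) == k then d n j `^ s else 0).
  have pos (F : nat -> nat -> bool) : 0 <= \sum_(n < N) \sum_(j < K n)
      (if F n j then d n j `^ s else 0).
    by apply: sumr_ge0 => n _; apply: sumr_ge0 => j _; case: ifP => // _; exact: powR_ge0.
  rewrite /w; case E : (pickle_inv k) => [[n j]|]; last first.
    by rewrite powR0 ?gt_eqF//; exact: (pos (fun n j => pickle (n, j) == k)).
  case: ifP => [jK|_]; last by rewrite powR0 ?gt_eqF//; exact: (pos (fun n j => pickle (n, j) == k)).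
  have nN : (n < N)%N.
    rewrite /N (bigD1 k)//= E /=; apply: leq_addr.
  have pk : pickle (n, j) == k.
    by have := @pickle_invK (nat * nat)%type k; rewrite E /= => ->.
  rewrite (bigD1 (Ordinal nN))//= (bigD1 (Ordinal jK))//= pk -addrA lerDl.
  rewrite addr_ge0//; apply: sumr_ge0 => i _.
    by case: ifP => // _; exact: powR_ge0.
  by apply: sumr_ge0 => l _; case: ifP => // _; exact: powR_ge0.
apply: (le_trans (ler_sum _ (fun k _ => wle k))).
rewrite exchange_big /=; apply: ler_sum => n _; rewrite exchange_big /=; apply: ler_sum => j _.
rewrite -big_mkcond /=.
have [h|h] := boolP (pickle (nat_of_ord n, nat_of_ord j) < M)%N.
  by rewrite (eq_bigl (pred1 (Ordinal h))) ?big_pred1_eq.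
rewrite big_pred0 ?powR_ge0// => k; apply/negbTE; apply: contra h => /eqP ->.
exact: ltn_ord.
Qed.

End Hausdorff.

(** * The critical exponent as a supremum of growth rates *)

Section LimsupLemmas.
Context {R : realType}.
Implicit Types (u v : nat -> \bar R).

Lemma limn_esup_lt u (b : \bar R) : (limn_esup u < b)%E ->
  exists N, forall n, (N <= n)%N -> (u n <= b)%E.
Proof.
rewrite /limn_esup /limf_esup => /ereal_inf_lt[_ [A [N _ NA] <-] ub].
exists N => n Nn; apply: le_trans (ltW ub); apply: ereal_sup_ubound.
by exists n => //; exact: NA.
Qed.

Lemma limn_esup_le u (b : \bar R) N : (forall n, (N <= n)%N -> (u n <= b)%E) ->
  (limn_esup u <= b)%E.
Proof.
move=> ub; rewrite /limn_esup /limf_esup.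
apply: (@le_trans _ _ (ereal_sup (u @` [set n | (N <= n)%N]))).
  by apply: ereal_inf_lbound; exists [set n | (N <= n)%N] => //; exists N.
by apply: ge_ereal_sup => _ [n Nn <-]; exact: ub.
Qed.

Lemma limn_esup_mono u v : (forall n, (u n <= v n)%E) -> (limn_esup u <= limn_esup v)%E.
Proof.
move=> uv; rewrite /limn_esup /limf_esup; apply: le_ereal_inf_tmp => _ [A FA <-].
apply: (@le_trans _ _ (ereal_sup (u @` A))).
  by apply: ereal_inf_lbound; exists A.
apply: ge_ereal_sup => _ [n An <-]; apply: le_trans (uv n) _.
by apply: ereal_sup_ubound; exists n.
Qed.

End LimsupLemmas.

Section Exponent.
Context {R : realType}.
Local Notation S1 := (circle R).
Implicit Types (G : set (S1 -> S1)) (L : set S1) (eps C s : R).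

Lemma counting_mono (T : choiceType) (A B : set T) : A `<=` B ->
  (counting A <= counting B :> \bar R)%E.
Proof.
move=> AB; rewrite /counting; case: asboolP => fA; case: asboolP => fB.
- rewrite lee_fin ler_nat; apply: finmap.fsubset_leq_card.
  by rewrite -fset_set_sub.
- by rewrite leey.
- by have := sub_finite_set AB fB.
- by rewrite leey.
Qed.

Lemma counting_ge0 (T : choiceType) (A : set T) : (0 <= counting A :> \bar R)%E.
Proof. by rewrite /counting; case: asboolP => // _; rewrite lee_fin. Qed.

Lemma ln2_gt0 : 0 < ln 2 :> R.
Proof. by rewrite ln_gt0// ltr1n. Qed.

Lemma elog2_mono (x y : \bar R) : (0 <= x)%E -> (x <= y)%E -> (elog2 x <= elog2 y)%E.
Proof.
move=> x0 xy; rewrite /elog2; apply: lee_wpmul2r.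
  by rewrite lee_fin invr_ge0 ltW// ln2_gt0.
rewrite lee_lne// in_itv/= leey andbT//; exact: le_trans xy.
Qed.

Definition growth_rate G L eps C : \bar R := limn_esup (fun n : nat =>
  ((n%:R^-1)%:E * elog2 (counting (expanding_elements G L eps C n)))%E).

Lemma expanding_elements_mono G L eps eps' C C' n n' : eps' <= eps -> C <= C' ->
  (n <= n')%N ->
  expanding_elements G L eps C n `<=` expanding_elements G L eps' C' n'.
Proof.
move=> he hC hn g [Gg [x Lx [d1 d2]]]; split => //; exists x => //; split.
  move=> y xy; apply: (le_trans _ (d1 y _)); last exact: le_ball he _ xy.
  by rewrite lef_pV2 ?posrE ?exprn_gt0// ler_weXn2l// ler1n.
apply: (@le_trans _ _ C%:E); last by rewrite lee_fin.
apply: le_trans d2; apply: ge_ereal_sup => _ [p [p1 p2 p12] <-].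
by apply: ereal_sup_ubound; exists p => //; split => //; exact: le_ball he _ _.
Qed.

Lemma growth_rate_mono G L eps eps' C C' : eps' <= eps -> C <= C' ->
  (growth_rate G L eps C <= growth_rate G L eps' C')%E.
Proof.
move=> he hC; apply: limn_esup_mono => n; apply: lee_wpmul2l.
  by rewrite lee_fin invr_ge0.
apply: elog2_mono; first exact: counting_ge0.
exact/counting_mono/expanding_elements_mono.
Qed.

Lemma nonincreasing_lim_at_right (f : R -> \bar R) :
  (forall e e', e <= e' -> (f e' <= f e)%E) ->
  lim (f x @[x --> 0^'+]) = ereal_sup (f @` `]0, +oo[).
Proof.
move=> fm; apply: cvg_lim => //.
have := @nonincreasing_at_right_cvge R f 0 (BInfty _ false) isT; apply.
by move=> e e' _ _; exact: fm.
Qed.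

(** The counted set grows when [C] grows and when [eps] decreases. *)
Lemma delta2E G L : delta2 G L =
  ereal_sup [set ereal_sup (range (growth_rate G L eps)) | eps in `]0, +oo[].
Proof.
rewrite /delta2.
have -> : (fun eps => lim (limn_esup (fun n : nat =>
    ((n%:R^-1)%:E * elog2 (counting (expanding_elements G L eps C n)))%E)
    @[C --> +oo%R])) = fun eps => ereal_sup (range (growth_rate G L eps)).
  apply/funext => eps; apply/cvg_lim => //.
  by apply: nondecreasing_cvge => C C'; exact: growth_rate_mono.
pose f eps := ereal_sup (range (growth_rate G L eps)).
suff fm e e' : e <= e' -> (f e' <= f e)%E by exact: (nonincreasing_lim_at_right fm).
move=> ee'.
apply: ge_ereal_sup => _ [C _ <-]; apply: le_trans (growth_rate_mono G L ee' (lexx C)) _.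
by apply: ereal_sup_ubound; exists C.
Qed.

Lemma growth_rate_le_delta2 G L eps C : 0 < eps ->
  (growth_rate G L eps C <= delta2 G L)%E.
Proof.
move=> e0; rewrite delta2E; apply: (@le_trans _ _ (ereal_sup (range (growth_rate G L eps)))).
  by apply: ereal_sup_ubound; exists C.
by apply: ereal_sup_ubound; exists eps => //=; rewrite in_itv/= e0.
Qed.

Lemma delta2_le G L (b : \bar R) (e0 : R) : 0 < e0 ->
  (forall eps C, 0 < eps <= e0 -> (growth_rate G L eps C <= b)%E) -> (delta2 G L <= b)%E.
Proof.
move=> e00 H; rewrite delta2E; apply: ge_ereal_sup => _ [eps + <-].
rewrite /= in_itv/= andbT => eps0; apply: ge_ereal_sup => _ [C _ <-].
apply: (@le_trans _ _ (growth_rate G L (Num.min eps e0) C)).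
  by apply: growth_rate_mono; rewrite // ge_min lexx.
by apply: H; rewrite lt_min eps0 e00 ge_min lexx orbT.
Qed.

Lemma powR2E (t : R) : 2 `^ t = expR (t * ln 2).
Proof. by rewrite /powR pnatr_eq0. Qed.

Lemma growth_rate_lt G L eps C s : (growth_rate G L eps C < s%:E)%E ->
  exists N, forall n, (N <= n)%N -> exists gs : seq (S1 -> S1),
    (forall g, expanding_elements G L eps C n g -> g \in gs) /\
    (size gs)%:R <= 2 `^ (s * n%:R).
Proof.
move=> /limn_esup_lt[N NP]; exists N.+1 => n Nn.
have := NP n (ltnW Nn); set E := expanding_elements _ _ _ _ _.
have n0 : 0 < n%:R :> R by rewrite ltr0n (leq_trans _ Nn).
rewrite /counting; case: asboolP => fE; last first.
  rewrite /elog2 /= mulyr gtr0_sg ?invr_gt0 ?ln2_gt0// mul1e mulry gtr0_sg ?invr_gt0//.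
  by rewrite mul1e.
move=> H; exists (finmap.enum_fset (fset_set E)).
split; first by move=> g Eg; have := in_fset_set fE g; rewrite [RHS]mem_set.
move: H; set k := size _ => H.
have [->|k0] := eqVneq k 0%N; first exact: powR_ge0.
have k0' : 0 < k%:R :> R by rewrite ltr0n lt0n.
move: H; rewrite /elog2 lne_EFin// -!EFinM lee_fin => H.
rewrite powR2E -[leLHS]lnK ?posrE// ler_expR.
by rewrite -ler_pdivrMr ?ln2_gt0// -ler_pdivrMr// mulrC.
Qed.

Lemma growth_rate_le G L eps C s (A : R) : 0 < A ->
  (forall n (gs : seq (S1 -> S1)), uniq gs ->
    (forall g, g \in gs -> expanding_elements G L eps C n g) ->
    (size gs)%:R <= A * 2 `^ (s * n%:R)) ->
  (growth_rate G L eps C <= s%:E)%E.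
Proof.
move=> A0 H; apply/lee_addgt0Pr => e e0.
pose N := (Num.truncn (`|ln A / ln 2| / e)).+1.
apply: (@limn_esup_le _ _ _ N) => n Nn.
have n0 : 0 < n%:R :> R by rewrite ltr0n (leq_trans _ Nn).
have cE : (counting (expanding_elements G L eps C n) <= (A * 2 `^ (s * n%:R))%:E)%E.
  set E := expanding_elements G L eps C n; set a := A * _.
  have fE : finite_set E.
    apply: contrapT => /(infinite_set_fset (Num.truncn a).+1)[B BE Bn].
    have := H n (finmap.enum_fset B) (finmap.fset_uniq B) (fun g gB => BE _ gB).
    rewrite leNgt => /negP; apply; rewrite -/a (lt_le_trans (truncnS_gt _))//.
    by rewrite ler_nat.
  rewrite /counting asboolT// lee_fin.
  apply: (H n (finmap.enum_fset (fset_set E))) => [|g]; first exact: finmap.fset_uniq.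
  by rewrite in_fset_set// inE.
apply: (@le_trans _ _ ((n%:R^-1)%:E * elog2 (A * 2 `^ (s * n%:R))%:E)%E).
  apply: lee_wpmul2l; first by rewrite lee_fin invr_ge0.
  by apply: elog2_mono => //; exact: counting_ge0.
rewrite /elog2 lne_EFin ?mulr_gt0 ?powR_gt0// -!EFinM -EFinD lee_fin.
rewrite lnM ?posrE ?powR_gt0// ln_powR mulrDl mulfK ?gt_eqF ?ln2_gt0// mulrDr.
rewrite addrC mulrCA mulVf ?gt_eqF// mulr1 lerD2l mulrC ler_pdivrMr// mulrC -ler_pdivrMl//.
apply: le_trans (ler_norm _) _; rewrite mulrC normrM (gtr0_norm (x := e^-1)) ?invr_gt0//.
rewrite [leLHS]mulrC; apply: le_trans (ltW (truncnS_gt _)) _; rewrite ler_nat; exact: Nn.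
Qed.

End Exponent.

(** * The dimension is at most the critical exponent *)

Section UpperBound.
Context {R : realType}.
Local Notation S1 := (circle R).
Implicit Types (x y z u v : S1) (g f : S1 -> S1) (G : set (S1 -> S1)) (L : set S1).

Lemma distortion_le g x (eps C : R) : 0 <= C ->
  (forall u v, mdist x u < eps -> mdist x v < eps ->
    `|ln (cderiv g u) - ln (cderiv g v)| <= C * ln 2 * mdist u v) ->
  (distortion g (ball x eps) <= C%:E)%E.
Proof.
move=> C0 H; apply: ge_ereal_sup => _ [[u v]/= [xu xv uv] <-].
rewrite lee_fin ler_pdivrMr ?mdist_gt0// /log2 -mulrBl normrM.
rewrite (gtr0_norm (x := (ln 2)^-1)) ?invr_gt0 ?ln2_gt0//.
by rewrite ler_pdivrMr ?ln2_gt0// mulrAC; apply: H.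
Qed.

Lemma distortion_ln g x (eps C : R) : (distortion g (ball x eps) <= C%:E)%E ->
  forall u v, mdist x u < eps -> mdist x v < eps ->
    `|ln (cderiv g u) - ln (cderiv g v)| <= C * ln 2 * mdist u v.
Proof.
move=> H u v xu xv; have [->|uv] := eqVneq u v.
  by rewrite subrr normr0 mdistxx mulr0.
have : ((`|log2 (cderiv g u) - log2 (cderiv g v)| / mdist u v)%:E <= C%:E)%E.
  by apply: le_trans H; apply: ereal_sup_ubound; exists (u, v).
rewrite lee_fin ler_pdivrMr ?mdist_gt0// /log2 -mulrBl normrM.
rewrite (gtr0_norm (x := (ln 2)^-1)) ?invr_gt0 ?ln2_gt0//.
by rewrite ler_pdivrMr ?ln2_gt0// mulrAC.
Qed.

Lemma limn_esup_ge0 (w : nat -> \bar R) : (forall n, (0 <= w n)%E) -> (0 <= limn_esup w)%E.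
Proof.
move=> w0; apply: le_ereal_inf_tmp => _ [A [N _ NA] <-].
apply: le_trans (w0 N) _; apply: ereal_sup_ubound; exists N => //; exact: (NA N (leqnn N)).
Qed.

Lemma delta2_ge0 G L : subgroup G -> L !=set0 -> (0 <= delta2 G L)%E.
Proof.
move=> sG [x Lx]; apply: le_trans (growth_rate_le_delta2 G L 0 ltr01).
apply: limn_esup_ge0 => n; apply: mule_ge0; first by rewrite lee_fin invr_ge0.
have -> : 0%E = elog2 (1 : \bar R) by rewrite /elog2 lne1 mul0e.
apply: elog2_mono => //; have : [set id] `<=` expanding_elements G L 1 0 n.
  move=> _ ->; split; first by case: sG.
  exists x => //; split=> [y _|]; first by rewrite cderiv_id invf_le1 ?exprn_gt0// exprn_ege1// ler1n.
  by apply: distortion_le => // u v _ _; rewrite !cderiv_id subrr normr0 !mul0r.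
move=> /(counting_mono (R := R)); apply: le_trans.
by rewrite /counting asboolT// fset_set1 finmap.cardfs1.
Qed.

Lemma geometric_tail (q : R) N M : 0 < q < 1 ->
  \sum_(n < M) (if (N <= n)%N then q ^+ n else 0) <= q ^+ N / (1 - q).
Proof.
move=> /andP[q0 q1]; rewrite ler_pdivlMr ?subr_gt0//.
suff : (\sum_(n < M) (if (N <= n)%N then q ^+ n else 0)) * (1 - q) + q ^+ (maxn N M) <= q ^+ N.
  have : 0 <= q ^+ maxn N M by rewrite exprn_ge0// ltW.
  lra.
elim: M => [|M IH]; first by rewrite big_ord0 mul0r add0r maxn0.
rewrite big_ord_recr /=; case: leqP => NM; last first.
  by rewrite addr0 (maxn_idPl NM) in IH *; move: IH; rewrite (maxn_idPl (ltnW NM)).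
move: IH; rewrite (maxn_idPr NM) (maxn_idPr (leqW NM)) exprS; lra.
Qed.

Lemma exists_expr_lt (q e : R) : 0 < q < 1 -> 0 < e -> exists N0, forall N, (N0 <= N)%N -> q ^+ N < e.
Proof.
move=> /andP[q0 q1] e0.
have : q ^+ n @[n --> \oo] --> (0 : R) by apply: cvg_expr; rewrite gtr0_norm.
move=> /cvgrPdist_lt/(_ e e0)[N0 _ NP]; exists N0 => N NN.
by have := NP N NN; rewrite /= sub0r normrN gtr0_norm// exprn_gt0.
Qed.

(** Each element has some distortion and expansion bounds, so it is counted
    for some [C] and [n]; these counts are finite as soon as the exponent is.
    In this way [G] is seen to be countable. *)
Lemma group_enum G L (s : R) : subgroup G -> L !=set0 -> (delta2 G L < s%:E)%E ->
  exists gl : nat -> seq (S1 -> S1), forall g, G g -> exists n, g \in gl n.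
Proof.
move=> sG [x Lx] ds.
have fin k : exists N, forall n, exists gs : seq (S1 -> S1), (N <= n)%N ->
    forall g, expanding_elements G L 1 k%:R n g -> g \in gs.
  have : (growth_rate G L 1 k%:R < s%:E)%E.
    by apply: le_lt_trans ds; exact: growth_rate_le_delta2.
  move=> /growth_rate_lt[N NP]; exists N => n.
  case: (leqP N n) => [/NP[gs [gsP _]]|Nn]; first by exists gs.
  by exists [::].
pose N k := projT1 (cid (fin k)).
have NP k : forall n, exists gs : seq (S1 -> S1), (N k <= n)%N ->
    forall g, expanding_elements G L 1 k%:R n g -> g \in gs.
  by rewrite /N; case: cid.
pose gs k n := projT1 (cid (NP k n)).
have gsP k n : (N k <= n)%N -> forall g, expanding_elements G L 1 k%:R n g -> g \in gs k n.
  by rewrite /gs; case: cid.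
exists (fun m => if (pickle_inv m : option (nat * nat)) is Some p then gs p.1 p.2 else [::]).
move=> g Gg.
have [b [B [K [b0 B0 K0 bB lnK']]]] := diff2_bounds (subgroup_diff2 sG Gg).
pose k := (Num.truncn (K / ln 2)).+1.
have [N1 N1P] : exists N1, forall n, (N1 <= n)%N -> 2^-1 ^+ n < b.
  by apply: exists_expr_lt => //; apply/andP; split; lra.
exists (pickle (k, maxn (N k) N1)); rewrite pickleK_inv /=.
apply: gsP; first exact: leq_maxl.
split => //; exists x => //; split=> [y _|].
  apply: (@le_trans _ _ b); last by case/andP: (bB y).
  by rewrite -exprVn ltW// N1P// leq_maxr.
apply: distortion_le => // u v _ _; apply: le_trans (lnK' u v) _.
rewrite ler_wpM2r ?mdist_ge0// -ler_pdivrMr ?ln2_gt0// ltW//.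
exact: truncnS_gt.
Qed.

End UpperBound.

Section DimensionUpperBound.
Context {R : realType}.
Local Notation S1 := (circle R).
Implicit Types (x y z u v : S1) (g f : S1 -> S1) (G : set (S1 -> S1)) (L : set S1).

Lemma dyadic_level (a : R) : 0 < a < 1 ->
  exists n, 2^-1 ^+ n <= a /\ a < 2 * 2^-1 ^+ n.
Proof.
move=> /andP[a0 a1].
have h01 : 0 < (2^-1 : R) < 1 by apply/andP; split; lra.
have exn : exists n, 2^-1 ^+ n <= a.
  by have [N NP] := @exists_expr_lt R _ _ h01 a0; exists N; rewrite ltW// NP.
case: (ex_minnP exn) => -[|n] na nmin; first by move: na; rewrite expr0 leNgt a1.
exists n.+1; split => //; rewrite exprS mulrA divff// mul1r ltNge.
by apply/negP => /nmin; rewrite ltnn.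
Qed.

(** With bounded distortion the derivative on the ball is comparable to its
    value at the centre, which is put at a dyadic scale. *)
Lemma inverse_branch_expanding G L (eps M A : R) x f : subgroup G ->
  L x -> G f -> 0 < eps -> 0 <= M -> A = expR (M * eps) ->
  (forall u v, mdist x u < eps -> mdist x v < eps ->
    `|ln (cderiv f u) - ln (cderiv f v)| <= M * mdist u v) ->
  cderiv f x < 1 ->
  exists n, [/\ 2^-1 ^+ n <= cderiv f x,
    expanding_elements G L eps (M / ln 2) n f &
    forall u, mdist x u < eps -> cderiv f u <= A * A * (2 * 2^-1 ^+ n)].
Proof.
move=> sG Lx Gf eps0 M0 AE fM f1; have f0 := diff2_pos (subgroup_diff2 sG Gf).
have Me0 : 0 <= M * eps by rewrite mulr_ge0// ltW.
have A1 : 1 <= A by rewrite AE -expR0 ler_expR.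
have A0 : 0 < A by exact: lt_le_trans A1.
have xx : mdist x x < eps by rewrite mdistxx.
have lnb u : mdist x u < eps -> `|ln (cderiv f x) - ln (cderiv f u)| <= M * eps.
  move=> xu; apply: le_trans (fM _ _ xx xu) _; rewrite ler_wpM2l// ltW//.
have up u : mdist x u < eps -> cderiv f u <= A * cderiv f x.
  move=> /lnb; rewrite ler_norml => /andP[h _].
  rewrite AE -[leLHS]lnK ?posrE// -[X in _ * X]lnK ?posrE// -expRD ler_expR; lra.
have dn u : mdist x u < eps -> cderiv f x / A <= cderiv f u.
  move=> /lnb; rewrite ler_norml => /andP[_ h]; rewrite ler_pdivrMr// mulrC.
  rewrite AE -[leLHS]lnK ?posrE// -[X in _ * X]lnK ?posrE// -expRD ler_expR; lra.
(* The scale is that of the lower bound of the derivative on the ball. *)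
have a01 : 0 < cderiv f x / A < 1.
  by rewrite divr_gt0//= ltr_pdivrMr// mul1r (lt_le_trans f1).
have [n [n1 n2]] := dyadic_level a01; exists n; split.
- apply: le_trans n1 _; rewrite ler_pdivrMr// ler_peMr// ltW//.
- split => //; exists x => //; split=> [y xy|].
    by rewrite -exprVn; apply: le_trans n1 _; exact: dn.
  apply: distortion_le => [|u v xu xv]; first by rewrite divr_ge0// ltW// ln2_gt0.
  by rewrite divfK ?gt_eqF ?ln2_gt0//; exact: fM.
- move=> u /up /le_trans; apply; rewrite -mulrA ler_pM2l// mulrC -ler_pdivrMr//.
  exact: ltW.
Qed.

Lemma powR_half (s : R) n : (2^-1 ^+ n) `^ s = (2 `^ (- s)) ^+ n.
Proof.
have h0 : 0 <= 2^-1 :> R by rewrite invr_ge0.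
rewrite -(powR_mulrn n h0) -powRrM mulrC powRrM powR_mulrn ?powR_ge0//.
congr (_ ^+ _); rewrite /powR invr_eq0 pnatr_eq0/=.
by rewrite lnV ?posrE// mulrN mulNr.
Qed.

(** The cover at stage [n] consists of the images of a fixed finite family of
    balls under the elements counted at time [n], together with finitely many
    points, so that all the points of the exceptional set appear at some stage. *)
Lemma limit_set_null G L (s : R) : subgroup G -> minimal_set G L ->
  (forall x, (NE G `&` L) x -> has_isolating_fixers G x) ->
  0 < s -> (delta2 G L < s%:E)%E -> hausdorff_measure s L = 0%E.
Proof.
move=> sG mL star s0 ds; have [L0 _ _ _] := mL.
have [s1 [ds1 s1s]] : exists s1 : R, (delta2 G L < s1%:E)%E /\ s1 < s.
  case: (delta2 G L) (delta2_ge0 sG L0) ds => [d| |]// _; rewrite lte_fin => ds.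
  by exists ((d + s) / 2); rewrite lte_fin; split; lra.
have [gl glP] := group_enum sG L0 ds.
have [eps [theta [M [P [/andP[eps0 eps4] t01 M0 fP brP]]]]] := iterated_branches sG mL star.
have [ps psP] : exists ps : seq S1, forall p, P p -> p \in ps.
  exists (finmap.enum_fset (fset_set P)) => p Pp.
  by have := in_fset_set fP p; rewrite [RHS]mem_set.
pose A := expR (M * eps).
have A0 : 0 < A by exact: expR_gt0.
have gr : (growth_rate G L eps (M / ln 2) < s1%:E)%E.
  exact: le_lt_trans (growth_rate_le_delta2 _ _ _ eps0) ds1.
have [N0 N0P] := growth_rate_lt gr.
have gsex n : exists gs : seq (S1 -> S1), (N0 <= n)%N ->
    (forall g, expanding_elements G L eps (M / ln 2) n g -> g \in gs) /\
    (size gs)%:R <= 2 `^ (s1 * n%:R) :> R.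
  by case: (leqP N0 n) => [/N0P[gs]|]; [exists gs|exists [::]].
pose gs n := projT1 (cid (gsex n)).
have gsP n : (N0 <= n)%N ->
    (forall g, expanding_elements G L eps (M / ln 2) n g -> g \in gs n) /\
    (size (gs n))%:R <= 2 `^ (s1 * n%:R) :> R.
  by rewrite /gs; case: cid.
have [m [z zP]] := @circle_net R (eps / 2) (halfr_gt0 eps0).
(* Ratio of the geometric series that bounds the sums of the covers. *)
pose q : R := 2 `^ (s1 - s).
have q01 : 0 < q < 1.
  rewrite powR_gt0//= /q powR2E -[ltRHS]expR0 ltr_expR.
  by rewrite -oppr_gt0 -mulNr mulr_gt0 ?ln2_gt0 ?opprB ?subr_gt0.
pose D n : R := A * A * (2 * 2^-1 ^+ n) * eps.
have D0 n : 0 <= D n by rewrite !mulr_ge0 ?(ltW A0) ?(ltW eps0)// exprn_ge0// invr_ge0.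
pose B : R := m%:R * (A * A * 2 * eps) `^ s.
have B0 : 0 <= B by rewrite mulr_ge0 ?powR_ge0.
apply: hausdorff_measure0 => // e e0.
have e0' : 0 < e * (1 - q) / (B + 1).
  case/andP: q01 => _ q1; rewrite divr_gt0 ?mulr_gt0 ?subr_gt0//.
  by rewrite ltr_wpDl.
have [N1 N1P] := @exists_expr_lt R _ _ q01 e0'.
pose N := maxn N0 N1.
(* Stage [n] lists pairs of a counted element and a ball of the net, from
   [N] on, followed by the translates of the exceptional centres by the
   [n]-th finite part of the group. *)
pose main n := if (N <= n)%N then [seq (g, i) | g <- gs n, i <- enum 'I_m] else [::].
pose pts n := [seq g p | g <- gl n, p <- ps].
pose K n := (size (main n) + size (pts n))%N.
pose W n (c : (S1 -> S1) * 'I_m) := [set y | exists w, [/\ mdist (z c.2) w < eps / 2,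
  y = c.1 w & forall w1 w2, mdist (z c.2) w1 < eps / 2 -> mdist (z c.2) w2 < eps / 2 ->
    mdist (c.1 w1) (c.1 w2) <= D n]].
have i0 : 'I_m by have [x _] := cid L0; exact: (projT1 (cid (zP x))).
pose U n j := if (j < size (main n))%N then W n (nth (id, i0) (main n) j)
              else [set nth 0 (pts n) (j - size (main n))].
pose d n j := if (j < size (main n))%N then D n else 0.
apply: (@flatten_cover _ _ s L K U d) => //.
- by move=> n j; rewrite /d; case: ifP.
- move=> n j x y jK; rewrite /U /d; case: ifP => _.
    by move=> [w1 [w1z -> H]] [w2 [w2z -> _]]; exact: H.
  by move=> -> ->; rewrite mdistxx.
- move=> y Ly; have [[g [p [Gg Pp gpy]]]|nex] := pselect (exists g p, [/\ G g, P p & g p = y]).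
    have [n gn] := glP g Gg.
    have yn : y \in pts n by rewrite -gpy; apply: allpairs_f => //; exact: psP.
    exists n, (size (main n) + index y (pts n))%N; split.
      by rewrite /K ltn_add2l index_mem.
    by rewrite /U ltnNge leq_addr /= addKn nth_index.
  have nP g p : G g -> P p -> g p <> y.
    by move=> Gg Pp gp; apply: nex; exists g, p.
  have h01 : 0 < (2^-1 : R) < 1 by apply/andP; split; lra.
  have hN0 : 0 < (2^-1 : R) ^+ N by rewrite exprn_gt0.
  have [k kP] := @exists_expr_lt R _ _ t01 hN0.
  have [x [f [Lx Gf fx [b1 b2]]]] := brP y Ly nP k.
  have xx : mdist x x < eps by rewrite mdistxx.
  have fxk : cderiv f x < 2^-1 ^+ N by apply: le_lt_trans (b1 _ xx) (kP k _).
  have fx1 : cderiv f x < 1.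
    apply: lt_le_trans fxk _; rewrite exprn_ile1//; lra.
  have [n [n1 Ef fn]] := inverse_branch_expanding sG Lx Gf eps0 M0 (erefl A) b2 fx1.
  have Nn : (N <= n)%N.
    rewrite leqNgt; apply/negP => nN; have := le_lt_trans n1 fxk.
    rewrite ltNge => /negP; apply; rewrite ler_wiXn2l//; [lra|exact: ltnW].
  have [i iP] := zP x.
  have fin : (f, i) \in main n.
    rewrite /main Nn; apply: allpairs_f; last by rewrite mem_enum.
    by apply: (gsP n _).1 => //; apply: leq_trans Nn; exact: leq_maxl.
  have jm : (index (f, i) (main n) < size (main n))%N by rewrite index_mem.
  exists n, (index (f, i) (main n)); split; first by rewrite /K ltn_addr.
  rewrite /U jm nth_index//; exists x; split => //= w1 w2 h1 h2.
  have ball_i w : mdist (z i) w < eps / 2 -> mdist x w < eps.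
    move=> h; apply: le_lt_trans (metric_triangle _ (z i) _) _.
    by rewrite [ltRHS]splitr metric_sym ltrD// metric_sym.
  apply: le_trans (ball_lipschitz (subgroup_diff2 sG Gf) eps4 fn (ball_i _ h1) (ball_i _ h2)) _.
  rewrite /D ler_wpM2l//.
    by rewrite !mulr_ge0 ?(ltW A0)// exprn_ge0// invr_ge0.
  apply: le_trans (metric_triangle _ (z i) _) _; rewrite [leRHS]splitr lerD ?ltW//.
  by rewrite metric_sym.
move=> N'.
apply: (@le_trans _ _ (\sum_(n < N') B * (if (N <= n)%N then q ^+ n else 0))).
  apply: ler_sum => n _.
  rewrite /K big_split_ord /= [X in _ + X]big1 ?addr0; last first.
    by move=> j _; rewrite /d ltnNge leq_addr /= powR0// gt_eqF.
  apply: (@le_trans _ _ (\sum_(j < size (main n)) D n `^ s)).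
    by apply: ler_sum => j _; rewrite /d ltn_ord.
  rewrite sumr_const card_ord /main; case: ifP => Nn; last by rewrite mulr0.
  rewrite size_allpairs size_enum_ord -mulr_natl natrM.
  have [_ hs] := gsP n (leq_trans (leq_maxl _ _) Nn).
  have -> : D n `^ s = (A * A * 2 * eps) `^ s * (2 `^ (- s)) ^+ n.
    rewrite -powR_half -powRM ?exprn_ge0 ?invr_ge0// ?mulr_ge0 ?(ltW A0) ?(ltW eps0)//.
    by congr (_ `^ _); rewrite /D !mulrA mulrAC.
  have -> : q ^+ n = 2 `^ (s1 * n%:R) * (2 `^ (- s)) ^+ n.
    rewrite -!powR_mulrn ?powR_ge0// -!powRrM -powRD; last by rewrite pnatr_eq0 implybT.
    by congr (_ `^ _); rewrite mulrBl mulNr.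
  rewrite [X in X * _]mulrC mulrACA; apply: ler_wpM2l => //.
  by apply: ler_wpM2r; [rewrite exprn_ge0// powR_ge0|].
rewrite -mulr_sumr; apply: le_trans (ler_wpM2l B0 (@geometric_tail R _ N N' q01)) _.
have /andP[q0 q1] := q01.
rewrite mulrA ler_pdivrMr ?subr_gt0//.
have := N1P N (leq_maxr _ _); rewrite ltr_pdivlMr ?ltr_wpDl// => /ltW; apply: le_trans.
by rewrite mulrC ler_wpM2l ?exprn_ge0 ?(ltW q0)// lerDl.
Qed.

Lemma dim_le_delta2 G L : subgroup G -> minimal_set G L ->
  (forall x, (NE G `&` L) x -> has_isolating_fixers G x) ->
  (hausdorff_dimension L <= delta2 G L)%E.
Proof.
move=> sG mL star; have [L0 _ _ _] := mL.
have := delta2_ge0 sG L0; case E : (delta2 G L) => [d| |]; [|by move=> _; rewrite leey|by rewrite leeNy_eq].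
rewrite lee_fin => d0; apply/lee_addgt0Pr => e e0; rewrite -EFinD.
apply: ereal_inf_lbound; exists (d + e) => //.
have de : 0 < d + e by apply: ltr_wpDl.
split => //; apply: (limit_set_null sG mL star) => //.
by rewrite E lte_fin ltrDl.
Qed.

End DimensionUpperBound.

(** * Separated iterated function systems *)

Section IteratedFunctionSystem.
Context {R : realType} {T : metricType R}.
Context (N : nat) (f : 'I_N -> T -> T) (K : set T) (beta sigma s : R).
Context (N2 : (1 < N)%N)
  (beta0 : 0 < beta)
  (sigma0 : 0 < sigma)
  (s0 : 0 < s)
  (Nbeta : 1 <= N%:R * beta `^ s)
  (K0 : K !=set0)
  (fK : forall i x, K x -> K (f i x))
  (fbeta : forall i x y, K x -> K y -> beta * mdist x y <= mdist (f i x) (f i y))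
  (fsep : forall i j x y, i != j -> K x -> K y -> sigma <= mdist (f i x) (f j y)).

(** Descent on the number of sets of the cover.  If all sets are smaller than
    [sigma], each one meets the image of at most one map.  The sets that meet
    the image of [f i], pulled back by [f i], form a cover of [K] by strictly
    fewer sets, enlarged by [beta^-1] at most; averaging over the [N] maps and
    using [1 <= N * beta `^ s] shows that the bound passes to the given cover. *)
Lemma ifs_cover_lower_bound (J : finType) (A : {set J}) (V : J -> set T) (w : J -> R) :
  (forall j, j \in A -> 0 <= w j) ->
  (forall j x y, j \in A -> V j x -> V j y -> mdist x y <= w j) ->
  (forall x, K x -> exists2 j, j \in A & V j x) ->
  sigma `^ s <= \sum_(j in A) w j `^ s.
Proof.
have [n] := ubnP #|A|; elim: n A V w => // n IH A V w An w0 Vw KV.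
have [[j jA sj]|small] := pselect (exists2 j, j \in A & sigma <= w j).
  rewrite (bigD1 j)//=; apply: (@le_trans _ _ (w j `^ s)).
    by apply: ge0_ler_powR; rewrite ?nnegrE ?(ltW s0) ?(ltW sigma0)//; exact: w0.
  by rewrite lerDl sumr_ge0// => k _; exact: powR_ge0.
have {}small j : j \in A -> w j < sigma.
  by move=> jA; rewrite ltNge; apply/negP => h; apply: small; exists j.
(* The sets of the cover that meet the image of [f i]. *)
pose B i := [set j in A | `[< exists2 u, K u & V j (f i u) >]]%SET.
have BA i j : j \in B i -> j \in A by rewrite inE => /andP[].
have Bdisj i k j : j \in B i -> j \in B k -> i = k.
  rewrite !inE => /andP[jA /asboolP[u Ku Vu]] /andP[_ /asboolP[v Kv Vv]].
  apply/eqP; apply: contraT => ik; have := fsep ik Ku Kv.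
  by rewrite leNgt (le_lt_trans (Vw _ _ _ jA Vu Vv))// small.
have Bne i : exists j, j \in B i.
  have [u Ku] := K0; have [j jA Vj] := KV _ (fK i Ku); exists j.
  by rewrite inE jA; apply/asboolP; exists u.
have Bcard i : (#|B i| < n)%N.
  have [k ik] : exists k : 'I_N, k != i.
    have [i0|i0] := eqVneq (val i) 0%N.
      by exists (Ordinal N2); rewrite -val_eqE /= i0.
    by exists (Ordinal (ltnW N2)); rewrite -val_eqE /= eq_sym.
  have [j jk] := Bne k; rewrite -ltnS; apply: leq_trans An; rewrite ltnS.
  apply: proper_card; apply/properP; split; first by apply/fintype.subsetP => l; exact: BA.
  exists j; first exact: BA jk.
  by apply/negP => ji; move/eqP: ik; apply; exact: (Bdisj _ _ _ jk ji).
have bs0 : 0 < beta `^ s by exact: powR_gt0.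
have key i : sigma `^ s * beta `^ s <= \sum_(j in B i) w j `^ s.
  have := IH (B i) (fun j => [set u | K u /\ V j (f i u)]) (fun j => w j / beta) (Bcard i).
  move=> H; rewrite -ler_pdivlMr//; apply: le_trans (H _ _ _) _.
  - by move=> j /BA jA; rewrite divr_ge0 ?w0// ltW.
  - move=> j x y /BA jA [Kx Vx] [Ky Vy]; rewrite ler_pdivlMr// mulrC.
    by apply: le_trans (fbeta i Kx Ky) _; exact: Vw.
  - move=> x Kx; have [j jA Vj] := KV _ (fK i Kx); exists j => //.
    by rewrite inE jA; apply/asboolP; exists x.
  rewrite mulr_suml; apply: ler_sum => j /BA jA.
  by rewrite powRM ?w0 ?invr_ge0 ?(ltW beta0)// -powR_inv1 ?(ltW beta0)// powRAC powR_inv1 ?powR_ge0.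
have tot : \sum_(i < N) \sum_(j in B i) w j `^ s <= \sum_(j in A) w j `^ s.
  have -> : \sum_(i < N) \sum_(j in B i) w j `^ s =
      \sum_(i < N) \sum_(j in A) (if j \in B i then w j `^ s else 0).
    apply: eq_bigr => i _; rewrite -big_mkcondr /=; apply: eq_bigl => j.
    by apply/idP/andP => [jB|[]//]; split => //; exact: BA jB.
  rewrite exchange_big /=; apply: ler_sum => j jA.
  have [[i ji]|nj] := pselect (exists i, j \in B i).
    rewrite (bigD1 i)//= ji big1 ?addr0// => k ki; case: ifP => // jk.
    by move: ki; rewrite (Bdisj _ _ _ jk ji) eqxx.
  rewrite big1 ?powR_ge0// => i _; case: ifP => // ji.
  by exfalso; apply: nj; exists i.
apply: le_trans tot.
apply: (@le_trans _ _ (\sum_(i < N) sigma `^ s * beta `^ s)); last exact: ler_sum.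
by rewrite sumr_const card_ord -mulrnAr -mulr_natl ler_peMr// powR_ge0.
Qed.

End IteratedFunctionSystem.

Section IFSDimension.
Context {R : realType}.
Local Notation S1 := (circle R).
Context (N : nat) (f : 'I_N -> S1 -> S1) (K L : set S1) (beta sigma s : R).
Context (N2 : (1 < N)%N)
  (beta0 : 0 < beta)
  (sigma0 : 0 < sigma)
  (s0 : 0 < s)
  (Nbeta : 1 <= N%:R * beta `^ s)
  (K0 : K !=set0)
  (cK : closed K)
  (KL : K `<=` L)
  (fK : forall i x, K x -> K (f i x))
  (fbeta : forall i x y, K x -> K y -> beta * mdist x y <= mdist (f i x) (f i y))
  (fsep : forall i j x y, i != j -> K x -> K y -> sigma <= mdist (f i x) (f j y)).

Lemma geometric_half_sum (e : R) m : 0 <= e -> \sum_(i < m) e * 2^-1 ^+ i.+1 <= e.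
Proof.
move=> e0; suff -> : \sum_(i < m) e * 2^-1 ^+ i.+1 = e - e * 2^-1 ^+ m.
  by rewrite gerBl mulr_ge0// exprn_ge0// invr_ge0.
elim: m => [|m IH]; first by rewrite big_ord0 expr0 mulr1 subrr.
by rewrite big_ord_recr /= IH exprS; lra.
Qed.

(** Compactness reduces to finite covers, once the sets are replaced by
    slightly larger open ones. *)
Lemma ifs_hausdorff_positive : hausdorff_measure s L <> 0%E.
Proof.
move=> HL; pose e := sigma `^ s / 4.
have ss0 : 0 < sigma `^ s by exact: powR_gt0.
have e0 : 0 < e by rewrite divr_gt0.
have [U [w [LU w0 Uw ws]]] := hausdorff_small_cover HL s0 e0.
pose eta i : R := e * 2^-1 ^+ i.+1.
have eta0 i : 0 < eta i by rewrite mulr_gt0// exprn_gt0// invr_gt0.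
(* The size [w' i > w i] is chosen so that its power exceeds that of [w i] by
   exactly [eta i]. *)
pose w' i := (w i `^ s + eta i) `^ s^-1.
have w's i : w' i `^ s = w i `^ s + eta i.
  by rewrite /w' -powRrM mulVf ?gt_eqF// powRr1// addr_ge0 ?powR_ge0// ltW.
have ww' i : w i < w' i.
  rewrite ltNge; apply/negP => h; have : w' i `^ s <= w i `^ s.
    by apply: ge0_ler_powR; rewrite ?nnegrE ?w0 ?powR_ge0 ?(ltW s0).
  by rewrite w's leNgt ltrDl eta0.
pose r i := (w' i - w i) / 2.
have r0 i : 0 < r i by rewrite divr_gt0// subr_gt0.
pose V i := [set y | exists2 u, U i u & mdist u y < r i].
have Vw' i x y : V i x -> V i y -> mdist x y <= w' i.
  move=> [u Uu ux] [v Uv vy]; apply: le_trans (metric_triangle _ u _) _.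
  have h1 := metric_triangle u v y; have h2 := Uw _ _ _ Uu Uv.
  have ux' : mdist x u < r i by rewrite metric_sym.
  have -> : w' i = r i + (w i + r i) by rewrite /r; lra.
  by apply: lerD; [exact: ltW|apply: le_trans h1 _; apply: lerD => //; exact: ltW].
have cK' : cover_compact K by rewrite -compact_cover; exact: closed_compact_circle.
have [||D _ KD] := cK' nat setT (fun i => (V i)^°).
- by move=> i _; exact: open_interior.
- move=> x /KL /LU[i _ Ui]; exists i => //; apply/near_circleP; exists (r i) => // y xy.
  by exists x.
pose m := (\max_(i <- finmap.enum_fset D) i).+1.
have := @ifs_cover_lower_bound R _ N f K beta sigma s N2 beta0 sigma0 s0 Nbeta K0 fK fbeta
  fsep 'I_m [set: 'I_m]%SET (fun j => V j) (fun j => w' j).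
have -> : \sum_(j in [set: 'I_m]%SET) w' j `^ s = \sum_(j < m) (w j `^ s + eta j).
  by apply: eq_big => [j|j _]; [rewrite inE|exact: w's].
rewrite big_split /= => H.
have : sigma `^ s <= e + e.
  apply: le_trans (H _ _ _) (lerD (ws m) (geometric_half_sum m (ltW e0))).
  - by move=> j _; exact: powR_ge0.
  - by move=> j x y _; exact: Vw'.
  - move=> x /KD[i iD /interior_subset Vi].
    have im : (i < m)%N.
       by rewrite ltnS; exact: (@leq_bigmax_seq _ (finmap.enum_fset D) xpredT (fun i => i) i iD isT).
    by exists (Ordinal im); rewrite ?inE.
by rewrite /e; lra.
Qed.

End IFSDimension.

(** * Local discreteness as a gap at the identity *)

Section LocalDiscreteness.
Context {R : realType}.
Local Notation S1 := (circle R).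
Implicit Types (x y z u v : S1) (g f : S1 -> S1) (G : set (S1 -> S1)) (L : set S1).

Lemma circle_interval_ball x (r : R) : 0 < r <= 4^-1 ->
  circle_interval [set u | mdist x u < r].
Proof.
move=> /andP[r0 r4]; exists `]crep x - r, crep x + r[%classic; split.
- exact: interval_is_interval.
- exists (crep x); apply: (near_in_itvoo (a := crep x - r) (b := crep x + r)).
  by rewrite in_itv/= ltrBlDr ltrDl r0.
- move=> s t /set_mem + /set_mem; rewrite /= !in_itv/= => hs ht /cproj_eqP[m mE].
  have : `|m%:~R : R| < 1 by rewrite -mE ltr_norml; lra.
  by move=> /small_int m0; apply/eqP; rewrite -subr_eq0 mE m0.
apply/seteqP; split=> [u xu|_ [t /= + <-]].
  have [h uE hd] := circle_chart x u; exists (crep x + h).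
    have {}xu : mdist x u < r := xu.
    by move: xu; rewrite -hd /= in_itv/= ltr_norml => ?; lra.
  by rewrite cprojD crepK.
rewrite in_itv/= => ht; rewrite -[x]crepK (le_lt_trans (mdist_cproj_le _ _))//.
by rewrite ltr_norml; lra.
Qed.

Lemma is_lift_iter g phi n : Diff2_plus g -> (forall n, Diff2_plus (iter n g)) ->
  is_lift g phi -> is_lift (iter n g) (iter n phi).
Proof.
move=> Dg Dn lp; elim: n => [|n IH]; first exact: lift_id.
apply: (lift_comp _ _ lp IH); exact: diff2_derivable.
Qed.

Lemma cderiv_locally_id f x (r : R) u : (forall v, mdist x v < r -> f v = v) ->
  mdist x u < r -> cderiv f u = 1.
Proof.
move=> fid xu; apply: is_derive_cderiv.
apply: (@near_eq_is_derive _ _ _ (in_chart id u)); last exact: is_derive_in_chart_id.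
near=> h; rewrite /in_chart fid ?(fid u)//.
apply: le_lt_trans (metric_triangle _ u _) _; rewrite -ltrBrDl.
apply: le_lt_trans (mdistD_cproj u h) _; rewrite -normrN -sub0r.
by near: h; apply: cvgr_dist_lt; [exact: cvg_id|rewrite subr_gt0].
Unshelve. all: end_near. Qed.

(** A nontrivial element fixing an interval pointwise has infinite order, as
    its lift is increasing, and the sequence of its iterates converges trivially
    to the identity on the interval. *)
Lemma locally_id_is_id G x (r : R) g : subgroup G -> locally_discrete G ->
  0 < r <= 4^-1 -> G g -> (forall u, mdist x u < r -> g u = u) -> g = id.
Proof.
move=> sG dG r04 Gg gid; apply: contrapT => ng.
have Dg := subgroup_diff2 sG Gg.
have Dn n : Diff2_plus (iter n g) by apply: (subgroup_diff2 sG); exact: subgroup_iter.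
have gx : g (cproj (crep x)) = cproj (crep x).
  by rewrite crepK gid// mdistxx; case/andP: r04.
have [phi lp px] := diff2_lift Dg gx.
have [t pt] : exists t, phi t != t.
  apply: contrapT => H; apply: ng; apply/funext => u; rewrite -[u]crepK lp.1.
  by congr cproj; apply/eqP; apply: contraT => h; exfalso; apply: H; exists (crep u).
have itx n : iter n phi (crep x) = crep x by elim: n => //= n ->.
have mono : injective (fun n => iter n phi t).
  have pl a b : a < b -> phi a < phi b by exact: (lift_lt (diff2_pos Dg) lp).
  have st : (forall n, iter n phi t < iter n.+1 phi t) \/
            (forall n, iter n.+1 phi t < iter n phi t).
    by case: (ltgtP (phi t) t) pt => // h _; [right|left]; elim=> //= n IH; exact: pl.
  move=> n m /= nm; apply/eqP; apply: contraT => nm'; exfalso.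
  wlog lt : n m nm nm' / (n < m)%N => [H|].
    by move: (nm'); rewrite neq_ltn => /orP[h|h]; [exact: (H n m)|apply: (H m n) => //; rewrite eq_sym].
  case: st => st.
    have h := @homo_ltn R (fun k => iter k phi t) (fun a b : R => a < b)
      (fun (y x z : R) => @lt_trans _ _ y x z) st.
    by have := h _ _ lt; rewrite nm ltxx.
  have h := @homo_ltn R (fun k => iter k phi t) (fun a b : R => b < a)
    (fun (y x z : R) xy yz => lt_trans yz xy) st.
  by have := h _ _ lt; rewrite nm ltxx.
apply: (dG _ (circle_interval_ball x r04)); exists (fun n => iter n g); split.
- move=> n m nm; apply: mono => /=.
  have l1 := is_lift_iter n Dg Dn lp; have := is_lift_iter m Dg Dn lp; rewrite -nm => l2.
  by rewrite (lift_unique l1 l2 (t0 := crep x))// !itx.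
- by move=> n; exact: subgroup_iter.
have idn n u : mdist x u < r -> iter n g u = u.
  by move=> xu; elim: n => //= n ->; exact: gid.
move=> e e0; near=> n; move=> u /= xu.
by rewrite (cderiv_locally_id (idn n) xu) idn// mdistxx subrr normr0.
Unshelve. all: end_near. Qed.

(** Otherwise elements closer and closer to the identity could be chosen, each
    one closer than all the previous ones, hence distinct.  A nontrivial element
    is not arbitrarily close to the identity by [locally_id_is_id]. *)
Lemma locally_discrete_gap G x (r : R) : subgroup G -> locally_discrete G ->
  0 < r <= 4^-1 -> exists2 eta : R, 0 < eta & forall g, G g ->
    (forall u, mdist x u < r -> mdist (g u) u < eta /\ `|cderiv g u - 1| < eta) -> g = id.
Proof.
move=> sG dG r04; apply: contrapT => H.
pose close (eta : R) g := forall u, mdist x u < r ->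
  mdist (g u) u < eta /\ `|cderiv g u - 1| < eta.
have close_mono eta eta' g : eta <= eta' -> close eta g -> close eta' g.
  by move=> h c u /c[c1 c2]; split; apply: lt_le_trans h.
have step (eta : R) : exists p : (S1 -> S1) * R, 0 < eta ->
    [/\ G p.1, close eta p.1, 0 < p.2, p.2 <= eta / 2 & ~ close p.2 p.1].
  have [eta0|eta0] := pselect (0 < eta); last by exists (id, 0).
  have [g [Gg cg ng]] : exists g, [/\ G g, close eta g & g <> id].
    apply: contrapT => H'; apply: H; exists eta => // g Gg cg.
    by apply: contrapT => ng; apply: H'; exists g.
  have [u xu gu] : exists2 u, mdist x u < r & g u != u.
    apply: contrapT => H'; apply: ng; apply: (locally_id_is_id (x := x) sG dG r04 Gg) => u xu.
    apply: contrapT => gu; apply: H'; exists u => //; exact/eqP.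
  exists (g, Num.min (mdist (g u) u) (eta / 2)) => _; split => //=.
  - by rewrite lt_min mdist_gt0 gu divr_gt0.
  - by rewrite ge_min lexx orbT.
  by move=> /(_ u xu)[]; rewrite lt_min ltxx.
have [F FP] := choice step.
(* Closeness to the identity required of the [n]-th element of the sequence. *)
pose e_ n := iter n (fun e => (F e).2) (1 : R).
have e_0 n : 0 < e_ n.
  by elim: n => [|n IH]; [exact: ltr01|case: (FP _ IH)].
have e_S n : e_ n.+1 <= e_ n / 2 by case: (FP _ (e_0 n)).
have e_2 n : e_ n <= 2^-1 ^+ n.
  by elim: n => [|n IH] //; apply: le_trans (e_S n) _; rewrite exprS mulrC ler_wpM2l.
have e_dec n m : (n <= m)%N -> e_ m <= e_ n.
  move=> /subnK <-; elim: (m - n)%N => [|k IH]; first by rewrite add0n.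
  rewrite addSn; apply: le_trans IH; apply: le_trans (e_S _) _.
  by have := e_0 (k + n)%N; lra.
pose gs n := (F (e_ n)).1.
apply: (dG _ (circle_interval_ball x r04)); exists gs; split.
- move=> n m nm; apply/eqP; apply: contraT => nm'; exfalso.
  wlog lt : n m nm nm' / (n < m)%N => [H'|].
    by move: (nm'); rewrite neq_ltn => /orP[h|h]; [exact: (H' n m)|apply: (H' m n) => //; rewrite eq_sym].
  have [_ _ _ _] := FP _ (e_0 n); apply; rewrite -/(gs n) nm.
  have [_ c _ _ _] := FP _ (e_0 m); apply: close_mono c.
  exact: (e_dec n.+1 m).
- by move=> n; case: (FP _ (e_0 n)).
move=> e e0.
have h01 : 0 < (2^-1 : R) < 1 by apply/andP; split; lra.
have [N NP] := @exists_expr_lt R _ _ h01 e0.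
exists N => // n /= Nn u xu; have [_ c _ _ _] := FP _ (e_0 n).
have [c1 c2] := c u xu; have en : e_ n < e := le_lt_trans (e_2 n) (NP n Nn).
by split; apply: lt_trans en.
Qed.

End LocalDiscreteness.

(** * Bounded overlap *)

Section Overlap.
Context {R : realType}.
Local Notation S1 := (circle R).
Implicit Types (x y z u w : S1) (g f h : S1 -> S1) (G : set (S1 -> S1)) (L : set S1).

(** Vectors with the same entries up to rounding at scale [tau] are
    [tau]-close, and there are finitely many rounded vectors. *)
Lemma separated_vectors_bounded (T : nat) (B tau : R) : 0 < tau ->
  exists Q : nat, forall (I : eqType) (s : seq I) (v : I -> 'I_T -> R), uniq s ->
    (forall i t, i \in s -> `|v i t| <= B) ->
    (forall i j, i \in s -> j \in s -> i != j -> exists t, tau < `|v i t - v j t|) ->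
    (size s <= Q)%N.
Proof.
move=> tau0; pose K := Num.truncn ((B + B) / tau).
exists #|{ffun 'I_T -> 'I_K.+1}| => I s v us vB vsep.
pose code i := [ffun t : 'I_T => inord (Num.truncn ((v i t + B) / tau)) : 'I_K.+1].
have uc : uniq (map code s).
  rewrite map_inj_in_uniq// => i j iI jI cij; apply/eqP; apply: contraT => ij.
  have [t tt] := vsep i j iI jI ij; exfalso; move: tt; apply/negP; rewrite -leNgt.
  have bd k : k \in s -> 0 <= (v k t + B) / tau /\ (Num.truncn ((v k t + B) / tau) < K.+1)%N.
    move=> /(vB _ t); rewrite ler_norml => /andP[h1 h2]; split.
      by rewrite divr_ge0 ?(ltW tau0)//; lra.
    by rewrite ltnS; apply: le_truncn; rewrite ler_pM2r ?invr_gt0//; lra.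
  have [i0 i1] := bd i iI; have [j0 j1] := bd j jI.
  have := congr1 (fun c : {ffun 'I_T -> 'I_K.+1} => val (c t)) cij.
  rewrite !ffunE /= !inordK// => E.
  have := truncn_itv i0; have := truncn_itv j0; rewrite -E.
  move=> /andP[a1 a2] /andP[b1 b2].
  have : `|(v i t + B) / tau - (v j t + B) / tau| <= 1.
    by move: a1 a2 b1 b2; rewrite -natr1 ler_norml; lra.
  rewrite -mulrBl opprD addrACA subrr addr0 normrM (gtr0_norm (x := tau^-1)) ?invr_gt0//.
  by rewrite ler_pdivrMr// mul1r.
rewrite -(size_map code) -(card_uniqP uc); exact: max_card.
Qed.

(** Elements which, rescaled by [v], form a family precompact in the [C^1]
    topology on the ball. *)
Definition scales_by G x (r K v : R) g := [/\ G g,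
  forall u, mdist x u < r -> v / 4 <= cderiv g u <= 2 * v &
  forall u w, mdist x u < r -> mdist x w < r ->
    `|cderiv g u - cderiv g w| <= K * v * mdist u w].

Lemma distr_le_three (a a' b b' k1 k2 c : R) : `|a - a'| <= k1 -> `|b - b'| <= k1 ->
  `|a' - b'| <= c -> k1 <= k2 -> 2 * k2 <= c -> `|a - b| <= 2 * c.
Proof.
by rewrite !ler_norml => /andP[? ?] /andP[? ?] /andP[? ?] ? ?; apply/andP; split; lra.
Qed.

(** The choice of [c] that makes [close_quotient] applicable with [tau = c]
    and [sigma = 2 c]. *)
Lemma gap_constants (c K r eta : R) : 0 < c -> 0 <= K * c ->
  100 * (1 + K) * c <= eta -> 100 * (1 + K) * c <= r ->
  [/\ 0 <= 2 * c, 4 * (c + 2 * c) < r / 4, 4 * (c + 2 * c) < eta &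
      4 * (2 * c + K * (4 * (c + 2 * c))) < eta].
Proof. by move=> c0 Kc0 ce cr; split; lra. Qed.

(** Since [g] expands lengths at least by [v / 4], two values of [g] and [h]
    which differ by [(tau + sigma) v] correspond under the inverse of [g] to
    points which differ by at most [4 (tau + sigma)]. *)
Lemma close_quotient G x z (r K v tau sigma eta : R) g h :
  subgroup G -> 0 < r <= 4^-1 -> 0 <= K -> 0 < v -> 0 <= tau -> 0 <= sigma ->
  scales_by G x r K v g -> scales_by G x r K v h ->
  `|crep (g x - z) - crep (h x - z)| <= tau * v ->
  (forall u, mdist x u < 3 / 4 * r -> `|cderiv g u - cderiv h u| <= sigma * v) ->
  4 * (tau + sigma) < r / 4 -> 4 * (tau + sigma) < eta ->
  4 * (sigma + K * (4 * (tau + sigma))) < eta ->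
  exists f, [/\ G f, cancel f g & forall u, mdist x u < r / 2 ->
    mdist ((f \o h) u) u < eta /\ `|cderiv (f \o h) u - 1| < eta].
Proof.
move=> sG /andP[r0 r4] K0 v0 tau0 sigma0 [Gg g1 g2] [Gh h1 h2] gh0 gh' a1 a2 a3.
have gX : g (cproj (crep x)) = cproj (crep z + crep (g x - z)).
  by rewrite cprojD !crepK subrKC.
have hX : h (cproj (crep x)) = cproj (crep z + crep (h x - z)).
  by rewrite cprojD !crepK subrKC.
have [f [phi [psi [[Gf gK fK] lp lq [pX qX] [pK qK]]]]] := lift_inverse sG Gg gX.
have Dg := subgroup_diff2 sG Gg; have Dh := subgroup_diff2 sG Gh.
have Df := subgroup_diff2 sG Gf.
have [chi lc cX] := diff2_lift Dh hX.
set X := crep x in gX hX pX qX cX.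
have xball (t d : R) : `|t - X| < d -> mdist x (cproj t) < d.
  by move=> tX; rewrite -[x]crepK; apply: le_lt_trans (mdist_cproj_le _ _) _; rewrite distrC.
exists f; split => // u xu.
have [t [ut tX _]] := circle_chart_cproj X u.
have {}tX : `|t - X| < r / 2 by rewrite tX /X crepK.
pose al := 4 * (tau + sigma).
have al0 : 0 <= al by rewrite mulr_ge0// addr_ge0.
have diff : `|phi t - chi t| <= (tau + sigma) * v.
  have d0 : `|phi X - chi X| <= tau * v.
    by rewrite pX cX opprD addrACA subrr add0r.
  have dD s : is_derive (s : R) 1 (phi - chi) (cderiv g (cproj s) - cderiv h (cproj s)).
    by apply: is_deriveB; [exact: lp.2|exact: lc.2].
  have bd s : `|s - X| < r / 2 -> `|cderiv g (cproj s) - cderiv h (cproj s)| <= sigma * v.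
    by move=> sX; apply: gh'; apply: xball; lra.
  have dt : `|(phi - chi) t - (phi - chi) X| <= sigma * v * `|t - X|.
    case: (leP X t) => Xt.
      rewrite (ger0_norm (x := t - X)) ?subr_ge0// ler_norml -mulNr; apply/andP; split.
        apply: (derive_lower_bound Xt dD) => s sI.
        have /bd : `|s - X| < r / 2 by move: tX; rewrite !ltr_norml; lra.
        by rewrite ler_norml => /andP[].
      apply: (derive_upper_bound Xt dD) => s sI.
      have /bd : `|s - X| < r / 2 by move: tX; rewrite !ltr_norml; lra.
      by rewrite ler_norml => /andP[].
    rewrite [leLHS]distrC [`|t - X|]distrC (ger0_norm (x := X - t)) ?subr_ge0 ?(ltW Xt)//.
    rewrite ler_norml -mulNr; apply/andP; split.
      apply: (derive_lower_bound (ltW Xt) dD) => s sI.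
      have /bd : `|s - X| < r / 2 by move: tX; rewrite !ltr_norml; lra.
      by rewrite ler_norml => /andP[].
    apply: (derive_upper_bound (ltW Xt) dD) => s sI.
    have /bd : `|s - X| < r / 2 by move: tX; rewrite !ltr_norml; lra.
    by rewrite ler_norml => /andP[].
  have {}dt : `|(phi - chi) t - (phi - chi) X| <= sigma * v.
    apply: le_trans dt _; rewrite ler_piMr ?mulr_ge0 ?(ltW v0)//; lra.
  move: d0 dt; rewrite !fctE !ler_norml mulrDl; lra.
have g0 := diff2_pos Dg.
have grow s1 s2 : s1 <= s2 -> `|s1 - X| < r -> `|s2 - X| < r ->
    v / 4 * (s2 - s1) <= phi s2 - phi s1.
  move=> s12 b1 b2; apply: (derive_lower_bound s12 lp.2) => s sI.
  have /g1/andP[] // : mdist x (cproj s) < r.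
  by apply: xball; move: b1 b2; rewrite !ltr_norml; lra.
have psim a b : a <= b -> psi a <= psi b by exact: (lift_le (diff2_pos Df) lq).
have omega : `|psi (chi t) - t| <= al.
  have e1 : chi t <= phi (t + al).
    have := grow t (t + al).
    rewrite lerDl al0 [t + al - t]addrAC subrr add0r => /(_ isT) H.
    have {}H : v / 4 * al <= phi (t + al) - phi t.
      by apply: H; move: tX a1; rewrite -/al !ltr_norml; lra.
    have E : v / 4 * al = (tau + sigma) * v by rewrite /al; lra.
    by move: diff H; rewrite E ler_norml; lra.
  have e2 : phi (t - al) <= chi t.
    have := grow (t - al) t.
    rewrite gerBl al0 subKr => /(_ isT) H.
    have {}H : v / 4 * al <= phi t - phi (t - al).
      by apply: H; move: tX a1; rewrite -/al !ltr_norml; lra.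
    have E : v / 4 * al = (tau + sigma) * v by rewrite /al; lra.
    by move: diff H; rewrite E ler_norml; lra.
  by move: (psim _ _ e1) (psim _ _ e2); rewrite !pK ler_norml; lra.
have wu : (f \o h) u = cproj (psi (chi t)) by rewrite /= ut lc.1 lq.1.
have dwu : mdist ((f \o h) u) u <= al.
  by rewrite wu {1}ut; apply: le_trans (mdist_cproj_le _ _) _.
split; first exact: le_lt_trans dwu a2.
have xw : mdist x ((f \o h) u) < r.
  apply: le_lt_trans (metric_triangle _ u _) _.
  rewrite metric_sym in dwu; apply: (@lt_trans _ _ (r / 2 + r / 4)); last lra.
  by apply: ltrD => //; exact: le_lt_trans dwu a1.
have xu' : mdist x u < r by apply: lt_trans xu _; lra.
rewrite diff2_cderiv_comp//.
have gw : g ((f \o h) u) = h u by rewrite /= fK.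
rewrite -[X in cderiv f X]gw (cderiv_cancel _ Dg Df gK).
set d := cderiv g _; have d0 : 0 < d by exact: g0.
have /andP[dv _] := g1 _ xw; rewrite -/d in dv.
have -> : d^-1 * cderiv h u - 1 = (cderiv h u - d) / d.
  by rewrite mulrBl divff ?gt_eqF// mulrC.
rewrite normrM (gtr0_norm (x := d^-1)) ?invr_gt0// ltr_pdivrMr//.
have h3 := gh' u (lt_trans xu _); have {}h3 : `|cderiv g u - cderiv h u| <= sigma * v by apply: h3; lra.
have h4 : `|cderiv g u - d| <= K * v * al.
  apply: le_trans (g2 _ _ xu' xw) _; rewrite ler_wpM2l ?mulr_ge0 ?(ltW v0)//.
  by rewrite metric_sym.
have h5 : `|cderiv h u - d| <= (sigma + K * al) * v.
  by move: h3 h4; rewrite !ler_norml => /andP[? ?] /andP[? ?]; apply/andP; split; lra.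
apply: le_lt_trans h5 _.
apply: (@lt_le_trans _ _ (eta * (v / 4))); last by rewrite ler_pM2l//; apply: le_lt_trans a2.
by rewrite mulrA ltr_pdivlMr// mulrAC ltr_pM2r// mulrC.
Qed.

(** Each element is described, after rescaling by [v], by its value at the
    centre and by its derivative at the points of a fine net.  Two elements with
    close descriptions are [C^1]-close on the ball because the derivatives are
    Lipschitz, so their quotient is the identity by [locally_discrete_gap]. *)
Lemma overlap_bounded G x (r K kappa : R) : subgroup G -> locally_discrete G ->
  0 < r <= 4^-1 -> 0 <= K -> 0 < kappa ->
  exists Q : nat, forall (v : R) z (s : seq (S1 -> S1)), 0 < v -> uniq s ->
    (forall g, g \in s -> scales_by G x r K v g /\ mdist (g x) z <= kappa * v) ->
    (size s <= Q)%N.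
Proof.
move=> sG dG r04 K0 kap0; have /andP[r0 r4] := r04.
have [|eta eta0 gap] := @locally_discrete_gap R G x (r / 2) sG dG.
  by apply/andP; split; lra.
(* The precision of the descriptions; [100] is larger than all the constants
   of [gap_constants]. *)
pose c := Num.min eta r / (100 * (1 + K)).
have K1 : 0 < 1 + K by rewrite ltr_wpDr.
have c0 : 0 < c by rewrite divr_gt0 ?lt_min ?eta0// mulr_gt0.
have cE : 100 * (1 + K) * c <= Num.min eta r.
  by rewrite mulrC divfK// gt_eqF// mulr_gt0.
have ce : 100 * (1 + K) * c <= eta by apply: le_trans cE _; rewrite ge_min lexx.
have cr : 100 * (1 + K) * c <= r by apply: le_trans cE _; rewrite ge_min lexx orbT.
have Kc0 : 0 <= K * c by rewrite mulr_ge0// ltW.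
pose del := c / (2 * (1 + K)).
have del0 : 0 < del by rewrite divr_gt0// mulr_gt0.
have delE : 2 * (1 + K) * del = c by rewrite mulrC divfK// gt_eqF// mulr_gt0.
have Kd0 : 0 <= K * del by rewrite mulr_ge0// ltW.
have [m [p pP]] := circle_net del0.
have [Q QP] := @separated_vectors_bounded m.+1 (2 + kappa) c c0.
exists Q => v z s v0 us sP.
(* Coordinate [0] is the rescaled position of [g x]; the others are the
   rescaled derivatives at the points of the net inside the ball, and [0]
   outside. *)
pose vec g (i : 'I_m.+1) : R := if unlift ord0 i is Some j then
    (if mdist x (p j) < r then cderiv g (p j) / v else 0)
  else crep (g x - z) / v.
apply: (QP _ s vec us).
- move=> g i /sP[[Gg g1 g2] gz]; rewrite /vec; case: unliftP => [j _|_].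
    case: ifP => xp; last by rewrite normr0 addr_ge0// ltW.
    rewrite gtr0_norm ?divr_gt0 ?(diff2_pos (subgroup_diff2 sG Gg))//.
    have /andP[_ h] := g1 _ xp; rewrite ler_pdivrMr//.
    by have := mulr_gt0 kap0 v0; lra.
  rewrite normrM (gtr0_norm (x := v^-1)) ?invr_gt0// ler_pdivrMr//.
  by rewrite mdistE in gz; apply: le_trans gz _; rewrite ler_pM2r//; lra.
move=> g h gs hs gh; apply: contrapT => H.
have [lg gz] := sP g gs; have [lh hz] := sP h hs.
have close i : `|vec g i - vec h i| <= c.
  by rewrite leNgt; apply/negP => ci; apply: H; exists i.
have c_0 : `|crep (g x - z) - crep (h x - z)| <= c * v.
  have := close ord0; rewrite /vec unlift_none -mulrBl normrM.
  by rewrite (gtr0_norm (x := v^-1)) ?invr_gt0// ler_pdivrMr.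
have c_j j : mdist x (p j) < r -> `|cderiv g (p j) - cderiv h (p j)| <= c * v.
  move=> xp; have := close (lift ord0 j); rewrite /vec liftK xp -mulrBl normrM.
  by rewrite (gtr0_norm (x := v^-1)) ?invr_gt0// ler_pdivrMr.
have [Gg g1 g2] := lg; have [Gh h1 h2] := lh.
have der u : mdist x u < 3 / 4 * r -> `|cderiv g u - cderiv h u| <= (2 * c) * v.
  move=> xu; have [j pu] := pP u; have xu' : mdist x u < r by lra.
  have xp : mdist x (p j) < r.
    apply: le_lt_trans (metric_triangle _ u _) _; rewrite [mdist u _]metric_sym; lra.
  have e1 := g2 _ _ xu' xp; have e2 := h2 _ _ xu' xp; have e3 := c_j j xp.
  have e4 : K * v * mdist u (p j) <= K * v * del.
    by rewrite ler_wpM2l ?mulr_ge0 ?(ltW v0)// ltW// metric_sym.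
  have e5 : 2 * (K * v * del) <= c * v.
    by rewrite -delE; have := mulr_gt0 del0 v0; lra.
  by rewrite -mulrA; exact: (distr_le_three e1 e2 e3 e4 e5).
have [k1 k2 k3 k4] := gap_constants c0 Kc0 ce cr.
have [f [Gf fK fclose]] :=
  close_quotient sG r04 K0 v0 (ltW c0) k1 lg lh c_0 der k2 k3 k4.
move: gh => /negP; apply; apply/eqP.
have fh : f \o h = id by apply: gap fclose; exact: subgroup_comp.
by apply/funext => u; have := congr1 (fun k => g (k u)) fh; rewrite /= fK.
Qed.

End Overlap.

(** * Counting the elements of a given contraction rate *)

Section CountingLevel.
Context {R : realType}.
Local Notation S1 := (circle R).
Implicit Types (x y z u w : S1) (g f h : S1 -> S1) (G : set (S1 -> S1)) (L : set S1).

(** Union bound. *)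
Lemma size_le_sum_count (I J : eqType) (s : seq I) (js : seq J) (P : J -> I -> bool) :
  (forall i, i \in s -> exists2 j, j \in js & P j i) ->
  (size s <= \sum_(j <- js) size [seq i <- s | P j i])%N.
Proof.
elim: s => [//|i s IH] H.
have {}IH := IH (fun k ks => H k (mem_behead (s := i :: s) ks)).
have [j jj Pj] := H i (mem_head i s).
rewrite (eq_bigr (fun k => P k i + size [seq l <- s | P k l])%N); last first.
  by move=> k _ /=; case: ifP.
rewrite big_split /= -add1n; apply: leq_add IH.
by rewrite (big_rem j)//= Pj leq_addr.
Qed.

(** Greedy choice: keep an element and discard those at distance at most [d]
    from it. *)
Lemma separated_subseq (I : eqType) (p : I -> S1) (d : R) (Q : nat) (s : seq I) : 0 <= d ->
  uniq s ->
  (forall z s', uniq s' -> {subset s' <= s} -> (forall i, i \in s' -> mdist (p i) z <= d) ->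
    (size s' <= Q)%N) ->
  exists sel, [/\ uniq sel, {subset sel <= s},
    forall i j, i \in sel -> j \in sel -> i != j -> d < mdist (p i) (p j) &
    (size s <= Q * size sel)%N].
Proof.
move=> d0; have [n] := ubnP (size s); elim: n s => // n IH [|i s] sn us HQ.
  by exists [::].
pose P j := mdist (p j) (p i) <= d.
have Pi : P i by rewrite /P mdistxx.
have [||sel [usel ssel dsel ssize]] := IH [seq j <- i :: s | ~~ P j] _ (filter_uniq _ us).
- rewrite /= Pi /= size_filter; apply: leq_ltn_trans (count_size _ _) _.
  by rewrite -ltnS; exact: sn.
- move=> z s' us' ss' Hs'; apply: (HQ z) => // j /ss'; by rewrite mem_filter => /andP[].
exists (i :: sel); split.
- rewrite /= usel andbT; apply/negP => /ssel; by rewrite mem_filter Pi.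
- move=> j; rewrite inE => /orP[/eqP->|/ssel]; first exact: mem_head.
  by rewrite mem_filter => /andP[].
- have far j : j \in sel -> d < mdist (p j) (p i).
    by move=> /ssel; rewrite mem_filter ltNge => /andP[].
  move=> j k; rewrite !inE => /orP[/eqP->|jsel] /orP[/eqP->|ksel].
  + by rewrite eqxx.
  + by move=> _; rewrite metric_sym; exact: far.
  + by move=> _; exact: far.
  + exact: dsel.
- rewrite -(count_predC P) -!size_filter [size (i :: sel)](_ : _ = (size sel).+1)// mulnS leq_add//.
  apply: (HQ (p i)); first exact: filter_uniq.
    by move=> j; rewrite mem_filter => /andP[].
  by move=> j; rewrite mem_filter => /andP[].
Qed.

Lemma bilipschitz_list G (hs : seq (S1 -> S1)) : subgroup G ->
  (forall h, h \in hs -> G h) -> exists2 b : R, 1 <= b & forall h, h \in hs ->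
    forall u w, mdist (h u) (h w) <= b * mdist u w /\ mdist u w <= b * mdist (h u) (h w).
Proof.
move=> sG; elim: hs => [|h hs IH] H; first by exists 1.
have [|b b1 bP] := IH; first by move=> k khs; apply: H; rewrite inE khs orbT.
have Gh : G h by apply: H; rewrite mem_head.
have [h' [Gh' hK h'K]] := subgroup_inv sG Gh.
have [B B0 BP] := diff2_lipschitz (subgroup_diff2 sG Gh).
have [B' B'0 B'P] := diff2_lipschitz (subgroup_diff2 sG Gh').
exists (b + B + B'); first by rewrite -addrA ler_wpDr// addr_ge0// ltW.
have b0 : 0 <= b by apply: le_trans b1.
move=> k; rewrite inE => /orP[/eqP->|/bP kP] u w.
  split; first by apply: le_trans (BP _ _) _; rewrite ler_wpM2r ?mdist_ge0//; lra.
  rewrite -{1}[u]hK -{1}[w]hK; apply: le_trans (B'P _ _) _.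
  by rewrite ler_wpM2r ?mdist_ge0//; lra.
have [k1 k2] := kP u w.
by split; [apply: le_trans k1 _|apply: le_trans k2 _]; rewrite ler_wpM2r ?mdist_ge0//; lra.
Qed.

Lemma closed_cball x (r : R) : closed [set y | mdist x y <= r].
Proof.
rewrite -[X in closed X]setCK; apply: open_closedC; rewrite openE => y /= /negP.
rewrite -ltNge => ry; apply/near_circleP; exists (mdist x y - r); first by rewrite subr_gt0.
move=> z yz /=; apply/negP; rewrite -ltNge.
have := metric_triangle x z y; rewrite [mdist z y]metric_sym; lra.
Qed.

(** Orbits are dense in the minimal set; compactness makes finitely many
    elements sufficient. *)
Lemma return_maps G L x (r : R) : subgroup G -> minimal_set G L -> L x -> 0 < r ->
  exists hs : seq (S1 -> S1), (forall h, h \in hs -> G h) /\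
    forall y, L y -> exists2 h, h \in hs & mdist x (h y) < r.
Proof.
move=> sG mL Lx r0; have [_ cL _ _] := mL.
have cL' : cover_compact L by rewrite -compact_cover; exact: closed_compact_circle.
have [||D DG LD] := cL' (S1 -> S1) G (fun h => [set y | mdist x (h y) < r]°).
- by move=> h _; exact: open_interior.
- move=> y Ly; have [h Gh hy] := minimal_orbit_dense sG mL Ly Lx r0.
  exists h => //; rewrite /interior; have ch := diff2_continuous (subgroup_diff2 sG Gh).
  have [B B0 BP] := diff2_lipschitz (subgroup_diff2 sG Gh).
  apply/near_circleP; exists ((r - mdist (h y) x) / B); first by rewrite divr_gt0// subr_gt0.
  move=> z; rewrite ltr_pdivlMr// mulrC => yz /=.
  have := metric_triangle x (h y) (h z); have := BP y z; rewrite [mdist x (h y)]metric_sym; lra.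
exists (finmap.enum_fset D); split; first by move=> h hD; exact: (set_mem (DG _ hD)).
by move=> y /LD[h hD /interior_subset hy]; exists h.
Qed.

(** For large [v] the overlap bound over a net of the circle is enough.  For
    small [v], among separated elements those followed by the same return map
    form a separated iterated function system on the part of [L] in a smaller
    ball; it shrinks distances at most by [v / (4 b)], so a null [L] does not
    allow [N (v / (4 b))^s >= 1]. *)
Lemma scales_by_counting G L x (r K D s : R) : subgroup G -> locally_discrete G ->
  minimal_set G L -> L x -> 0 < r <= 4^-1 -> 0 <= K -> 0 < D -> 0 < s ->
  hausdorff_measure s L = 0%E ->
  exists2 A : R, 0 <= A & forall (v : R) (gs : seq (S1 -> S1)), 0 < v <= D -> uniq gs ->
    (forall g, g \in gs -> scales_by G x r K v g) -> (size gs)%:R * v `^ s <= A.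
Proof.
move=> sG dG mL Lx r04 K0 D0 s0 HL; have /andP[r0 r4] := r04.
have [_ cL iL _] := mL.
have Linv g y : G g -> L y -> L (g y) by move=> Gg Ly; apply: (iL _ Gg); exists y.
pose rho := r / 2; have rho0 : 0 < rho by rewrite divr_gt0.
have [|Q QP] := @overlap_bounded R G x r K (4 * r) sG dG r04 K0; first by rewrite mulr_gt0.
have [hs [hsG hsP]] := return_maps sG mL Lx (halfr_gt0 rho0).
have [b b1 bP] := bilipschitz_list sG hsG.
have b0 : 0 < b by apply: lt_le_trans b1.
(* Below [v0], a return map followed on the image of the small ball keeps it
   inside that ball. *)
pose v0 := (4 * b)^-1; have v00 : 0 < v0 by rewrite invr_gt0 mulr_gt0.
have bv0 : 4 * b * v0 = 1 by rewrite mulfV// gt_eqF// mulr_gt0.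
have [m [z zP]] := @circle_net R (4 * r * v0) (mulr_gt0 (mulr_gt0 (ltr0Sn _ _) r0) v00).
pose A1 := (m * Q)%:R * D `^ s.
pose A2 := (Q * size hs)%:R * (D `^ s + (4 * b) `^ s).
have Ds0 : 0 <= D `^ s by exact: powR_ge0.
have bs0 : 0 <= (4 * b) `^ s by exact: powR_ge0.
have A10 : 0 <= A1 by rewrite mulr_ge0.
have A20 : 0 <= A2 by rewrite mulr_ge0// addr_ge0.
exists (A1 + A2); first exact: addr_ge0.
move=> v gs /andP[vp vD] ugs gsP.
have vsD : v `^ s <= D `^ s by apply: ge0_ler_powR; rewrite ?nnegrE ?(ltW s0) ?(ltW vp) ?(ltW D0).
case: (ltP v0 v) => vv0.
  apply: (@le_trans _ _ A1); last by rewrite lerDl.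
  apply: ler_pM; rewrite ?powR_ge0// ler_nat.
  apply: leq_trans (size_le_sum_count (js := enum 'I_m)
    (P := fun i g => mdist (g x) (z i) < 4 * r * v) _) _.
    move=> g _; have [i iP] := zP (g x); exists i; first by rewrite mem_enum.
    by rewrite metric_sym; apply: lt_trans iP _; rewrite ltr_pM2l// mulr_gt0.
  apply: (@leq_trans (\sum_(i <- enum 'I_m) Q)%N).
    apply: leq_sum => i _; apply: (QP v (z i)) => //; first exact: filter_uniq.
    by move=> g; rewrite mem_filter => /andP[/ltW ? /gsP].
  by rewrite big_const_seq count_predT size_enum_ord iter_addn_0 mulnC.
apply: (@le_trans _ _ A2); last by rewrite lerDr.
have [||sel [usel ssel dsel ssize]] := @separated_subseq _ (fun g : S1 -> S1 => g x) (4 * r * v) Q gs _ ugs.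
- by rewrite !mulr_ge0 ?(ltW r0) ?(ltW vp).
- by move=> w s' us' ss' Hs'; apply: (QP v w) => // g gs'; split; [exact/gsP/ss'|exact: Hs'].
have vh : v <= 2^-1.
  apply: le_trans vv0 _; rewrite /v0 lef_pV2 ?posrE ?mulr_gt0//; lra.
have key h : h \in hs -> (size [seq g <- sel | mdist x (h (g x)) < rho / 2])%:R * v `^ s
    <= D `^ s + (4 * b) `^ s.
  move=> hhs; set S := [seq g <- sel | _]; have Gh := hsG h hhs.
  have SP g : g \in S -> [/\ g \in sel, scales_by G x r K v g & mdist x (h (g x)) < rho / 2].
    by rewrite mem_filter => /andP[gx gsel]; split => //; exact/gsP/ssel.
  have [S1'|S2] := leqP (size S) 1.
    apply: (@le_trans _ _ (D `^ s)); last by rewrite lerDl.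
    by apply: le_trans vsD; rewrite ler_piMl ?powR_ge0// lern1.
  have vb0 : 0 < v / (4 * b) by rewrite divr_gt0// mulr_gt0.
  apply: (@le_trans _ _ ((4 * b) `^ s)); last by rewrite lerDr.
  rewrite leNgt; apply/negP => big.
  have Nb : 1 <= (size S)%:R * (v / (4 * b)) `^ s.
    have b4 : 0 < (4 * b) `^ s by rewrite powR_gt0// mulr_gt0.
    rewrite powRM ?invr_ge0 ?(ltW vp)//; last by rewrite mulr_ge0// ltW.
    rewrite -powR_inv1; last by rewrite mulr_ge0// ltW.
    rewrite powRAC powR_inv1 ?powR_ge0// mulrA ler_pdivlMr// mul1r.
    exact: ltW.
  pose f (i : 'I_(size S)) : S1 -> S1 := h \o nth id S i.
  pose C := L `&` [set y | mdist x y <= rho].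
  have Sn (i : 'I_(size S)) : nth id S i \in S by apply: mem_nth.
  have inball y : mdist x y <= rho -> mdist x y < r.
    by move=> h1; apply: le_lt_trans h1 _; rewrite /rho; lra.
  have glip g y y' : g \in S -> mdist x y <= rho -> mdist x y' <= rho ->
      mdist (g y) (g y') <= 2 * v * mdist y y'.
    move=> /SP[_ [Gg g1 _] _] /inball h1 /inball h2.
    apply: (ball_lipschitz (subgroup_diff2 sG Gg) r4 _ h1 h2) => w /g1/andP[//].
  have glow g y y' : g \in S -> mdist x y <= rho -> mdist x y' <= rho ->
      v / 4 * mdist y y' <= mdist (g y) (g y').
    move=> /SP[_ [Gg g1 _] _] /inball h1 /inball h2.
    apply: (ball_lower_lipschitz (subgroup_diff2 sG Gg) r4 g1 _ h1 h2).
    apply: (@le_trans _ _ (2 * v * (2 * 4^-1))); last lra.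
    by rewrite ler_wpM2l ?mulr_ge0 ?(ltW vp)// ler_wpM2l.
  have xx : mdist x x <= rho by rewrite mdistxx ltW.
  apply: (@ifs_hausdorff_positive R (size S) f C L (v / (4 * b)) (2 * r * v / b) s) => //.
  - by rewrite divr_gt0// !mulr_gt0.
  - by exists x.
  - by apply: closedI => //; exact: closed_cball.
  - by move=> y [].
  - move=> i y [Ly xy]; have /SP[_ [Gg _ _] hx] := Sn i.
    split; first exact: (Linv h _ Gh (Linv _ _ Gg Ly)).
    have [h1 _] := bP h hhs (nth id S i x) (nth id S i y).
    have h2 := glip _ x y (Sn i) xx xy.
    have h3 : b * mdist (nth id S i x) (nth id S i y) <= b * (2 * v * rho).
      rewrite ler_wpM2l ?(ltW b0)//; apply: le_trans h2 _.
      by rewrite ler_wpM2l// mulr_ge0// ltW.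
    have h4 : b * (2 * v * rho) <= rho / 2.
      have -> : b * (2 * v * rho) = (4 * b * v) * (rho / 2) by lra.
      apply: ler_piMl; first by rewrite divr_ge0// ltW.
      apply: le_trans (_ : 4 * b * v0 <= _); last by rewrite bv0.
      by rewrite ler_wpM2l// mulr_ge0// ltW.
    have := metric_triangle x (h (nth id S i x)) (h (nth id S i y)).
    rewrite /f /=; lra.
  - move=> i y y' [_ xy] [_ xy']; rewrite /f /=.
    have [_ h1] := bP h hhs (nth id S i y) (nth id S i y').
    have h2 := glow _ _ _ (Sn i) xy xy'.
    rewrite invfM mulrA mulrAC ler_pdivrMr// [leRHS]mulrC.
    exact: le_trans h2 h1.
  - move=> i j y y' ij [_ xy] [_ xy']; rewrite /f /=.
    have [_ h1] := bP h hhs (nth id S i y) (nth id S j y').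
    rewrite ler_pdivrMr// [leRHS]mulrC; apply: le_trans h1.
    have nij : nth id S i != nth id S j by rewrite nth_uniq// filter_uniq.
    have [si _ _] := SP _ (Sn i); have [sj _ _] := SP _ (Sn j).
    have h2 := dsel _ _ si sj nij.
    have h3 := glip _ _ _ (Sn i) xx xy; have h4 := glip _ _ _ (Sn j) xx xy'.
    have h5 : 2 * v * mdist x y <= 2 * v * rho by rewrite ler_wpM2l// mulr_ge0// ltW.
    have h6 : 2 * v * mdist x y' <= 2 * v * rho by rewrite ler_wpM2l// mulr_ge0// ltW.
    have t1 := metric_triangle (nth id S i x) (nth id S i y) (nth id S j x).
    have t2 := metric_triangle (nth id S i y) (nth id S j y') (nth id S j x).
    rewrite [mdist (nth id S j y') _]metric_sym in t2.
    have E : 2 * v * rho = r * v by rewrite /rho; lra.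
    rewrite E in h5 h6; lra.
have hsum : (size sel <= \sum_(h <- hs) size [seq g <- sel | (mdist x (h (g x)) < rho / 2)%R])%N.
  apply: (size_le_sum_count (P := fun h g => (mdist x (h (g x)) < rho / 2)%R)) => g /ssel/gsP[Gg _ _].
  by have [h hh hx] := hsP (g x) (Linv _ _ Gg Lx); exists h.
apply: (@le_trans _ _ ((Q * size sel)%:R * v `^ s)).
  by rewrite ler_wpM2r ?powR_ge0// ler_nat.
rewrite /A2 !natrM -!mulrA ler_wpM2l//.
apply: (@le_trans _ _ (\sum_(h <- hs) (size [seq g <- sel | mdist x (h (g x)) < rho / 2])%:R * v `^ s)).
  by rewrite -mulr_suml ler_wpM2r ?powR_ge0// -natr_sum ler_nat.
apply: (@le_trans _ _ (\sum_(h <- hs) (D `^ s + (4 * b) `^ s))).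
  by rewrite big_seq [leRHS]big_seq; apply: ler_sum => h; exact: key.
by rewrite big_const_seq count_predT iter_addr_0 -[leLHS]mulr_natl.
Qed.

End CountingLevel.

(** * The critical exponent is at most the dimension *)

Section DimensionLowerBound.
Context {R : realType}.
Local Notation S1 := (circle R).
Implicit Types (x y z u w : S1) (g f h : S1 -> S1) (G : set (S1 -> S1)) (L : set S1).

(** The image of the ball is not longer than the circle, by injectivity. *)
Lemma cderiv_ball_bound g x (r m : R) : Diff2_plus g -> 0 < r <= 4^-1 ->
  (forall u, mdist x u < r -> m <= cderiv g u) -> m * r <= 1.
Proof.
move=> Dg /andP[r0 r4] gm; rewrite leNgt; apply/negP => mr.
have [phi lp] := diff2_any_lift Dg.
set X := crep x; pose a := X - r / 2; pose b := X + r / 2.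
have ab : a <= b by rewrite /a /b; lra.
have grow : m * (b - a) <= phi b - phi a.
  apply: (derive_lower_bound ab lp.2) => s sI; apply: gm.
  rewrite -[x]crepK; apply: le_lt_trans (mdist_cproj_le _ _) _.
  by move: sI; rewrite /a /b -/X ltr_norml; lra.
have ba : b - a = r by rewrite /a /b; lra.
rewrite ba in grow.
have [||t] := @IVT R phi a b (phi a + 1) ab.
- exact/continuous_subspaceT/(lift_cont lp).
- have pab : phi a <= phi b by exact: (lift_le (diff2_pos Dg) lp).
  by rewrite min_l// max_r//; lra.
rewrite in_itv/= => /andP[at_ tb] pt.
have /(diff2_inj Dg)/cproj_eqP[k kE] : g (cproj t) = g (cproj a).
  rewrite !lp.1 pt; apply/cproj_eqP; exists 1; lra.
have : `|k%:~R : R| < 1 by rewrite -kE ger0_norm; lra.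
move=> /small_int k0; rewrite k0 in kE.
have ta : t = a by apply/eqP; rewrite -subr_eq0 kE.
by rewrite ta in pt; lra.
Qed.

Lemma dist_le_ln (a b m : R) : 0 < a -> 0 < b -> a <= m -> b <= m ->
  `|a - b| <= m * `|ln a - ln b|.
Proof.
wlog ba : a b / b <= a => [H a0 b0 am bm|a0 b0 am _].
  case: (leP b a) => [|/ltW] h; first exact: H.
  by have := H b a h b0 a0 bm am; rewrite distrC [`|ln b - _|]distrC.
have lba : ln b <= ln a by rewrite ler_ln ?posrE.
rewrite !ger0_norm ?subr_ge0//.
apply: (@le_trans _ _ (a * (ln a - ln b))); last by rewrite ler_wpM2r ?subr_ge0.
have := expR_ge1Dx (ln b - ln a); rewrite expRD expRN !lnK ?posrE// => h.
have : a * (1 + (ln b - ln a)) <= a * (b / a) by rewrite ler_pM2l.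
by rewrite mulrCA divff ?gt_eqF// mulr1; lra.
Qed.

Lemma ball_ln_bounds g x (r M : R) : Diff2_plus g -> 0 < r -> 0 <= M ->
  M * r <= ln 2 ->
  (forall u w, mdist x u < r -> mdist x w < r ->
    `|ln (cderiv g u) - ln (cderiv g w)| <= M * mdist u w) ->
  forall u, mdist x u < r -> cderiv g x / 2 <= cderiv g u <= 2 * cderiv g x.
Proof.
move=> Dg r0 M0 Mr gM u xu; have g0 := diff2_pos Dg.
have xx : mdist x x < r by rewrite mdistxx.
have : `|ln (cderiv g x) - ln (cderiv g u)| <= ln 2.
  apply: le_trans (gM _ _ xx xu) _; apply: le_trans Mr.
  by rewrite ler_wpM2l// ltW.
rewrite ler_norml => /andP[h1 h2]; apply/andP; split.
  rewrite ler_pdivrMr// -[leLHS]lnK ?posrE// -[leRHS]lnK ?posrE ?mulr_gt0//.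
  by rewrite ler_expR lnM ?posrE//; lra.
rewrite -[leLHS]lnK ?posrE// -[leRHS]lnK ?posrE ?mulr_gt0//.
by rewrite ler_expR lnM ?posrE//; lra.
Qed.

(** A ball of radius [r] about a base point [x] near [y] lies in the ball on
    which the hypotheses hold, and [r] is so small that the derivative varies by
    a factor at most [2] there. *)
Lemma expanding_scales_by G (eps C r : R) n g x y : subgroup G -> 0 <= C ->
  0 < r <= 4^-1 -> r <= eps / 2 -> C * ln 2 * r <= ln 2 -> G g ->
  (forall u, mdist y u < eps -> 2 ^- n <= cderiv g u) ->
  (distortion g (ball y eps) <= C%:E)%E -> mdist x y < eps / 2 ->
  exists m, 2 ^+ m < 8 / r * 2 ^+ n /\
    scales_by G x r (2 * (C * ln 2)) (8 / r * 2^-1 ^+ m) g.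
Proof.
move=> sG C0 r04 re Cr Gg gn /distortion_ln gd xy; have /andP[r0 r4] := r04.
have Dg := subgroup_diff2 sG Gg; have g0 := diff2_pos Dg.
have l2 : 0 < ln 2 :> R := ln2_gt0.
have yball u : mdist x u < r -> mdist y u < eps.
  move=> xu; apply: le_lt_trans (metric_triangle _ x _) _; rewrite [mdist y x]metric_sym; lra.
have gM u w (xu : mdist x u < r) (xw : mdist x w < r) := gd u w (yball u xu) (yball w xw).
have M0 : 0 <= C * ln 2 by rewrite mulr_ge0// ltW.
have bd := ball_ln_bounds Dg r0 M0 Cr gM.
set a := cderiv g x in bd; have a0 : 0 < a by exact: g0.
have ar : a / 2 * r <= 1.
  by apply: (cderiv_ball_bound Dg r04) => u /bd/andP[].
have a1 : 0 < a * (r / 4) < 1 by rewrite mulr_gt0 ?divr_gt0//; lra.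
have [m [m1 m2]] := dyadic_level a1; exists m.
have p0 : 0 < (2^-1 : R) ^+ m by rewrite exprn_gt0// invr_gt0.
pose v := 8 / r * 2^-1 ^+ m.
have v0 : 0 < v by rewrite mulr_gt0// divr_gt0.
have vr : v * r = 8 * 2^-1 ^+ m by rewrite /v mulrAC divfK// gt_eqF.
have av : v / 2 <= a by rewrite -(ler_pM2r r0) mulrAC vr; lra.
have va : a < v by rewrite -(ltr_pM2r r0) vr; lra.
have xx : mdist x x < r by rewrite mdistxx.
split.
  have na : 2 ^- n < v by apply: le_lt_trans (gn _ (yball _ xx)) va.
  have := na; rewrite /v exprVn -(ltr_pM2r (x := 2 ^+ n)) ?exprn_gt0// mulVf ?gt_eqF ?exprn_gt0//.
  rewrite -(ltr_pM2r (x := 2 ^+ m)) ?exprn_gt0// mul1r => h; apply: lt_le_trans h _.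
  by rewrite mulrAC -[8 / r * _ * _]mulrA mulVf ?gt_eqF ?exprn_gt0// mulr1.
have bv u : mdist x u < r -> v / 4 <= cderiv g u <= 2 * v.
  by move=> /bd/andP[? ?]; apply/andP; split; lra.
split => // u w xu xw; have /andP[_ uv] := bv u xu; have /andP[_ wv] := bv w xw.
apply: le_trans (dist_le_ln (g0 u) (g0 w) uv wv) _.
apply: (@le_trans _ _ (2 * v * (C * ln 2 * mdist u w))).
  by apply: ler_wpM2l; [rewrite mulr_ge0// ltW|exact: (gM u w xu xw)].
by rewrite [2 * (C * ln 2) * v]mulrAC -[leRHS]mulrA.
Qed.

Lemma geometric_sum_le (q : R) P : 1 < q -> \sum_(m < P) q ^+ m <= q ^+ P / (q - 1).
Proof.
move=> q1; rewrite ler_pdivlMr ?subr_gt0// mulrC -subrX1; lra.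
Qed.

Lemma finite_net_in L (r : R) : closed L -> 0 < r ->
  exists xs : seq S1, (forall x, x \in xs -> L x) /\
    forall y, L y -> exists2 x, x \in xs & mdist x y < r.
Proof.
move=> cL r0.
have cL' : cover_compact L by rewrite -compact_cover; exact: closed_compact_circle.
have [||D DL LD] := cL' S1 L (fun x => [set y | mdist x y < r]°).
- by move=> x _; exact: open_interior.
- move=> y Ly; exists y => //; apply/near_circleP; exists r => // z yz; exact: yz.
exists (finmap.enum_fset D); split; first by move=> x xD; exact: (set_mem (DL _ xD)).
by move=> y /LD[x xD /interior_subset xy]; exists x.
Qed.

Lemma uniform_counting G L (xs : seq S1) (r K D s : R) : subgroup G -> locally_discrete G ->
  minimal_set G L -> (forall x, x \in xs -> L x) -> 0 < r <= 4^-1 -> 0 <= K -> 0 < D -> 0 < s ->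
  hausdorff_measure s L = 0%E ->
  exists2 A : R, 0 <= A & forall x, x \in xs -> forall (v : R) (gs : seq (S1 -> S1)),
    0 < v <= D -> uniq gs ->
    (forall g, g \in gs -> scales_by G x r K v g) -> (size gs)%:R * v `^ s <= A.
Proof.
move=> sG dG mL + r04 K0 D0 s0 HL; elim: xs => [|x xs IH] xsL; first by exists 0.
have [|A A0 AP] := IH; first by move=> y yxs; apply: xsL; rewrite inE yxs orbT.
have [B B0 BP] := scales_by_counting sG dG mL (xsL x (mem_head _ _)) r04 K0 D0 s0 HL.
exists (A + B); first exact: addr_ge0.
move=> y; rewrite inE => /orP[/eqP->|/AP yP] v gs vD ugs gsP.
  by apply: le_trans (BP v gs vD ugs gsP) _; rewrite lerDr.
by apply: le_trans (yP v gs vD ugs gsP) _; rewrite lerDl.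
Qed.

(** The elements counted at time [n] are distributed over a finite set of
    base points and over the dyadic scales [8 / r * 2^-m] with [m < n + d + 1];
    the counts [A v^-s] form a geometric series dominated by its last term. *)
Lemma growth_rate_le_dimension G L (eps C s : R) : subgroup G -> locally_discrete G ->
  minimal_set G L -> 0 < eps <= 4^-1 -> 0 <= C -> 0 < s ->
  hausdorff_measure s L = 0%E -> (growth_rate G L eps C <= s%:E)%E.
Proof.
move=> sG dG mL /andP[eps0 eps4] C0 s0 HL; have [_ cL _ _] := mL.
have l2 : 0 < ln 2 :> R := ln2_gt0.
have C1 : 0 < C + 1 by rewrite ltr_wpDl.
(* On balls of radius [r] the logarithm of the derivative varies by at most
   [ln 2]. *)
pose r := Num.min (eps / 2) (C + 1)^-1.
have r0 : 0 < r by rewrite lt_min divr_gt0//= invr_gt0.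
have re : r <= eps / 2 by rewrite ge_min lexx.
have r04 : 0 < r <= 4^-1 by rewrite r0/=; lra.
have Cr : C * ln 2 * r <= ln 2.
  rewrite mulrAC -[leRHS]mul1r ler_wpM2r ?(ltW l2)//.
  apply: (@le_trans _ _ ((C + 1) * (C + 1)^-1)); last by rewrite mulfV// gt_eqF.
  by apply: ler_pM => //; [exact: ltW|rewrite lerDl|rewrite ge_min lexx orbT].
have [xs [xsL xsP]] := finite_net_in cL (halfr_gt0 eps0).
have D0 : 0 < 8 / r by rewrite divr_gt0.
have K0 : 0 <= 2 * (C * ln 2) by rewrite !mulr_ge0// ltW.
have [A A0 AP] := uniform_counting sG dG mL xsL r04 K0 D0 s0 HL.
pose q : R := 2 `^ s.
have q1 : 1 < q by rewrite /q powR2E -[ltLHS]expR0 ltr_expR mulr_gt0.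
have q0 : 0 < q by exact: powR_gt0.
pose d := Num.truncn (8 / r).
have dP : 8 / r <= 2 ^+ d.+1.
  rewrite ltW// (lt_le_trans (truncnS_gt _))// -natrX ler_nat.
  by rewrite -/d ltnW// ltn_expl.
have Ds0 : 0 < (8 / r) `^ s by exact: powR_gt0.
pose B := (size xs)%:R * (A / (8 / r) `^ s) * (q ^+ d.+1 / (q - 1)) + 1.
have B0 : 0 < B.
  rewrite ltr_wpDl// mulr_ge0//; first by rewrite mulr_ge0// divr_ge0// ltW.
  by rewrite divr_ge0 ?exprn_ge0 ?(ltW q0)// subr_ge0 ltW.
apply: (growth_rate_le B0) => n gs ugs gsE.
have qn : 2 `^ (s * n%:R) = q ^+ n by rewrite powRrM powR_mulrn ?powR_ge0.
pose P x m g := `[< scales_by G x r (2 * (C * ln 2)) (8 / r * 2^-1 ^+ m) g >].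
have h1 : (size gs <= \sum_(x <- xs) \sum_(m <- iota 0 (n + d.+1)) size [seq g <- gs | P x m g])%N.
  apply: leq_trans (size_le_sum_count (js := xs)
    (P := fun x g => has (fun m => P x m g) (iota 0 (n + d.+1))) _) _.
    move=> g /gsE[Gg [y Ly [gy gd]]]; have [x xxs xy] := xsP y Ly; exists x => //.
    have [m [mn lm]] := expanding_scales_by sG C0 r04 re Cr Gg gy gd xy.
    apply/hasP; exists m; last exact/asboolP.
    rewrite mem_iota /= add0n ltnNge; apply/negP => nm.
    move: mn; apply/negP; rewrite -leNgt.
    apply: (@le_trans _ _ (2 ^+ (n + d.+1))); last by rewrite ler_weXn2l// ler1n.
    by rewrite exprD mulrC ler_wpM2l.
  apply: leq_sum => x _; apply: leq_trans (size_le_sum_count (js := iota 0 (n + d.+1))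
    (P := fun m g => P x m g) _) _.
    by move=> g; rewrite mem_filter => /andP[/hasP[m mi Pm] _]; exists m.
  apply: leq_sum => m _; apply: uniq_leq_size; first by rewrite !filter_uniq.
  by move=> g; rewrite !mem_filter => /andP[-> /andP[_ ->]].
have h2 x m : x \in xs -> (size [seq g <- gs | P x m g])%:R <= A / (8 / r) `^ s * q ^+ m.
  move=> xxs; have p0 : 0 < (2^-1 : R) ^+ m by rewrite exprn_gt0// invr_gt0.
  have := AP x xxs (8 / r * 2^-1 ^+ m) [seq g <- gs | P x m g].
  rewrite mulr_gt0//= ler_piMr ?(ltW D0)//; last by rewrite exprn_ile1// ?invr_ge0// invf_le1 ?ler1n.
  move=> /(_ isT (filter_uniq _ ugs)) H.
  have {}H := H (fun g => fun gP => asboolW (andP (etrans (esym (mem_filter _ _ _)) gP)).1).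
  move: H; rewrite powRM ?(ltW D0) ?(ltW p0)// powR_half powRN exprVn.
  rewrite mulrA ler_pdivrMr ?exprn_gt0// -ler_pdivlMr// mulrAC.
  by [].
apply: (@le_trans _ _ ((size xs)%:R * (A / (8 / r) `^ s * (q ^+ (n + d.+1) / (q - 1))))).
  apply: (@le_trans _ _ (\sum_(x <- xs) \sum_(m < n + d.+1) A / (8 / r) `^ s * q ^+ m)).
    apply: (@le_trans _ _ (\sum_(x <- xs) \sum_(m <- iota 0 (n + d.+1))
        (size [seq g <- gs | P x m g])%:R)).
      by rewrite -(ler_nat R) natr_sum in h1; under eq_bigr do rewrite -natr_sum; exact: h1.
    rewrite big_seq [leRHS]big_seq; apply: ler_sum => x xxs.
    rewrite -(big_mkord xpredT (fun m => A / (8 / r) `^ s * q ^+ m)) /index_iota subn0.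
    by apply: ler_sum => m _; exact: h2.
  rewrite big_const_seq count_predT iter_addr_0 -[leLHS]mulr_natl ler_wpM2l//.
  rewrite -mulr_sumr ler_wpM2l ?divr_ge0 ?(ltW Ds0)//.
  exact: geometric_sum_le.
rewrite qn exprD /B [leRHS]mulrDl [1 * _]mul1r.
apply: (@le_trans _ _ ((size xs)%:R * (A / (8 / r) `^ s) * (q ^+ d.+1 / (q - 1)) * q ^+ n)).
  rewrite le_eqVlt; apply/orP; left; apply/eqP.
  by move: (q ^+ n) (q ^+ d.+1) (q - 1)^-1 => a b c; ring.
by rewrite lerDl exprn_ge0// ltW.
Qed.

Lemma delta2_le_dim G L : subgroup G -> locally_discrete G -> minimal_set G L ->
  (delta2 G L <= hausdorff_dimension L)%E.
Proof.
move=> sG dG mL; apply: le_ereal_inf_tmp => _ [s [s0 HL] <-].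
apply: (@delta2_le _ _ _ _ 4^-1) => [|eps C eps4]; first by rewrite invr_gt0.
apply: (@le_trans _ _ (growth_rate G L eps `|C|)).
  by apply: growth_rate_mono => //; exact: ler_norm.
exact: growth_rate_le_dimension.
Qed.

End DimensionLowerBound.

Theorem theorem2p21 (R : realType) (G : set (circle R -> circle R))
    (Lambda : set (circle R)) :
  subgroup G ->
  finitely_generated G ->
  locally_discrete G ->
  (forall x : circle R, ~ finite_set (group_orbit G x)) ->
  minimal_set G Lambda ->
  property_star G \/ property_Lambda_star G ->
  hausdorff_dimension Lambda = delta2 G Lambda.
Proof.
move=> sG _ dG iG mL star.
apply/eqP; rewrite eq_le delta2_le_dim// andbT; apply: dim_le_delta2 => // x [nx Lx].
case: star => [[_ H]|[A [[mA _] H]]]; first exact: H.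
by apply: H; split => //; rewrite (minimal_set_unique sG iG mA mL).
Qed.
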